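(* Let $V=(Y,C,0)$ be a quasi strong symmetry of the Brownian-motion-driven SDE $dX^i_t=\mu^i(X_t)dt+\sigma^i_\alpha(X_t)dW^\alpha_t$ on $M$. If the components $Y^i=Y(x^i)$, $i=1,\dots,m$, are polynomials of first degree in $x^1,\dots,x^m$, then $\tilde V=(Y,C)\in\mathcal{V}(M)$ is a weak symmetry of the Euler discretization scheme $F$. If, for a given $x_0\in M$, $\operatorname{span}\{\sigma_1(x_0),\dots,\sigma_k(x_0)\}=\mathbb{R}^m$, then also the converse holds: if $(Y,C)$ is a weak symmetry of the Euler discretization scheme, then the $Y^i$ are polynomials of first degree in $x^1,\dots,x^m$.
   Context: Summation over repeated indices is understood. $M\subset\mathbb{R}^m$ is open with coordinates $x^1,\dots,x^m$; $W$ is a $k$-dimensional Brownian motion; $\mu$ and $\sigma=(\sigma_1,\dots,\sigma_k)$ are smooth coefficients on $M$, $\sigma_\alpha=(\sigma^1_\alpha,\dots,\sigma^m_\alpha)$; $L=\frac12\sum_\alpha\sigma^i_\alpha\sigma^j_\alpha\partial_{x^ix^j}+\mu^i\partial_{x^i}$. ''Polynomial of first degree'' means polynomial of degree at most one. Quasi strong symmetry of the SDE $(\mu,\sigma)$: a triple $(Y,C,0)$ with $Y=Y^i\partial_{x^i}$ a vector field on $M$ and $C:M\to\mathfrak{so}(k)$ smooth such that $Y$ generates a one-parameter group on $M$ and $$Y^i\partial_{x^i}(\mu^j)-L(Y^j)=0,\qquad Y^i\partial_{x^i}(\sigma^j_\alpha)-\sigma^i_\alpha\partial_{x^i}(Y^j)+\sigma^j_\beta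 C^\beta_\alpha=0.$$ Euler scheme: for deterministic times $0=t_0<t_1<\cdots$ with $\Delta t_\ell=t_\ell-t_{\ell-1}$, $\Delta W_\ell=W_{t_\ell}-W_{t_{\ell-1}}$, the scheme is $X_{t_\ell}=F(X_{t_{\ell-1}},\Delta t_\ell,\Delta W_\ell)$ with $$F^i(x,\Delta t,\Delta W)=x^i+\mu^i(x)\Delta t+\sigma^i_\alpha(x)\Delta W^\alpha;$$ it is assumed that $F$ takes values in $M$ (e.g. $M=\mathbb{R}^m$). It is viewed as an equation driven by the process $Z$ on $\mathbb{R}^{k+1}$, $Z^0_t=\sum_\ell t_\ell I_{[t_\ell,t_{\ell+1})}(t)$, $Z^\alpha_t=\sum_\ell W^\alpha_{t_\ell}I_{[t_\ell,t_{\ell+1})}(t)$; a solution is a pair $(X,Z')$ with $Z'$ having the law of $Z$ and $X_{t_\ell}=F(X_{t_{\ell-1}},\Delta Z'_{t_\ell})$, adapted to a filtration for which the jumps of $Z'$ are those of a discretized Brownian motion. Weak symmetries of the scheme: a pair $T=(\Phi,B)$ with $\Phi:M\to M$ a diffeomorphism and $B:M\to O(k)$ smooth acts on solutions by $P_T(X,Z)=(X',Z')$ with $X'_{t_\ell}=\Phi(X_{t_\ell})$, $\Delta Z'^\alpha_{t_\ell}=B^\alpha_\beta(X_{t_{\ell-1}})\Delta Z^\beta_{t_\ell}$, $\Delta Z'^0_{t_\ell}=\Delta t_\ell$. $T$ is a weak symmetry of the scheme if $P_T$ maps solutions to solutions of the same scheme. $\mathcal{V}(M)$ denotes here the pairs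 $(Y,C)$ with $Y$ a vector field on $M$ and $C:M\to\mathfrak{so}(k)$ smooth; $(Y,C)$ is a weak symmetry of the scheme if all $T_a=(\Phi_a,B_a)$ are, where $\partial_a\Phi_a(x)=Y(\Phi_a(x))$, $\partial_aB_a(x)=C(\Phi_a(x))B_a(x)$, $\Phi_0=\mathrm{id}$, $B_0=I_k$. *)

(* Defs.v *)
From HB Require Import structures.
From mathcomp Require Import all_boot all_order all_algebra.
From mathcomp Require Import all_classical all_reals all_analysis.
Set Implicit Arguments.
Unset Strict Implicit.
Unset Printing Implicit Defensive.
Import Order.TTheory GRing.Theory Num.Theory.
Import numFieldNormedType.Exports.
Local Open Scope classical_set_scope.
Local Open Scope ring_scope.

(* Points of R^m are column vectors, and a matrix-valued coefficient is indexed
   as  s x i a = sigma^i_a(x)  and  C x b a = C^b_a(x).  Functions on the open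
   set M are total functions whose values outside M are never constrained. *)

Section Smooth.
Context {R : realType} {m : nat}.
Implicit Types (M : set 'cV[R]_m) (f : 'cV[R]_m -> R).

Definition partial (i : 'I_m) f : 'cV[R]_m -> R :=
  fun x => 'D_(delta_mx i 0) f x.

Fixpoint Cn_on (n : nat) M f : Prop :=
  (forall x, M x -> {for x, continuous f}) /\
  match n with
  | 0%N => True
  | p.+1 => forall i : 'I_m,
      (forall x, M x -> derivable f x (delta_mx i 0)) /\ Cn_on p M (partial i f)
  end.

Definition smooth_on M (p q : nat) (g : 'cV[R]_m -> 'M[R]_(p, q)) : Prop :=
  forall n i j, Cn_on n M (fun x => g x i j).

Definition first_degree_on M f : Prop :=
  exists (c : R) (l : 'I_m -> R),
    forall x, M x -> f x = c + \sum_i l i * x i 0.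

Definition diffeo_on M (Phi : 'cV[R]_m -> 'cV[R]_m) : Prop :=
  exists Psi : 'cV[R]_m -> 'cV[R]_m,
    [/\ forall x, M x -> M (Phi x) /\ Psi (Phi x) = x,
        forall x, M x -> M (Psi x) /\ Phi (Psi x) = x,
        smooth_on M Phi & smooth_on M Psi].

(* The action  Y^i d_i f  of the vector field Y on the function f. *)
Definition lie (Y : 'cV[R]_m -> 'cV[R]_m) f : 'cV[R]_m -> R :=
  fun x => \sum_i Y x i 0 * partial i f x.

Definition flow_on M (Y : 'cV[R]_m -> 'cV[R]_m)
    (Phi : R -> 'cV[R]_m -> 'cV[R]_m) : Prop :=
  forall x, M x ->
    Phi 0 x = x /\
    forall a : R, M (Phi a x) /\
      is_derive a (1 : R) (fun b : R => Phi b x) (Y (Phi a x)).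

End Smooth.

Section SDE.
Context {R : realType} {m k : nat}.
Variables (M : set 'cV[R]_m).
Variables (mu : 'cV[R]_m -> 'cV[R]_m) (sigma : 'cV[R]_m -> 'M[R]_(m, k)).

Definition generator (f : 'cV[R]_m -> R) : 'cV[R]_m -> R := fun x =>
  2^-1 * (\sum_(a < k) \sum_i \sum_j
            sigma x i a * sigma x j a * partial i (partial j f) x)
  + \sum_i mu x i 0 * partial i f x.

Definition quasi_strong_symmetry (Y : 'cV[R]_m -> 'cV[R]_m)
    (C : 'cV[R]_m -> 'M[R]_k) : Prop :=
  [/\ smooth_on M Y /\ smooth_on M C,
      forall x, M x -> (C x)^T = - C x,
      exists Phi, flow_on M Y Phi,
      forall x, M x -> forall j,
        lie Y (fun y => mu y j 0) x - generator (fun y => Y y j 0) x = 0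
    & forall x, M x -> forall (j : 'I_m) (a : 'I_k),
        lie Y (fun y => sigma y j a) x
        - \sum_i sigma x i a * partial i (fun y => Y y j 0) x
        + \sum_b sigma x j b * C x b a = 0].

Definition euler (x : 'cV[R]_m) (dt : R) (dw : 'cV[R]_k) : 'cV[R]_m :=
  x + dt *: mu x + sigma x *m dw.

End SDE.

Section Scheme.
Context {R : realType}.

Definition time_grid (t : nat -> R) : Prop :=
  t 0%N = 0 /\ forall l, t l < t l.+1.

Definition grid_step (t : nat -> R) (l : nat) : R := t l.+1 - t l.

(* All processes are piecewise constant on the intervals [t_l, t_(l+1)), so
   they are represented by the sequence of their values at the grid times. *)

Definition filtration d (T : measurableType d) (G : nat -> set (set T)) : Prop :=
  [/\ forall l, sigma_algebra setT (G l),
      forall l, G l `<=` measurable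
    & forall l, G l `<=` G l.+1].

Definition adapted d (T : measurableType d) (G : nat -> set (set T)) (n : nat)
    (X : nat -> T -> 'cV[R]_n) : Prop :=
  forall l (i : 'I_n) (A : set R), measurable A ->
    G l ((fun w => X l w i 0) @^-1` A).

Definition jump (T : Type) (n : nat) (Z : nat -> T -> 'cV[R]_n) (l : nat) (w : T)
  : 'cV[R]_n := Z l.+1 w - Z l w.

(* Z = (Z^0, Z^1, ..., Z^k) is adapted to G and has the law of the discretized
   pair (time, Brownian motion).  In the last clause, S = setT says that the
   increment of (Z^1, ..., Z^k) has law N(0, dt * I_k), and a general S adds
   that it is independent of G l. *)
Definition discretized_brownian (t : nat -> R) (k : nat)
    d (T : measurableType d) (P : probability T R) (G : nat -> set (set T))
    (Z : nat -> T -> 'cV[R]_(1 + k)) : Prop :=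
  [/\ adapted G Z,
      {ae P, forall w, Z 0%N w = 0},
      forall l, {ae P, forall w, Z l w 0 0 = t l}
    & forall l (S : set T) (A : 'I_k -> set R),
        G l S -> (forall a, measurable (A a)) ->
        P (S `&` [set w | forall a, A a (dsubmx (jump Z l w) a 0)]) =
        (P S * \prod_(a < k) normal_prob 0 (Num.sqrt (grid_step t l)) (A a))%E].

Definition euler_solution (t : nat -> R) (m k : nat) (M : set 'cV[R]_m)
    (mu : 'cV[R]_m -> 'cV[R]_m) (sigma : 'cV[R]_m -> 'M[R]_(m, k))
    d (T : measurableType d) (P : probability T R)
    (X : nat -> T -> 'cV[R]_m) (Z : nat -> T -> 'cV[R]_(1 + k)) : Prop :=
  exists G : nat -> set (set T),
    [/\ filtration G,
        adapted G X /\ (forall l w, M (X l w)),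
        discretized_brownian t P G Z
      & forall l, {ae P, forall w,
          X l.+1 w =
          euler mu sigma (X l w) (jump Z l w 0 0) (dsubmx (jump Z l w))}].

(* The two components of P_T (X, Z) for T = (Phi, B); the second one is the
   process started at 0 whose jumps are (dt_l, B(X_(t_(l-1))) dZ_(t_l)). *)
Definition transform_state (m : nat) (Phi : 'cV[R]_m -> 'cV[R]_m) (T : Type)
    (X : nat -> T -> 'cV[R]_m) : nat -> T -> 'cV[R]_m :=
  fun l w => Phi (X l w).

Definition transform_driver (t : nat -> R) (m k : nat)
    (B : 'cV[R]_m -> 'M[R]_k) (T : Type)
    (X : nat -> T -> 'cV[R]_m) (Z : nat -> T -> 'cV[R]_(1 + k)) :
    nat -> T -> 'cV[R]_(1 + k) :=
  fun l w => \sum_(j < l)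
    col_mx (grid_step t j)%:M (B (X j w) *m dsubmx (jump Z j w)).

Definition euler_weak_symmetry (t : nat -> R) (m k : nat) (M : set 'cV[R]_m)
    (mu : 'cV[R]_m -> 'cV[R]_m) (sigma : 'cV[R]_m -> 'M[R]_(m, k))
    (Phi : 'cV[R]_m -> 'cV[R]_m) (B : 'cV[R]_m -> 'M[R]_k) : Prop :=
  [/\ diffeo_on M Phi,
      smooth_on M B,
      forall x, M x -> B x *m (B x)^T = 1%:M
    & forall d (T : measurableType d) (P : probability T R) X Z,
        euler_solution t M mu sigma P X Z ->
        euler_solution t M mu sigma P
          (transform_state Phi X) (transform_driver t B X Z)].

(* (Y, C) generates T_a = (Phi a, B a) through the two differential equations;
   Phi and B are unique on M. *)
Definition euler_infinitesimal_weak_symmetry (t : nat -> R) (m k : nat)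
    (M : set 'cV[R]_m)
    (mu : 'cV[R]_m -> 'cV[R]_m) (sigma : 'cV[R]_m -> 'M[R]_(m, k))
    (Y : 'cV[R]_m -> 'cV[R]_m) (C : 'cV[R]_m -> 'M[R]_k) : Prop :=
  exists (Phi : R -> 'cV[R]_m -> 'cV[R]_m) (B : R -> 'cV[R]_m -> 'M[R]_k),
    [/\ flow_on M Y Phi,
        forall x, M x -> B 0 x = 1%:M /\
          forall a : R,
            is_derive a (1 : R) (fun b : R => B b x) (C (Phi a x) *m B a x)
      & forall a : R, euler_weak_symmetry t M mu sigma (Phi a) (B a)].

End Scheme.

(* Main.v *)
(** If Y is affine, so is its flow: Phi_a x = E_a x + v_a on M with E_a' = A E_a.
    Differentiating mu(Phi_a x) and sigma(Phi_a x) B_a(x) along the flow, the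
    determining equations say that these curves solve the same linear equation
    as E_a mu(x) and E_a sigma(x) (the second order part of L(Y) vanishes), hence
      Phi_a(x + mu dt + sigma w) = Phi_a x + mu(Phi_a x) dt + sigma(Phi_a x) B_a(x) w.
    The transformed increments B_a(X_l) dW_l are again Gaussian and independent of
    the past, because B_a(X_l) is orthogonal and known at time l: testing with
    products of narrow Gaussian densities, the rotation moves to the centres of
    the densities, which do not affect the integral over dW_l by symmetry.

    Conversely, an Euler solution started at x0 exists (an independent Gaussian
    sequence is extracted from the binary digits of a uniform variable), so the
    displayed identity holds at x0 for almost every w, hence for every w as
    Gaussian laws have full support.  Since sigma(x0) is onto, M is the whole
    space and every Phi_a is affine, and so is Y, its derivative at a = 0. *)
Require Import Defs.
From HB Require Import structures.
From mathcomp Require Import all_boot all_order all_algebra.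
From mathcomp Require Import all_classical all_reals all_analysis.
From mathcomp Require Import ring lra measurable_realfun.
Set Implicit Arguments.
Unset Strict Implicit.
Unset Printing Implicit Defensive.
Import Order.TTheory GRing.Theory Num.Theory.
Import numFieldNormedType.Exports.
Local Open Scope classical_set_scope.
Local Open Scope ring_scope.

(** * Derivatives and the Gronwall inequality *)

(** A weak symmetry must have every [B a] smooth on [M], and [B] solves a linear equation whose
    coefficients depend on the starting point; most of the analysis serves this one requirement.
    That the flow is affine helps a second time here: partial derivatives of [C (Phi s x)] in x are
    combinations of functions of the same kind with coefficients depending on time only, so no
    theory of nonlinear flows is called for. On the probabilistic side, independence of the past is
    given on products of sets, one factor per coordinate, while [B] mixes the coordinates. A product
    of Gaussian densities of equal width survives this: it depends only on the distance to its
    centre, so after rotation it is again a product over the original coordinates, with a random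
    centre known at time l. Sets are recovered by integrating over the centres and letting the width
    tend to 0; the limit is never computed, because the identity rotation produces the same numbers.
    For the converse, preservation of solutions says nothing until a solution is exhibited; of the
    one built from [x0] only the first step is used. *)

Section PointwiseDerive.
Context {R : realType} {V : normedModType R}.
Implicit Types (f g : V -> R) (x v : V) (a b : R).

Lemma is_derive_add f g x v a b : is_derive x v f a -> is_derive x v g b ->
  is_derive x v (fun z => f z + g z) (a + b).
Proof. by move=> fa gb; exact: (@is_deriveD _ _ _ f g). Qed.

Lemma is_derive_sub f g x v a b : is_derive x v f a -> is_derive x v g b ->
  is_derive x v (fun z => f z - g z) (a - b).
Proof. by move=> fa gb; exact: (@is_deriveB _ _ _ f g). Qed.

Lemma is_derive_opp f x v a : is_derive x v f a ->
  is_derive x v (fun z => - f z) (- a).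
Proof. by move=> fa; exact: (@is_deriveN _ _ _ f). Qed.

Lemma is_derive_mul f g x v a b : is_derive x v f a -> is_derive x v g b ->
  is_derive x v (fun z => f z * g z) (a * g x + f x * b).
Proof.
move=> fa gb; have h := @is_deriveM _ _ f g x v _ _ fa gb.
by apply: (is_derive_eq h); rewrite /GRing.scale/= addrC [g x * a]mulrC.
Qed.

Lemma is_derive_const x v a : is_derive x v (fun _ => a : R) 0.
Proof. exact: is_derive_cst. Qed.

Lemma is_derive_scal f x v a c : is_derive x v f a ->
  is_derive x v (fun z => c * f z) (c * a).
Proof. by move=> fa; exact: (@is_deriveZ _ _ _ f). Qed.

Lemma is_derive_bigsum n (h : 'I_n -> V -> R) x v (dh : 'I_n -> R) :
  (forall i, is_derive x v (h i) (dh i)) ->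
  is_derive x v (fun z => \sum_i h i z) (\sum_i dh i).
Proof.
move=> hd; have := @is_derive_sum _ _ _ _ h x v dh hd.
by congr (is_derive _ _ _ _); apply/funext => z; rewrite fct_sumE.
Qed.

End PointwiseDerive.

Lemma is_derive_exp_scal {R : realType} (B z : R) :
  is_derive z (1 : R) (fun z => expR (B * z)) (B * expR (B * z)).
Proof.
have h := @is_derive_scal R _ (@id R) z (1 : R) (1 : R) B (is_derive_id _ _).
have := @is_derive1_comp _ (@expR R) (fun z => B * z) z _ _ (is_derive_expR _) h.
by rewrite mulr1 mulrC.
Qed.

Section Primitive.
Context {R : realType}.
Local Notation lebesgue := (@lebesgue_measure R).

Lemma is_derive_continuous (f : R -> R) (x df : R) :
  is_derive x (1 : R) f df -> {for x, continuous f}.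
Proof. by case=> fx _; apply/differentiable_continuous/derivable1_diffP. Qed.

Lemma is_derive_le (f df : R -> R) (a b : R) : a <= b ->
  (forall x : R, a <= x <= b -> is_derive x (1 : R) f (df x)) ->
  (forall x : R, a <= x <= b -> 0 <= df x) -> f a <= f b.
Proof.
move=> ab fd d0; rewrite -subr_ge0.
have [| |x + ->] := @MVT_segment R f df a b ab.
- by move=> x; rewrite in_itv/= => /andP[/ltW ax /ltW xb]; apply: fd; rewrite ax.
- apply: derivable_within_continuous => x; rewrite in_itv/= => xab.
  by case: (fd x xab).
- by rewrite in_itv/= => xab; rewrite mulr_ge0 ?d0// subr_ge0.
Qed.

Lemma is_derive0_eq (f : R -> R) (a b : R) : a <= b ->
  (forall x : R, a <= x <= b -> is_derive x (1 : R) f 0) -> f a = f b.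
Proof.
move=> ab fd; apply/eqP; rewrite eq_le; apply/andP; split.
  exact: (is_derive_le (df := fun=> 0) ab).
rewrite -lerN2; apply: (is_derive_le (f := fun x => - f x) (df := fun=> 0) ab) => [|//].
by move=> x xab; rewrite -oppr0; apply: is_deriveN; exact: fd.
Qed.

Lemma continuous_has_primitive (f : R -> R) : continuous f ->
  exists F : R -> R, F 0 = 0 /\ forall x : R, is_derive x (1 : R) F (f x).
Proof.
move=> cf.
pose I (a x : R) := \int[lebesgue]_(t in `[a, x]) f t.
have fi (a b : R) : lebesgue.-integrable `[a, b] (EFin \o f).
  apply: continuous_compact_integrable; first exact: segment_compact.
  exact: continuous_subspaceT.
have dI (a x : R) : a < x -> is_derive x (1 : R) (I a) (f x).
  move=> ax; have xu : x < x + 1 by rewrite ltrDl.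
  have [d e] := @continuous_FTC1_closed _ f a x (x + 1) xu (fi _ _) ax (cf x).
  by apply: (DeriveDef d); rewrite -derive1E; exact: e.
have Iab (a b x y : R) : a < x -> b < x -> x <= y -> I a x - I b x = I a y - I b y.
  move=> ax bx xy; apply: (is_derive0_eq (f := fun z => I a z - I b z)) => //.
  move=> z /andP[xz _]; rewrite -(subrr (f z)).
  by apply: is_deriveB; apply: dI; apply: lt_le_trans xz.
have {}Iab (a b x y : R) : a < x -> b < x -> a < y -> b < y ->
    I a x - I a y = I b x - I b y.
  move=> ax bx ay byy; case: (leP x y) => [xy|/ltW yx].
    by have := Iab _ _ _ _ ax bx xy; lra.
  by have := Iab _ _ _ _ ay byy yx; lra.
(* The fundamental theorem applies strictly to the right of the base point, so the base point moves
   with x and stays to the left of both x and 0. By [Iab] the differences of values do not depend on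
   it. *)
pose a (x : R) : R := - `|x| - 1.
have ax x : a x < x by rewrite /a; have := ler_norm (- x); rewrite normrN; lra.
have a0 x : a x < 0 by rewrite /a; have := normr_ge0 x; lra.
exists (fun x => I (a x) x - I (a x) 0); split; first by rewrite subrr.
(* One more unit to the left, so that the fixed base [b] serves every z within distance 1 of x. *)
move=> x; pose b := a x - 1.
have bx : b < x by rewrite /b; have := ax x; lra.
have db : is_derive x (1 : R) (fun z => I b z - I b 0) (f x).
  by rewrite -[f x]subr0; apply: is_deriveB; exact: dI.
apply: (near_eq_is_derive _ db).
near=> z; have zx : `|x - z| < 1 by near: z; apply: cvgr_dist_lt => //; exact: cvg_id.
apply: Iab => //; rewrite /b /a.
- by have := ler_norm (x - z); have := ler_norm (- x); rewrite normrN; lra.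
- by have := normr_ge0 x; lra.
Unshelve. all: by end_near. Qed.

(** The function [d z - q z exp (- K z)] is nondecreasing on nonnegative times: its derivative is at
    least [d (1 - exp (- K z))]. *)
Lemma gronwall_pos (q dq : R -> R) (K d T : R) : 0 <= K -> 0 <= d ->
  (forall s : R, 0 <= s <= T -> is_derive s (1 : R) q (dq s)) ->
  (forall s : R, 0 <= s <= T -> dq s <= K * q s + d) ->
  forall s, 0 <= s <= T -> q s <= (q 0 + d * s) * expR (K * s).
Proof.
move=> K0 d0 qd qb s /andP[s0 sT].
have sub z : 0 <= z <= s -> 0 <= z <= T.
  by move=> /andP[-> zs]; rewrite (le_trans zs sT).
pose g (z : R) : R := d * z - q z * expR (- K * z).
have : g 0 <= g s.
  apply: (is_derive_le (df := fun z => d - (dq z - K * q z) * expR (- K * z)) s0).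
    move=> z /sub zT; rewrite /g; have qz := qd _ zT.
    have e3 := is_derive_scal d (@is_derive_id _ _ z (1 : R)).
    have e4 := is_derive_sub e3 (is_derive_mul qz (is_derive_exp_scal (- K) z)).
    by apply: (is_derive_eq e4); ring.
  move=> z zs; have zT := sub z zs; have qz := qb _ zT.
  have e1 : expR (- K * z) <= 1.
    by rewrite -expR0 ler_expR mulNr oppr_le0 mulr_ge0//; case/andP: zs.
  rewrite subr_ge0; apply: (@le_trans _ _ (d * expR (- K * z))).
    by rewrite ler_wpM2r ?expR_ge0//; lra.
  by rewrite ler_piMr.
rewrite /g !mulr0 expR0 mulr1 sub0r => h.
have -> : q s = q s * expR (- K * s) * expR (K * s).
  by rewrite -mulrA -expRD mulNr addNr expR0 mulr1.
by rewrite ler_wpM2r ?expR_ge0//; lra.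
Qed.

Lemma is_derive_comp_opp (f : R -> R) (s df : R) : is_derive (- s) (1 : R) f df ->
  is_derive s (1 : R) (fun z => f (- z)) (- df).
Proof.
move=> h; rewrite -mulrN1.
apply: (@is_derive1_comp _ f (fun z => - z)) => //.
Qed.

(** The bound is on the absolute value of the derivative so that time reversal preserves it; this
    reduces negative times to [gronwall_pos]. *)
Lemma gronwall (q dq : R -> R) (K d T : R) : 0 <= K -> 0 <= d ->
  (forall s : R, `|s| <= T -> is_derive s (1 : R) q (dq s)) ->
  (forall s : R, `|s| <= T -> `|dq s| <= K * q s + d) ->
  forall s, `|s| <= T -> q s <= (q 0 + d * `|s|) * expR (K * `|s|).
Proof.
move=> K0 d0 qd qb s sT; have aT z : 0 <= z <= T -> `|z| <= T.
  by move=> /andP[z0 zT]; rewrite ger0_norm.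
have [s0|/ltW s0] := leP 0 s.
  rewrite !ger0_norm//; apply: (gronwall_pos (dq := dq) (T := T)) => //.
  - by move=> z /aT; apply: qd.
  - by move=> z /aT /qb; apply: le_trans; exact: ler_norm.
  - by rewrite s0 -(ger0_norm s0).
rewrite ler0_norm// -{1}(opprK s) -{1}[0]oppr0.
apply: (gronwall_pos (q := fun z => q (- z)) (dq := fun z => - dq (- z)) (T := T)) => //.
- by move=> z /aT zT; apply: is_derive_comp_opp; apply: qd; rewrite normrN.
- move=> z /aT zT; apply: le_trans (ler_norm _) _; rewrite normrN.
  by apply: qb; rewrite normrN.
- by rewrite oppr_ge0 s0 -(ler0_norm s0).
Qed.

(** Integration gains a factor [1 / B] when growth is measured against [exp (B |s|)]. With [B] twice
    a Lipschitz constant, each Picard step halves distances, however long the time interval. *)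
Lemma is_derive_exp_bound (F f : R -> R) (A B T : R) : 0 <= A -> 0 < B -> F 0 = 0 ->
  (forall s : R, `|s| <= T -> is_derive s (1 : R) F (f s)) ->
  (forall s : R, `|s| <= T -> `|f s| <= A * expR (B * `|s|)) ->
  forall s, `|s| <= T -> `|F s| <= A / B * expR (B * `|s|).
Proof.
move=> A0 B0 F0 Fd fb.
have e1 (z : R) : is_derive z (1 : R) (fun z => A / B * expR (B * z)) (A * expR (B * z)).
  apply: (is_derive_eq (is_derive_scal (A / B) (is_derive_exp_scal B z))).
  rewrite mulrA divfK//.
  by rewrite gt_eqF.
have pos (G g : R -> R) : G 0 = 0 ->
  (forall s : R, 0 <= s <= T -> is_derive s (1 : R) G (g s)) ->
  (forall s : R, 0 <= s <= T -> `|g s| <= A * expR (B * s)) ->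
  forall s, 0 <= s <= T -> G s <= A / B * expR (B * s).
  move=> G0 Gd gb s /andP[s0 sT].
  have sub z : 0 <= z <= s -> 0 <= z <= T.
    by move=> /andP[-> zs]; rewrite (le_trans zs sT).
  have : A / B * expR (B * 0) - G 0 <= A / B * expR (B * s) - G s.
    apply: (is_derive_le (f := fun z => A / B * expR (B * z) - G z)
       (df := fun z => A * expR (B * z) - g z) s0).
      by move=> z /sub zT; exact: is_derive_sub (e1 z) (Gd z zT).
    by move=> z /sub zT; rewrite subr_ge0; apply: le_trans (gb _ zT); exact: ler_norm.
  rewrite G0 subr0 mulr0 expR0 mulr1 => h.
  by rewrite -subr_ge0; apply: le_trans h; rewrite divr_ge0// ltW.
have aT z : 0 <= z <= T -> `|z| <= T.
  by move=> /andP[z0 zT]; rewrite ger0_norm.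
have aTN z : 0 <= z <= T -> `|- z| <= T by rewrite normrN; exact: aT.
have gz z : 0 <= z <= T -> `|z| = z by case/andP=> z0 _; exact: ger0_norm.
have {}pos (G g : R -> R) : G 0 = 0 ->
  (forall s : R, 0 <= s <= T -> is_derive s (1 : R) G (g s)) ->
  (forall s : R, 0 <= s <= T -> `|g s| <= A * expR (B * s)) ->
  forall s, 0 <= s <= T -> `|G s| <= A / B * expR (B * s).
  move=> G0 Gd gb s sT; rewrite ler_norml (pos G g)// andbT lerNl.
  apply: (pos (fun z => - G z) (fun z => - g z)) => //; first by rewrite G0 oppr0.
    by move=> z zT; apply: is_derive_opp; exact: Gd.
  by move=> z zT; rewrite normrN gb.
move=> s sT; have [s0|/ltW s0] := leP 0 s.
  rewrite (ger0_norm s0); apply: (pos F f) => //.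
  - by move=> z zT; apply: Fd; exact: aT.
  - by move=> z zT; have := fb _ (aT z zT); rewrite (gz z zT).
  - by rewrite s0 -(ger0_norm s0).
rewrite (ler0_norm s0) -{1}(opprK s).
apply: (pos (fun z => F (- z)) (fun z => - f (- z))) => //; first by rewrite oppr0.
- by move=> z zT; apply: is_derive_comp_opp; apply: Fd; exact: aTN.
- by move=> z zT; have := fb _ (aTN z zT); rewrite !normrN (gz z zT).
- by rewrite oppr_ge0 s0 -(ler0_norm s0).
Qed.

End Primitive.

(** * Linear differential equations *)

Section LinearODE.
Context {R : realType}.

Lemma cvg_bigsum (U : Type) (F : set_system U) {FF : Filter F} (I : Type) (r : seq I)
    (f : I -> U -> R) (l : I -> R) :
  (forall i, f i x @[x --> F] --> l i) ->
  (\sum_(i <- r) f i x) @[x --> F] --> \sum_(i <- r) l i.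
Proof.
move=> fl; elim: r => [|i r IH].
  rewrite big_nil (_ : (fun x => _) = fun=> 0); first exact: cvg_cst.
  by apply/funext => x; rewrite big_nil.
rewrite big_cons (_ : (fun x => _) = fun x => f i x + \sum_(j <- r) f j x).
  exact: cvgD.
by apply/funext => x; rewrite big_cons.
Qed.

Lemma continuous_bounded_segment (f : R -> R) (T : R) : continuous f ->
  exists2 K : R, 0 <= K & forall s, `|s| <= T -> `|f s| <= K.
Proof.
move=> cf; have [T0|T0] := leP 0 T; last first.
  by exists 0 => // s sT; have := normr_ge0 s; lra.
have nT : - T <= T by lra.
have cf' : {within `[- T, T], continuous (fun x => `|f x|)}.
  apply: continuous_subspaceT => x; exact: (continuous_comp (cf x) (@norm_continuous _ _ _)).
have [c _ h] := EVT_max nT cf'.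
exists `|f c| => // s sT; apply: h; rewrite in_itv/= -ler_norml//.
Qed.

Lemma matrix_bounded_segment N p (D : R -> 'M[R]_(N, p)) (T : R) :
  (forall i j, continuous (fun s => D s i j)) ->
  exists2 K : R, 0 <= K & forall s, `|s| <= T -> forall i j, `|D s i j| <= K.
Proof.
move=> cD.
have /choice[K KP] : forall ij : 'I_N * 'I_p, exists K : R, 0 <= K /\
    forall s, `|s| <= T -> `|D s ij.1 ij.2| <= K.
  by move=> ij; have [K K0 h] := continuous_bounded_segment T (cD ij.1 ij.2); exists K.
exists (\sum_ij K ij); first by apply: sumr_ge0 => ij _; case: (KP ij).
move=> s sT i j; apply: le_trans (_ : K (i, j) <= _); first by apply: (KP (i, j)).2.
by rewrite (bigD1 (i, j))//= lerDl; apply: sumr_ge0 => ij _; case: (KP ij).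
Qed.

(** Let [g n] be the tail [2 C / 2^n] of the geometric series. Then [a - g] increases, [a + g]
    decreases, and both squeeze the limit, which gives convergence and its rate together. *)
Lemma cauchy_geometric (a : nat -> R) (C : R) : 0 <= C ->
  (forall n, `|a n.+1 - a n| <= C * 2^-1 ^+ n) ->
  a n @[n --> \oo] --> limn a /\
  forall n, `|limn a - a n| <= 2 * C * 2^-1 ^+ n.
Proof.
move=> C0 aC.
pose g n : R := 2 * C * 2^-1 ^+ n.
have g0 n : 0 <= g n by rewrite /g !mulr_ge0 ?exprn_ge0 ?invr_ge0.
have gS n : g n.+1 = g n - C * 2^-1 ^+ n by rewrite /g exprS; field.
have gcv : g n @[n --> \oo] --> (0 : R).
  rewrite -[0](mulr0 (2 * C)); apply: cvgM; first exact: cvg_cst.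
  by apply: cvg_expr; rewrite ger0_norm ?invr_ge0// invf_lt1 ?ltr1n.
have ab n : - (C * 2^-1 ^+ n) <= a n.+1 - a n <= C * 2^-1 ^+ n.
  by rewrite -ler_norml.
have inc : nondecreasing_seq (fun n => a n - g n).
  by apply/nondecreasing_seqP => n; rewrite gS; have := ab n; lra.
have dec : nonincreasing_seq (fun n => a n + g n).
  by apply/nonincreasing_seqP => n; rewrite gS; have := ab n; lra.
have ub n m : a n - g n <= a m + g m.
  have := inc n (maxn n m) (leq_maxl _ _); have := dec m (maxn n m) (leq_maxr _ _).
  by have := g0 (maxn n m); lra.
have bcv : (a n - g n) @[n --> \oo] --> limn (fun n => a n - g n).
  by apply: nondecreasing_is_cvgn => //; exists (a 0%N + g 0%N) => _ [n _ <-].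
have acv : a n @[n --> \oo] --> limn (fun n => a n - g n).
  set b := (fun n => a n - g n) in bcv *.
  have -> : a = b \+ g by apply/funext => n; rewrite /b/= subrK.
  by rewrite -[limn b]addr0; apply: cvgD.
have ->: limn a = limn (fun n => a n - g n) by apply/cvg_lim.
split=> // n; rewrite ler_distl; apply/andP; split.
- apply: limr_ge; first by apply/cvg_ex; eexists; exact: bcv.
  near=> m; apply: inc; near: m; exact: nbhs_infty_ge.
- apply: limr_le; first by apply/cvg_ex; eexists; exact: bcv.
  by near=> m; exact: ub.
Unshelve. all: by end_near. Qed.

(** The squared Frobenius norm: unlike the largest entry it is differentiable along a differentiable
    curve, as [gronwall] demands. *)
Definition sqsum N p (w : 'M[R]_(N, p)) : R := \sum_i \sum_j w i j ^+ 2.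

Lemma le_sqsum N p (w : 'M[R]_(N, p)) i j : w i j ^+ 2 <= sqsum w.
Proof.
rewrite /sqsum (bigD1 i)//= (bigD1 j)//= -addrA lerDl addr_ge0//.
  by apply: sumr_ge0 => l _; exact: sqr_ge0.
by apply: sumr_ge0 => l _; apply: sumr_ge0 => l' _; exact: sqr_ge0.
Qed.

(** The derivative of the squared norm consists of terms [2 D_il w_lj w_ij] and [2 r_ij w_ij]. By
    [2 x y <= x^2 + y^2] the first kind adds up to at most [2 N K] times the squared norm; the
    second adds one more squared norm, the [+ 1] of the exponent, and at most [N p d^2]. *)
Lemma ode_energy N p (D : R -> 'M[R]_N) (w r : R -> 'M[R]_(N, p)) (K d T : R) :
  0 <= K -> 0 <= d ->
  (forall s : R, `|s| <= T -> forall i j,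
    is_derive s (1 : R) (fun z => w z i j) ((D s *m w s + r s) i j)) ->
  (forall s, `|s| <= T -> forall i j, `|D s i j| <= K) ->
  (forall s, `|s| <= T -> forall i j, `|r s i j| <= d) ->
  forall s, `|s| <= T ->
    sqsum (w s) <= (sqsum (w 0) + (N * p)%:R * d ^+ 2 * `|s|) *
                   expR ((2 * N%:R * K + 1) * `|s|).
Proof.
move=> K0 d0 wd DK rd.
pose dq s := \sum_i \sum_j ((D s *m w s + r s) i j * w s i j + w s i j * (D s *m w s + r s) i j).
apply: (gronwall (dq := dq)).
- by rewrite addr_ge0// !mulr_ge0.
- by rewrite mulr_ge0// exprn_ge0.
- move=> s sT; apply: is_derive_bigsum => i; apply: is_derive_bigsum => j.
  by apply: is_derive_mul; exact: wd.
move=> s sT; rewrite /dq.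
have key i j : `|(D s *m w s + r s) i j * w s i j + w s i j * (D s *m w s + r s) i j| <=
    \sum_(l < N) K * (w s i j ^+ 2 + w s l j ^+ 2) + (w s i j ^+ 2 + d ^+ 2).
  rewrite !mxE mulrC -mulr2n -mulr_natl mulrDr mulrDr.
  apply: le_trans (ler_normD _ _) _; apply: lerD; last first.
    have := rd s sT i j; rewrite ler_norml => /andP[r1 r2].
    have h : (r s i j) ^+ 2 <= d ^+ 2 by nra.
    rewrite ler_norml; apply/andP; split.
      by have := sqr_ge0 (w s i j + r s i j); nra.
    by have := sqr_ge0 (w s i j - r s i j); nra.
  rewrite mulr_sumr mulr_sumr; apply: le_trans (ler_norm_sum _ _ _) _.
  apply: ler_sum => l _; rewrite mulrCA mulrA mulrCA normrM.
  apply: ler_pM => //; first exact: DK.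
  rewrite ler_norml; apply/andP; split.
    by have := sqr_ge0 (w s i j + w s l j); nra.
  by have := sqr_ge0 (w s i j - w s l j); nra.
apply: le_trans (ler_norm_sum _ _ _) _.
apply: (@le_trans _ _ (\sum_(i < N) \sum_(j < p)
   (\sum_(l < N) K * (w s i j ^+ 2 + w s l j ^+ 2) + (w s i j ^+ 2 + d ^+ 2)))).
  apply: ler_sum => i _; apply: le_trans (ler_norm_sum _ _ _) _.
  by apply: ler_sum => j _; exact: key.
rewrite le_eqVlt; apply/orP; left; apply/eqP.
under eq_bigr do rewrite big_split/=.
rewrite big_split/=.
have -> : \sum_(i < N) \sum_(j < p) (w s i j ^+ 2 + d ^+ 2) =
   sqsum (w s) + (N * p)%:R * d ^+ 2.
  under eq_bigr do rewrite big_split/=.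
  rewrite big_split/= -/(sqsum (w s)); congr (_ + _).
  by rewrite !sumr_const !card_ord -mulrnA mulr_natl mulnC.
have -> : \sum_(i < N) \sum_(j < p) \sum_(l < N) K * (w s i j ^+ 2 + w s l j ^+ 2) =
   2 * N%:R * K * sqsum (w s).
  under eq_bigr do under eq_bigr do rewrite -mulr_sumr big_split/= sumr_const card_ord.
  under eq_bigr do rewrite -mulr_sumr big_split/=.
  rewrite -mulr_sumr big_split/=.
  have -> : \sum_(i < N) \sum_(j < p) w s i j ^+ 2 *+ N = N%:R * sqsum (w s).
    rewrite /sqsum mulr_sumr; apply: eq_bigr => i _; rewrite mulr_sumr.
    by apply: eq_bigr => j _; rewrite mulr_natl.
  rewrite [X in _ + X](_ : _ = N%:R * sqsum (w s)); first ring.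
  by rewrite sumr_const card_ord exchange_big/= mulr_natl.
ring.
Qed.

Lemma linear_ode_uniq N p (D : R -> 'M[R]_N) (u v : R -> 'M[R]_(N, p)) :
  (forall i j, continuous (fun s => D s i j)) ->
  (forall (s : R) i j, is_derive s (1 : R) (fun z => u z i j) ((D s *m u s) i j)) ->
  (forall (s : R) i j, is_derive s (1 : R) (fun z => v z i j) ((D s *m v s) i j)) ->
  u 0 = v 0 -> forall s, u s = v s.
Proof.
move=> cD du dv uv0 s.
have [K K0 DK] := matrix_bounded_segment `|s| cD.
have := @ode_energy N p D (fun z => u z - v z) (fun _ => 0) K 0 `|s| K0 (lexx _) _ DK _ s (lexx _).
rewrite uv0 subrr expr0n/= mulr0 mul0r.
have -> : sqsum (0 : 'M[R]_(N, p)) = 0.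
  by rewrite /sqsum big1// => i _; rewrite big1// => j _; rewrite mxE expr0n.
rewrite addr0 mul0r => h; apply/matrixP => i j; apply/eqP.
rewrite -subr_eq0 -sqrf_eq0 eq_le sqr_ge0 andbT.
have -> : u s i j - v s i j = (u s - v s) i j by rewrite !mxE.
apply: le_trans (le_sqsum _ i j) (h _ _) => z zs i' j'.
  rewrite addr0 mulmxBr.
  rewrite (_ : (fun z0 => _) = (fun z0 => u z0 i' j' - v z0 i' j')); last first.
    by apply/funext => y; rewrite !mxE.
  by apply: (is_derive_eq (is_derive_sub (du z i' j') (dv z i' j'))); rewrite !mxE.
by rewrite mxE normr0.
Qed.

Lemma mulmx_entry_bound N p (A : 'M[R]_N) (B : 'M[R]_(N, p)) (K c : R) i j :
  (forall i j, `|A i j| <= K) -> (forall l, `|B l j| <= c) ->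
  `|(A *m B) i j| <= N%:R * K * c.
Proof.
move=> AK Bc; rewrite mxE; apply: le_trans (ler_norm_sum _ _ _) _.
apply: (@le_trans _ _ (\sum_(l < N) K * c)).
  by apply: ler_sum => l _; rewrite normrM ler_pM.
by rewrite sumr_const card_ord -mulrA mulr_natl.
Qed.

Lemma continuous_mulmx_entry N p (A : R -> 'M[R]_N) (B : R -> 'M[R]_(N, p)) :
  (forall i j, continuous (fun s => A s i j)) ->
  (forall i j, continuous (fun s => B s i j)) ->
  forall i j, continuous (fun s => (A s *m B s) i j).
Proof.
move=> cA cB i j s.
have -> : (fun s => (A s *m B s) i j) = (fun s => \sum_l A s i l * B s l j).
  by apply/funext => z; rewrite mxE.
by apply: cvg_bigsum => l; apply: cvgM; [exact: cA|exact: cB].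
Qed.

(** Picard iteration from the constant [u0]. Thanks to the exponential weight it converges uniformly
    on every [[-T, T]] at once, so the solution is global without gluing local ones. *)
Lemma linear_ode_exists N p (D : R -> 'M[R]_N) (u0 : 'M[R]_(N, p)) :
  (forall i j, continuous (fun s => D s i j)) ->
  exists u : R -> 'M[R]_(N, p), u 0 = u0 /\ forall (s : R) i j,
    is_derive s (1 : R) (fun z => u z i j) ((D s *m u s) i j).
Proof.
move=> cD.
(* The primitive is made a total operator, with an arbitrary value on discontinuous functions, so
   that the iteration can be written down before its terms are known to be continuous. *)
have /choice[PR PRP] : forall f : R -> R, exists F : R -> R, continuous f ->
    F 0 = 0 /\ forall x : R, is_derive x (1 : R) F (f x).
  move=> f; have [cf|ncf] := pselect (continuous f); last by exists f.
  by have [F HF] := continuous_has_primitive cf; exists F.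
pose S (v : R -> 'M[R]_(N, p)) (s : R) : 'M[R]_(N, p) :=
  \matrix_(i, j) (u0 i j + PR (fun z => (D z *m v z) i j) s).
have Sd (v : R -> 'M[R]_(N, p)) : (forall i j, continuous (fun s => v s i j)) ->
    S v 0 = u0 /\ forall (s : R) i j,
    is_derive s (1 : R) (fun z => S v z i j) ((D s *m v s) i j).
  move=> cv; have cDv := continuous_mulmx_entry cD cv.
  split; first by apply/matrixP => i j; rewrite mxE (PRP _ (cDv i j)).1 addr0.
  move=> s i j; rewrite (_ : (fun z => _) = (fun z => u0 i j + PR (fun z => (D z *m v z) i j) z)).
    apply: (is_derive_eq (is_derive_add (is_derive_const _ _ _) ((PRP _ (cDv i j)).2 s))).
    by rewrite add0r.
  by apply/funext => z; rewrite mxE.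
have Sc (v : R -> 'M[R]_(N, p)) : (forall i j, continuous (fun s => v s i j)) ->
    forall i j, continuous (fun s => S v s i j).
  by move=> cv i j s; apply: is_derive_continuous ((Sd v cv).2 s i j).
pose U := fix U n := if n is n'.+1 then S (U n') else (fun _ => u0).
have Uc n : forall i j, continuous (fun s => U n s i j).
  elim: n => [|n IH] /=; first by move=> i j s; exact: cvg_cst.
  exact: Sc.
have U0 n : U n 0 = u0 by case: n => [//|n]; exact: (Sd _ (Uc n)).1.
have Ud n (s : R) i j : is_derive s (1 : R) (fun z => U n.+1 z i j) ((D s *m U n s) i j).
  exact: (Sd _ (Uc n)).2.
pose c0 := \sum_i \sum_j `|u0 i j|.
have c00 : 0 <= c0 by apply: sumr_ge0 => i _; apply: sumr_ge0.
have u0c i j : `|u0 i j| <= c0.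
  rewrite /c0 (bigD1 i)//= (bigD1 j)//= -addrA lerDl addr_ge0//.
    exact: sumr_ge0.
  by apply: sumr_ge0 => l _; apply: sumr_ge0.
have e1 (x : R) : 0 <= x -> 1 <= expR x by move=> x0; rewrite -expR0 ler_expR.
(* In the weight [exp (2 L |s|)] the factor [L] lost by multiplying with [D] is regained with a
   surplus of 2 by integrating. The [+ 1] in [L] only makes it positive. *)
have step (T K : R) : 0 <= K -> (forall s, `|s| <= T -> forall i j, `|D s i j| <= K) ->
    forall n s, `|s| <= T -> forall i j,
    `|U n.+1 s i j - U n s i j| <=
      c0 * 2^-1 ^+ n * expR (2 * (N%:R * K + 1) * `|s|).
  move=> K0 DK; set L := N%:R * K + 1.
  have NK0 : 0 <= N%:R * K by rewrite mulr_ge0.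
  have L0 : 0 < L by rewrite /L; lra.
  have L20 : 0 < 2 * L by rewrite mulr_gt0.
  elim=> [|n IH] s sT i j.
    apply: (@le_trans _ _ (L * c0 / (2 * L) * expR (2 * L * `|s|))).
      apply: (@is_derive_exp_bound _ (fun z => U 1%N z i j - U 0%N z i j)
         (fun z => (D z *m u0) i j - 0) (L * c0) (2 * L) T) => //.
      - by rewrite mulr_ge0// ltW.
      - by rewrite U0 subrr.
      - by move=> z zT; exact: (is_derive_sub (Ud 0%N z i j) (is_derive_const _ _ _)).
      move=> z zT; rewrite subr0.
      apply: le_trans (mulmx_entry_bound i (DK z zT) (fun l => u0c l j)) _.
      apply: (@le_trans _ _ (L * c0)); first by rewrite ler_wpM2r// /L; lra.
      rewrite ler_peMr ?mulr_ge0 ?(ltW L0)//; apply: e1.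
      by rewrite mulr_ge0// ltW.
    rewrite ler_wpM2r ?expR_ge0// expr0 mulr1 ler_pdivrMr//.
    by have := mulr_ge0 c00 (ltW L0); nra.
  have -> : c0 * 2^-1 ^+ n.+1 = L * (c0 * 2^-1 ^+ n) / (2 * L).
    by rewrite exprS; field; rewrite gt_eqF.
  have cn0 : 0 <= c0 * 2^-1 ^+ n by rewrite mulr_ge0// exprn_ge0 ?invr_ge0.
  apply: (@is_derive_exp_bound _ (fun z => U n.+2 z i j - U n.+1 z i j)
     (fun z => (D z *m U n.+1 z) i j - (D z *m U n z) i j) _ (2 * L) T) => //.
  - by rewrite mulr_ge0// ltW.
  - by rewrite !U0 subrr.
  move=> z zT; have -> : (D z *m U n.+1 z) i j - (D z *m U n z) i j =
      (D z *m (U n.+1 z - U n z)) i j by rewrite mulmxBr !mxE.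
  have h l : `|(U n.+1 z - U n z) l j| <= c0 * 2^-1 ^+ n * expR (2 * L * `|z|).
    by have := IH z zT l j; rewrite !mxE.
  apply: le_trans (mulmx_entry_bound i (DK z zT) h) _.
  by rewrite -[leRHS]mulrA ler_wpM2r ?mulr_ge0 ?expR_ge0// /L; lra.
have unif (T : R) : exists2 C, 0 <= C & forall n s, `|s| <= T -> forall i j,
    `|U n.+1 s i j - U n s i j| <= C * 2^-1 ^+ n.
  have [K K0 DK] := matrix_bounded_segment T cD.
  exists (c0 * expR (2 * (N%:R * K + 1) * T)); first by rewrite mulr_ge0 ?expR_ge0.
  move=> n s sT i j; apply: le_trans (step T K K0 DK n s sT i j) _.
  rewrite mulrAC ler_wpM2r ?exprn_ge0 ?invr_ge0// ler_wpM2l// ler_expR.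
  by rewrite ler_wpM2l// mulr_ge0// addr_ge0// mulr_ge0.
pose u s : 'M[R]_(N, p) := \matrix_(i, j) limn (fun n => U n s i j).
have ucv s i j : U n s i j @[n --> \oo] --> u s i j.
  have [C C0 h] := unif `|s|; rewrite mxE.
  exact: (cauchy_geometric C0 (fun n => h n s (lexx _) i j)).1.
have ub (T : R) : exists2 C, 0 <= C & forall n s, `|s| <= T -> forall i j,
    `|u s i j - U n s i j| <= 2 * C * 2^-1 ^+ n.
  have [C C0 h] := unif T; exists C => // n s sT i j; rewrite mxE.
  exact: (cauchy_geometric C0 (fun n => h n s sT i j)).2.
have small (C e : R) : 0 <= C -> 0 < e -> exists n, 2 * C * 2^-1 ^+ n < e.
  move=> C0 e0; have : (2 * C * 2^-1 ^+ n) @[n --> \oo] --> (0 : R).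
    rewrite -[0](mulr0 (2 * C)); apply: cvgM; first exact: cvg_cst.
    by apply: cvg_expr; rewrite ger0_norm ?invr_ge0// invf_lt1 ?ltr1n.
  move=> /cvgrPdist_lt /(_ e e0) [n _ /(_ n (leqnn n))] /=; rewrite sub0r normrN => h.
  by exists n; apply: le_lt_trans h; exact: ler_norm.
have uc i j : continuous (fun s => u s i j).
  move=> s; have [C C0 h] := ub (`|s| + 1).
  apply/cvgrPdist_lt => e e0; have e3 : 0 < e / 3 by rewrite divr_gt0.
  have [n nC] := small C (e / 3) C0 e3.
  near=> z.
  have zT : `|z| <= `|s| + 1.
    have : `|s - z| < 1 by near: z; apply: cvgr_dist_lt => //; exact: cvg_id.
    by have := ler_normB s (s - z); rewrite subKr; lra.
  have sT : `|s| <= `|s| + 1 by lra.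
  have h1 := h n z zT i j; have h2 := h n s sT i j.
  have h3 : `|U n s i j - U n z i j| < e / 3.
    by near: z; apply: cvgr_dist_lt => //; exact: (Uc n i j s).
  rewrite (_ : u s i j - u z i j = (u s i j - U n s i j) +
    (U n s i j - U n z i j) - (u z i j - U n z i j)); last ring.
  apply: le_lt_trans (ler_normB _ _) _.
  by apply: le_lt_trans (lerD (ler_normD _ _) (lexx _)) _; lra.
have [v0 vd] := Sd u uc.
(* [S u] is differentiable as a primitive, so the fixed point equation already yields the
   differential equation for [u]. *)
suff uv : S u = u by rewrite uv in v0 vd; exists u.
apply/esym/funext => s; apply/matrixP => i j.
have [C C0 h] := ub `|s|; have [K K0 DK] := matrix_bounded_segment `|s| cD.
have conv n (z : R) : `|z| <= `|s| ->
    `|U n.+1 z i j - S u z i j| <= (N%:R * K * (2 * C * 2^-1 ^+ n)) / 1 * expR (1 * `|z|).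
  have C2 : 0 <= N%:R * K * (2 * C * 2^-1 ^+ n).
    by rewrite !mulr_ge0// exprn_ge0 ?invr_ge0.
  apply: (@is_derive_exp_bound _ (fun z => U n.+1 z i j - S u z i j)
     (fun z => (D z *m U n z) i j - (D z *m u z) i j)) => //.
  - by rewrite U0 v0 subrr.
  move=> y yT; have -> : (D y *m U n y) i j - (D y *m u y) i j =
      (D y *m (U n y - u y)) i j by rewrite mulmxBr !mxE.
  have hl l : `|(U n y - u y) l j| <= 2 * C * 2^-1 ^+ n.
    by have := h n y yT l j; rewrite distrC !mxE.
  apply: le_trans (mulmx_entry_bound i (DK y yT) hl) _.
  by rewrite ler_peMr// e1// mul1r.
(* The constants of [conv] at time s. Passing through [U n.+1] bounds the distance of [u] to [S u]
   by [2 (C + M) / 2^n] for every n, and [small] makes this less than any positive number. *)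
pose M := N%:R * K * (2 * C) * expR `|s|.
have M0 : 0 <= M by rewrite /M !mulr_ge0 ?expR_ge0.
apply/eqP; rewrite -subr_eq0 -normr_eq0 eq_le normr_ge0 andbT leNgt.
apply/negP => e0.
have [n] := small (C + M) _ (addr_ge0 C0 M0) e0.
apply/negP; rewrite -leNgt.
have h1 := h n.+1 s (lexx _) i j; have h2 := conv n s (lexx _).
have -> : u s i j - S u s i j = (u s i j - U n.+1 s i j) + (U n.+1 s i j - S u s i j) by ring.
apply: le_trans (ler_normD _ _) _.
apply: le_trans (lerD h1 h2) _; rewrite mul1r divr1 /M exprS.
have p0 : 0 <= 2^-1 ^+ n :> R by rewrite exprn_ge0// invr_ge0.
have a1 := mulr_ge0 C0 p0; have a2 := mulr_ge0 M0 p0; rewrite /M in a2.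
have -> : 2 * C * (2^-1 * 2^-1 ^+ n) = C * 2^-1 ^+ n by field.
have -> : N%:R * K * (2 * C * 2^-1 ^+ n) * expR `|s| =
  N%:R * K * (2 * C) * expR `|s| * 2^-1 ^+ n by ring.
have -> : 2 * (C + N%:R * K * (2 * C) * expR `|s|) * 2^-1 ^+ n =
  2 * (C * 2^-1 ^+ n) + 2 * (N%:R * K * (2 * C) * expR `|s| * 2^-1 ^+ n) by ring.
by lra.
Unshelve. all: by end_near. Qed.

End LinearODE.

(** * Smooth dependence on parameters *)

Section OdeDependence.
Context {R : realType}.

Lemma is_derive_line (V : normedModType R) (f : V -> R) (x v : V) (y : R) :
  derivable f (x + y *: v) v ->
  is_derive y (1 : R) (fun z => f (x + z *: v)) ('D_v f (x + y *: v)).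
Proof.
move=> fd; have E : (fun h : R => h^-1 *: (((fun z : R => f (x + z *: v)) \o shift y) (h *: (1 : R)) - f (x + y *: v))) =
   (fun h : R => h^-1 *: ((f \o shift (x + y *: v)) (h *: v) - f (x + y *: v))).
  apply/funext => h /=; congr (_ *: (f _ - _)).
  by rewrite scalerDl addrCA [h *: 1]mulr1.
apply: DeriveDef; first by rewrite /derivable E.
by rewrite /derive E.
Qed.

(** The difference [w] of the solutions satisfies [w' = Dq w + (Dq - D) u] with a uniformly small
    residual, so [ode_energy] applies. The filter is arbitrary because the lemma serves twice: along
    points tending to x for continuity, and along increments tending to 0 for difference
    quotients. *)
Lemma ode_param_cvg (Q : Type) (F : set_system Q) {FF : Filter F} N p
  (D : R -> 'M[R]_N) (Dq : Q -> R -> 'M[R]_N)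
  (u : R -> 'M[R]_(N, p)) (uq : Q -> R -> 'M[R]_(N, p)) :
  (forall i j, continuous (fun s => D s i j)) ->
  (forall (s : R) i j, is_derive s (1 : R) (fun z => u z i j) ((D s *m u s) i j)) ->
  (\forall q \near F, uq q 0 = u 0 /\ forall (s : R) i j,
     is_derive s (1 : R) (fun z => uq q z i j) ((Dq q s *m uq q s) i j)) ->
  (forall T e : R, 0 < e -> \forall q \near F, forall s, `|s| <= T ->
     forall i j, `|Dq q s i j - D s i j| <= e) ->
  forall T e : R, 0 < e -> \forall q \near F, forall s, `|s| <= T ->
     forall i j, `|uq q s i j - u s i j| <= e.
Proof.
move=> cD ud uqd DqD T e e0.
have cu i j : continuous (fun s => u s i j).
  by move=> s; exact: is_derive_continuous (ud s i j).
have [K K0 DK] := matrix_bounded_segment T cD.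
have [C C0 uC] := matrix_bounded_segment T cu.
pose A := (N * p)%:R * (N%:R * C) ^+ 2 * `|T| * expR ((2 * N%:R * (K + 1) + 1) * `|T|).
have A0 : 0 <= A by rewrite /A !mulr_ge0 ?expR_ge0 ?exprn_ge0 ?mulr_ge0.
have A1 : 0 < A + 1 by lra.
(* The bound by 1 keeps the entries of [Dq] below [K + 1], so that [A] can be fixed beforehand; the
   other bound absorbs [A]. *)
pose e' := Num.min 1 (e / (A + 1)).
have e'0 : 0 < e' by rewrite /e' lt_min ltr01 divr_gt0.
near=> q.
have [uq0 uqd'] : uq q 0 = u 0 /\ forall (s : R) i j,
   is_derive s (1 : R) (fun z => uq q z i j) ((Dq q s *m uq q s) i j).
  by near: q; exact: uqd.
have Dq' : forall s, `|s| <= T -> forall i j, `|Dq q s i j - D s i j| <= e'.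
  by near: q; exact: DqD.
move=> s sT i j.
have sT' : `|s| <= `|T| by apply: le_trans sT (ler_norm _).
pose w z := uq q z - u z.
pose r z := (Dq q z - D z) *m u z.
have := @ode_energy R N p (Dq q) w r (K + 1) (N%:R * e' * C) T _ _ _ _ _ s sT.
have -> : w 0 = 0 by rewrite /w uq0 subrr.
have -> : sqsum (0 : 'M[R]_(N, p)) = 0.
  by rewrite /sqsum big1// => l _; rewrite big1// => l' _; rewrite mxE expr0n.
rewrite add0r => h.
have {}h : sqsum (w s) <= A * e' ^+ 2.
  apply: le_trans (h _ _ _ _ _) _.
  - by lra.
  - by rewrite !mulr_ge0// ltW.
  - move=> z zT k l.
    rewrite (_ : (fun y => w y k l) = (fun y => uq q y k l - u y k l)); last first.
      by apply/funext => y; rewrite !mxE.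
    apply: (is_derive_eq (is_derive_sub (uqd' z k l) (ud z k l))).
    by rewrite /w /r mulmxBr mulmxBl addrA subrK !mxE.
  - move=> z zT k l; have := Dq' z zT k l; have := DK z zT k l.
    have : e' <= 1 by rewrite /e' ge_min lexx.
    have := ler_normD (Dq q z k l - D z k l) (D z k l); rewrite subrK; lra.
  - move=> z zT k l; apply: mulmx_entry_bound => [a b|b].
      by rewrite !mxE; exact: Dq'.
    exact: uC.
  have -> : A * e' ^+ 2 = (N * p)%:R * (N%:R * e' * C) ^+ 2 * `|T| *
      expR ((2 * N%:R * (K + 1) + 1) * `|T|) by rewrite /A; ring.
  have b0 : 0 <= (N * p)%:R * (N%:R * e' * C) ^+ 2.
    by rewrite mulr_ge0// sqr_ge0.
  apply: ler_pM; [exact: mulr_ge0 b0 (normr_ge0 _)|exact: expR_ge0|by rewrite ler_wpM2l|].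
  rewrite ler_expR ler_wpM2l// addr_ge0// !mulr_ge0//; lra.
have e'A : e' * (A + 1) <= e.
  by rewrite -ler_pdivlMr// /e' ge_min lexx orbT.
have {}h : (w s i j) ^+ 2 <= e ^+ 2.
  apply: le_trans (le_sqsum (w s) i j) (le_trans h _).
  apply: (@le_trans _ _ ((e' * (A + 1)) ^+ 2)).
    rewrite exprMn mulrC ler_wpM2l ?sqr_ge0//; nra.
  have : 0 <= e' * (A + 1) by rewrite mulr_ge0// ltW.
  by nra.
have -> : uq q s i j - u s i j = w s i j by rewrite !mxE.
by rewrite ler_norml; nra.
Unshelve. all: by end_near. Qed.

Context {m : nat}.
Implicit Types (M : set 'cV[R]_m).

(** Derivatives are taken in x only, and time enters through joint continuity. This is what
    uniformity over bounded time intervals requires, and the class is stable under solving linear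
    equations in time. *)
Fixpoint joint_Cn (n : nat) M (f : R -> 'cV[R]_m -> R) : Prop :=
  (forall s x, M x -> {for (s, x), continuous (fun z => f z.1 z.2)}) /\
  match n with
  | 0%N => True
  | p.+1 => forall i : 'I_m,
      (forall s x, M x -> derivable (f s) x (delta_mx i 0)) /\
      joint_Cn p M (fun s => partial i (f s))
  end.

Lemma joint_Cn_cont n M f : joint_Cn n M f ->
  forall s x, M x -> {for (s, x), continuous (fun z => f z.1 z.2)}.
Proof. by case: n => [|n] []. Qed.

(** The tube lemma: compactness of [[-T, T]] makes the neighbourhood of x independent of the
    time. *)
Lemma joint_continuous_tube (f : R -> 'cV[R]_m -> R) x :
  (forall s, {for (s, x), continuous (fun z => f z.1 z.2)}) ->
  forall T e : R, 0 < e ->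
  \forall y \near x, forall s, `|s| <= T -> `|f s y - f s x| <= e.
Proof.
move=> cf T e e0.
have cK : compact `[- T, T] by exact: segment_compact.
have := (compact_near_coveringP _).1 cK _ (nbhs x) (fun y s => `|f s y - f s x| <= e) _.
move=> h; have {h} : \forall y \near x, forall s, `[- T, T]%classic s -> `|f s y - f s x| <= e.
  apply: h => s _.
  have e2 : 0 < e / 2 by rewrite divr_gt0.
  have := cf s; move=> /cvgrPdist_lt /(_ _ e2) [[A B]/= [nA nB] AB].
  exists (A, B) => //= -[s' y]/= [As' By].
  have h1 := AB (s', y) (conj As' By).
  have h2 := AB (s', x) (conj As' (nbhs_singleton nB)).
  rewrite /= in h1 h2.
  have -> : f s' y - f s' x = - (f s x - f s' y) + (f s x - f s' x) by ring.
  by apply: le_trans (ler_normD _ _) _; rewrite normrN; lra.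
by apply: filterS => y h s sT; apply: h; rewrite /= in_itv/= -ler_norml.
Qed.

Lemma near_forall_imp (I : finType) (Q : Type) (F : set_system Q) {FF : Filter F}
    (P : I -> Q -> Prop) (S : Q -> Prop) :
  (forall q, (forall i, P i q) -> S q) ->
  (forall i, F (P i)) -> F S.
Proof.
move=> PS FP; have h := filter_forall FF FP.
by apply: filterS h => q; exact: PS.
Qed.

Lemma near_eq_continuous (U : topologicalType) (f g : U -> R) (x : U) :
  (\forall z \near x, f z = g z) -> {for x, continuous f} -> {for x, continuous g}.
Proof.
move=> E fx; have e := nbhs_singleton E.
suff : g z @[z --> x] --> g x by [].
rewrite -e; apply: cvg_trans fx; apply: near_eq_cvg.
by apply: filterS E => z ->.
Qed.

Lemma open_near M x : open M -> M x -> \forall y \near x, M y.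
Proof. by move=> oM Mx; exact: open_nbhs_nbhs. Qed.

Lemma partial_ext M i (f g : 'cV[R]_m -> R) x : open M -> M x ->
  (forall y, M y -> f y = g y) -> partial i f x = partial i g x.
Proof.
move=> oM Mx fg; apply: near_eq_derive.
by apply: filterS (open_near oM Mx) => y /fg.
Qed.

Lemma derivable_ext M (f g : 'cV[R]_m -> R) x v : open M -> M x ->
  (forall y, M y -> f y = g y) -> derivable f x v -> derivable g x v.
Proof.
move=> oM Mx fg; apply: near_eq_derivable.
by apply: filterS (open_near oM Mx) => y /fg.
Qed.

Lemma joint_Cn_ext n M f g : open M -> (forall s x, M x -> f s x = g s x) ->
  joint_Cn n M f -> joint_Cn n M g.
Proof.
move=> oM; have ec (f' g' : R -> 'cV[R]_m -> R) : (forall s x, M x -> f' s x = g' s x) ->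
   (forall s x, M x -> {for (s, x), continuous (fun z => f' z.1 z.2)}) ->
   forall s x, M x -> {for (s, x), continuous (fun z => g' z.1 z.2)}.
  move=> fg fc s x Mx; apply: near_eq_continuous (fc s x Mx).
  exists (setT, M); first by split; [exact: filterT|exact: open_near].
  by move=> [s' y] [_ /= My]; exact: fg.
elim: n f g => [|n IH] f g fg [fc fd]; first by split=> //; exact: ec fc.
split=> [|i]; first exact: ec fc.
have [fi fCn] := fd i; split.
  by move=> s x Mx; apply: (derivable_ext oM Mx _ (fi s x Mx)) => y; exact: fg.
apply: IH fCn => s x Mx; apply: partial_ext oM Mx _ => y; exact: fg.
Qed.

Lemma joint_CnS n M f : joint_Cn n.+1 M f -> joint_Cn n M f.
Proof.
elim: n f => [|n IH] f [fc fd]; first by split.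
split=> // i; have [fi fCn] := fd i; split=> //; exact: IH.
Qed.

Lemma joint_Cn_cst n M c : joint_Cn n M (fun _ _ => c).
Proof.
elim: n c => [|n IH] c; first by split=> // s x _; exact: cvg_cst.
split=> [s x _|i]; first exact: cvg_cst.
split=> [s x _|]; first exact: derivable_cst.
rewrite (_ : (fun s => _) = fun _ _ => 0); first exact: IH.
by apply/funext => s; apply/funext => x; rewrite /partial; exact: derive_cst.
Qed.

Lemma joint_continuous_slice (f : R -> 'cV[R]_m -> R) x :
  (forall s, {for (s, x), continuous (fun z => f z.1 z.2)}) ->
  continuous (fun s => f s x).
Proof.
move=> fc s.
apply: (@continuous_comp _ _ _ (fun s : R => (s, x)) (fun z : R * 'cV[R]_m => f z.1 z.2)).
  move=> P [[A B] /= [nA nB] AB]; apply: (filterS _ nA) => z Az.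
  by apply: AB; split=> //=; exact: nbhs_singleton nB.
exact: fc.
Qed.

Lemma is_derive_cvg (V : normedModType R) (f : V -> R) (x v : V) (l : R) :
  (h^-1 * (f (x + h *: v) - f x)) @[h --> 0^'] --> l -> is_derive x v f l.
Proof.
move=> fl; have E : (fun h : R => h^-1 *: ((f \o shift x) (h *: v) - f x)) =
   (fun h : R => h^-1 * (f (x + h *: v) - f x)).
  by apply/funext => h /=; rewrite [x + _]addrC.
apply: DeriveDef; first by apply/cvg_ex; exists l; rewrite E.
by rewrite /derive E; apply/cvg_lim.
Qed.

(** By the mean value theorem the quotient is a directional derivative at an intermediate point of
    the segment. *)
Lemma difference_quotient_bound (V : normedModType R) (f : V -> R) (x v : V)
    (a e h : R) : h != 0 ->
  (forall c, `|c| <= `|h| -> derivable f (x + c *: v) v /\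
     `|'D_v f (x + c *: v) - a| <= e) ->
  `|h^-1 * (f (x + h *: v) - f x) - a| <= e.
Proof.
move=> h0 fh; have x0 : f x = f (x + 0 *: v) by rewrite scale0r addr0.
have mv b c : b < c -> (forall z, b <= z <= c -> `|z| <= `|h|) ->
   exists2 z, `|z| <= `|h| & f (x + c *: v) - f (x + b *: v) = 'D_v f (x + z *: v) * (c - b).
  move=> bc bch; have d z : b <= z <= c ->
      is_derive z (1 : R) (fun y => f (x + y *: v)) ('D_v f (x + z *: v)).
    by move=> /bch /fh [fz _]; exact: is_derive_line.
  have [| |z] := @MVT R (fun y => f (x + y *: v)) (fun z => 'D_v f (x + z *: v)) b c bc.
  - by move=> z; rewrite in_itv/= => /andP[/ltW bz /ltW zc]; apply: d; rewrite bz.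
  - by apply: derivable_within_continuous => z; rewrite in_itv/= => /d[].
  by rewrite in_itv/= => /andP[/ltW bz /ltW zc] ->; exists z => //; apply: bch; rewrite bz.
have [z zh ->] : exists2 z, `|z| <= `|h| &
    h^-1 * (f (x + h *: v) - f x) = 'D_v f (x + z *: v).
  have [hp|hn] := ltP 0 h.
    have [z /andP[z0 zh]|z zh E] := mv 0 h hp.
      by rewrite !ger0_norm// ltW.
    by exists z => //; rewrite x0 E subr0; field.
  have {}hn : h < 0 by rewrite lt_neqAle h0.
  have [z /andP[z0 zh]|z zh E] := mv h 0 hn.
    by rewrite !ler0_norm ?lerN2// ltW.
  exists z => //; rewrite x0 -opprB E; by field.
by have [] := fh z zh.
Qed.

Lemma near_segment (V : normedModType R) (x v : V) (P : set V) : nbhs x P ->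
  \forall h \near (0 : R), forall c, `|c| <= `|h| -> P (x + c *: v).
Proof.
move=> nP; have : \forall c \near (0 : R), P (x + c *: v).
  have : (x + c *: v) @[c --> (0 : R)] --> x.
    rewrite -[X in _ --> X]addr0 -[X in _ --> _ + X](scale0r v).
    by apply: cvgD; [exact: cvg_cst|apply: cvgZr_tmp; exact: cvg_id].
  exact.
move=> [r /= r0 rP]; near=> h => c ch.
apply: rP; rewrite /ball_/= sub0r normrN; apply: le_lt_trans ch _.
rewrite -normrN -(sub0r h).
by near: h; apply: cvgr_dist_lt => //; exact: cvg_id.
Unshelve. all: by end_near. Qed.

Definition is_ode_solution N p (D : R -> 'M[R]_N) (u : R -> 'M[R]_(N, p)) :=
  forall (s : R) i j, is_derive s (1 : R) (fun z => u z i j) ((D s *m u s) i j).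

(** The variational equation: if [u' = D u], then u stacked on its partial derivative solves the
    linear equation with this matrix. The size doubles, but the form of the equation is kept, which
    lets the order of differentiation grow by induction. *)
Definition tangent_matrix N (i0 : 'I_m) (D : R -> 'cV[R]_m -> 'M[R]_N) (s : R)
    (x : 'cV[R]_m) : 'M[R]_(N + N) :=
  block_mx (D s x) 0 (\matrix_(a, b) partial i0 (fun y => D s y a b) x) (D s x).

Lemma joint_Cn_tangent_matrix n N M (D : R -> 'cV[R]_m -> 'M[R]_N) i0 :
  (forall i j, joint_Cn n.+1 M (fun s x => D s x i j)) ->
  forall i j, joint_Cn n M (fun s x => tangent_matrix i0 D s x i j).
Proof.
move=> DC i j; rewrite /tangent_matrix.
case: (split_ordP i) => k ->; case: (split_ordP j) => l ->.
- rewrite (_ : (fun s x => _) = fun s x => D s x k l); first exact: joint_CnS.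
  by do 2 (apply/funext => ?); rewrite block_mxEul.
- rewrite (_ : (fun s x => _) = fun _ _ => 0); first exact: joint_Cn_cst.
  by do 2 (apply/funext => ?); rewrite block_mxEur mxE.
- rewrite (_ : (fun s x => _) = fun s => partial i0 (fun x => D s x k l)).
    by have [_ /(_ i0)[]] := DC k l.
  by do 2 (apply/funext => ?); rewrite block_mxEdl mxE.
- rewrite (_ : (fun s x => _) = fun s x => D s x k l); first exact: joint_CnS.
  by do 2 (apply/funext => ?); rewrite block_mxEdr.
Qed.

(** Continuity in time at the fixed x is combined with closeness of the solutions at x and y,
    uniform for times up to [|s| + 1]. *)
Lemma joint_continuous_ode N p M (D : R -> 'cV[R]_m -> 'M[R]_N) (u0 : 'M[R]_(N, p))
    (u : R -> 'cV[R]_m -> 'M[R]_(N, p)) : open M ->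
  (forall i j, joint_Cn 0 M (fun s x => D s x i j)) ->
  (forall x, M x -> u 0 x = u0 /\ is_ode_solution (D ^~ x) (u ^~ x)) ->
  forall i j, joint_Cn 0 M (fun s x => u s x i j).
Proof.
move=> oM DC uP i j; split=> // s x Mx.
have [u0x ux] := uP x Mx.
have Dc k l : forall s, {for (s, x), continuous (fun z => D z.1 z.2 k l)}.
  by move=> s'; have [h _] := DC k l; exact: h.
have cD k l : continuous (fun s => D s x k l).
  exact: (@joint_continuous_slice (fun s x => D s x k l)).
apply/cvgrPdist_le => e e0; have e2 : 0 < e / 2 by rewrite divr_gt0.
have nA : \forall y \near x, forall s', `|s'| <= `|s| + 1 ->
   forall i j, `|u s' y i j - u s' x i j| <= e / 2.
  have := @ode_param_cvg 'cV[R]_m (nbhs x) _ N p (D ^~ x) (fun y s => D s y)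
    (u ^~ x) (fun y s => u s y) cD ux _ _ (`|s| + 1) (e / 2) e2; apply.
    apply: filterS (open_near oM Mx) => y /uP [-> uy]; split=> //.
  move=> T e' e'0.
  have h (kl : 'I_N * 'I_N) := joint_continuous_tube (f := fun s x => D s x kl.1 kl.2) (Dc kl.1 kl.2) T e'0.
  by apply: near_forall_imp h => y h' s' s'T k l; exact: (h' (k, l)).
have nB : \forall s' \near s, `|u s x i j - u s' x i j| <= e / 2.
  have := is_derive_continuous (ux s i j); by move/cvgrPdist_le; apply.
have nB' : \forall s' \near s, `|s'| <= `|s| + 1.
  near=> s'; have : `|s - s'| < 1 by near: s'; apply: cvgr_dist_lt => //; exact: cvg_id.
  by have := ler_normB s (s - s'); rewrite subKr; lra.
exists ([set s' | `|u s x i j - u s' x i j| <= e / 2 /\ `|s'| <= `|s| + 1],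
        [set y | forall s', `|s'| <= `|s| + 1 ->
   forall i j, `|u s' y i j - u s' x i j| <= e / 2]).
  by split=> //=; exact: filterI.
move=> [s' y] /= [[h1 h2] h3]; have {}h3 := h3 s' h2 i j.
have -> : u s x i j - u s' y i j = (u s x i j - u s' x i j) - (u s' y i j - u s' x i j) by ring.
by apply: le_trans (ler_normB _ _) _; lra.
Unshelve. all: by end_near. Qed.

(** For each increment h, u and its difference quotient jointly solve a linear equation whose matrix
    tends to the tangent matrix, so the quotient tends to the lower half of [U]. *)
Lemma is_derive_ode N p M (D : R -> 'cV[R]_m -> 'M[R]_N) (u0 : 'M[R]_(N, p))
    (u : R -> 'cV[R]_m -> 'M[R]_(N, p)) i0 x (U : R -> 'M[R]_(N + N, p)) :
  open M -> M x ->
  (forall i j, joint_Cn 1 M (fun s x => D s x i j)) ->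
  (forall x, M x -> u 0 x = u0 /\ is_ode_solution (D ^~ x) (u ^~ x)) ->
  U 0 = col_mx u0 0 -> is_ode_solution (tangent_matrix i0 D ^~ x) U ->
  forall s i j, is_derive x (delta_mx i0 0) (fun y => u s y i j) (dsubmx (U s) i j).
Proof.
move=> oM Mx DC uP U0 Ud s i j; set v : 'cV[R]_m := delta_mx i0 0.
have [u0x ux] := uP x Mx.
apply: is_derive_cvg; apply/cvgrPdist_le => e e0.
have Mnear : \forall h \near (0 : R), forall c, `|c| <= `|h| -> M (x + c *: v).
  by apply: near_segment; exact: open_near.
have Dc k l : forall s, {for (s, x), continuous (fun z => D z.1 z.2 k l)}.
  by move=> s'; have [h _] := DC k l; exact: h.
have pDc k l : forall s, {for (s, x), continuous
     (fun z => partial i0 (fun y => D z.1 y k l) z.2)}.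
  by move=> s'; have [_ /(_ i0)[_ [h _]]] := DC k l; exact: h.
have cU : forall i j, continuous (fun s => tangent_matrix i0 D s x i j).
  move=> k l; apply: (@joint_continuous_slice (fun s x => tangent_matrix i0 D s x k l)).
  move=> s'; have [h _] := joint_Cn_tangent_matrix i0 DC k l; exact: h.
(* From [D(x+hv) u(x+hv) - D(x) u(x) = (D(x+hv) - D(x)) u(x) + D(x+hv) (u(x+hv) - u(x))], divided by
   h. *)
pose Dq h z := block_mx (D z x) 0 (h^-1 *: (D z (x + h *: v) - D z x)) (D z (x + h *: v)).
pose uq h z := col_mx (u z x) (h^-1 *: (u z (x + h *: v) - u z x)).
have := @ode_param_cvg _ 0^' _ (N + N) p (tangent_matrix i0 D ^~ x) Dq U uq cU Ud _ _ `|s| e e0.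
move=> main; have {main} : \forall q \near 0^', forall s0, `|s0| <= `|s| ->
    forall i j, `|uq q s0 i j - U s0 i j| <= e.
  apply: main.
    have {}Mnear := nbhs_dnbhs Mnear.
    apply: filterS2 (nbhs_dnbhs_neq (0 : R)) Mnear => h h0 Mh.
    have Mxh : M (x + h *: v) by exact: Mh.
    have [u0h uh] := uP _ Mxh.
    split; first by rewrite /uq u0x u0h subrr scaler0 U0.
    move=> z k l; rewrite /uq /Dq mul_block_col mul0mx addr0.
    case: (split_ordP k) => k' ->.
      rewrite col_mxEu (_ : (fun _ => _) = fun y => u y x k' l); first exact: ux.
      by apply/funext => y; rewrite col_mxEu.
    rewrite col_mxEd (_ : (fun _ => _) = fun y => h^-1 * (u y (x + h *: v) k' l - u y x k' l)).
      apply: (is_derive_eq (is_derive_scal h^-1 (is_derive_sub (uh z k' l) (ux z k' l)))).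
      rewrite -scalemxAl -scalemxAr -scalerDr mulmxBl mulmxBr.
      move: (D z _ *m u z _) (D z _ *m u z x) (D z x *m u z x) => a b c.
      by rewrite !mxE; ring.
    by apply/funext => y; rewrite col_mxEd !mxE.
  move=> T e' e'0.
  have tube1 (kl : 'I_N * 'I_N) : \forall h \near 0^', forall s, `|s| <= T ->
      `|D s (x + h *: v) kl.1 kl.2 - D s x kl.1 kl.2| <= e'.
    apply: nbhs_dnbhs.
    have := near_segment v (joint_continuous_tube (f := fun s x => D s x kl.1 kl.2) (Dc kl.1 kl.2) T e'0).
    by apply: filterS => h; apply.
  have tube2 (kl : 'I_N * 'I_N) : \forall h \near 0^', forall s, `|s| <= T ->
      `|h^-1 * (D s (x + h *: v) kl.1 kl.2 - D s x kl.1 kl.2)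
        - partial i0 (fun y => D s y kl.1 kl.2) x| <= e'.
    have h1 := nbhs_dnbhs (near_segment v (joint_continuous_tube (f := fun s => partial i0 (fun y => D s y kl.1 kl.2)) (pDc kl.1 kl.2) T e'0)).
    have h2 := nbhs_dnbhs Mnear.
    apply: filterS3 h1 h2 (nbhs_dnbhs_neq (0 : R)) => h h1 h2 h0 s' s'T.
    apply: (difference_quotient_bound (f := fun y => D s' y kl.1 kl.2)) => // c ch.
    split; last by apply: h1.
    by have [_ /(_ i0)[dD _]] := DC kl.1 kl.2; apply: dD; exact: h2.
  have F0 : Filter (0 : R)^' by apply: filter_filter.
  have tube12 kl := @filterI R 0^' F0 _ _ (tube1 kl) (tube2 kl).
  apply: near_forall_imp tube12 => h h12 s' s'T k l; rewrite /Dq /tangent_matrix.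
  case: (split_ordP k) => k' ->; case: (split_ordP l) => l' ->.
  - by rewrite !block_mxEul subrr normr0 ltW.
  - by rewrite !block_mxEur subrr normr0 ltW.
  - by rewrite !block_mxEdl; have := (h12 (k', l')).2 s' s'T; rewrite !mxE.
  - by rewrite !block_mxEdr; exact: (h12 (k', l')).1.
apply: filterS => h /(_ s (lexx _) (rshift N i) j).
by rewrite /uq col_mxEd !mxE distrC.
Qed.

(** Induction on n with the size [N] left free: a partial derivative of the solution is the lower
    half of a solution of the tangent system, whose coefficients have one derivative less. *)
Theorem joint_Cn_ode n N p M (D : R -> 'cV[R]_m -> 'M[R]_N) (u0 : 'M[R]_(N, p))
    (u : R -> 'cV[R]_m -> 'M[R]_(N, p)) : open M ->
  (forall i j, joint_Cn n M (fun s x => D s x i j)) ->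
  (forall x, M x -> u 0 x = u0 /\ is_ode_solution (D ^~ x) (u ^~ x)) ->
  forall i j, joint_Cn n M (fun s x => u s x i j).
Proof.
move=> oM; elim: n N D u0 u => [|n IH] N D u0 u DC uP i j.
  exact: joint_continuous_ode uP i j.
have DC0 k l : joint_Cn 0 M (fun s x => D s x k l) by have [? _] := DC k l.
have DC1 k l : joint_Cn 1 M (fun s x => D s x k l).
  have [h h'] := DC k l; split=> // i0; have [? hh] := h' i0; split=> //.
  by split=> //; exact: joint_Cn_cont hh.
have [uc _] := joint_continuous_ode oM DC0 uP i j.
split=> // i0.
have /choice[U UP] : forall x, exists U : R -> 'M[R]_(N + N, p), M x ->
    U 0 = col_mx u0 0 /\ is_ode_solution (tangent_matrix i0 D ^~ x) U.
  move=> x; have [Mx|nMx] := pselect (M x); last by exists (fun _ => 0).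
  have cT k l : continuous (fun s => tangent_matrix i0 D s x k l).
    apply: (@joint_continuous_slice (fun s x => tangent_matrix i0 D s x k l)).
    by move=> s'; have [h _] := joint_Cn_tangent_matrix i0 DC1 k l; exact: h.
  by have [U [U0 Ud]] := linear_ode_exists (col_mx u0 0) cT; exists U.
have du s x : M x -> is_derive x (delta_mx i0 0) (fun y => u s y i j) (dsubmx (U x s) i j).
  by move=> Mx; have [U0 Ud] := UP x Mx; exact: (is_derive_ode oM Mx DC1 uP U0 Ud).
split; first by move=> s x Mx; have [] := du s x Mx.
have := IH _ (tangent_matrix i0 D) (col_mx u0 0) (fun s x => U x s)
  (joint_Cn_tangent_matrix i0 DC) UP (rshift N i) j.
apply: joint_Cn_ext => // s x Mx.
by have [_ e] := du s x Mx; rewrite /partial e mxE.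
Qed.

End OdeDependence.

(** * Continuity, chain rule and smoothness on an open set *)

Section ContinuousAt.
Context {R : realType} {U : topologicalType}.
Implicit Types (f g : U -> R) (x : U).

Lemma continuous_at_cst x (c : R) : {for x, continuous (fun _ => c)}.
Proof. exact: cst_continuous. Qed.

Lemma continuous_at_add f g x : {for x, continuous f} -> {for x, continuous g} ->
  {for x, continuous (fun y => f y + g y)}.
Proof. by move=> fx gx; exact: cvgD. Qed.

Lemma continuous_at_mul f g x : {for x, continuous f} -> {for x, continuous g} ->
  {for x, continuous (fun y => f y * g y)}.
Proof. by move=> fx gx; exact: cvgM. Qed.

Lemma continuous_at_bigsum n (h : 'I_n -> U -> R) x :
  (forall i, {for x, continuous (h i)}) -> {for x, continuous (fun y => \sum_i h i y)}.
Proof. by move=> hx; exact: cvg_bigsum. Qed.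

End ContinuousAt.

Section MatrixDerive.
Context {R : realType} {V : normedModType R}.

Lemma is_derive_mxP p q (F : V -> 'M[R]_(p, q)) (x v : V) (dF : 'M[R]_(p, q)) :
  is_derive x v F dF <->
  forall i j, is_derive x v (fun z => F z i j) (dF i j).
Proof.
split=> [[Fd <-] i j|Fd].
  by apply: DeriveDef; [exact: (derivable_mxP _ _ _).1|rewrite derive_mx// mxE].
have Fdv : derivable F x v by apply/derivable_mxP => i j; have [] := Fd i j.
apply: DeriveDef => //; rewrite derive_mx//; apply/matrixP => i j; rewrite mxE.
by have [] := Fd i j.
Qed.

End MatrixDerive.

Section SmoothFunctions.
Context {R : realType} {m : nat}.
Implicit Types (M : set 'cV[R]_m) (f g : 'cV[R]_m -> R).

Lemma Cn_on_cont n M f : Cn_on n M f -> forall x, M x -> {for x, continuous f}.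
Proof. by case: n => [|n] []. Qed.

Lemma Cn_on_ext n M f g : open M -> (forall x, M x -> f x = g x) ->
  Cn_on n M f -> Cn_on n M g.
Proof.
move=> oM; have ec f' g' : (forall x, M x -> f' x = g' x) ->
   (forall x, M x -> {for x, continuous f'}) -> forall x, M x -> {for x, continuous g'}.
  move=> fg fc x Mx; apply: near_eq_continuous (fc x Mx).
  by apply: filterS (open_near oM Mx) => y; exact: fg.
elim: n f g => [|n IH] f g fg [fc fd]; first by split=> //; exact: ec fc.
split=> [|i]; first exact: ec fc.
have [fi fCn] := fd i; split.
  by move=> x Mx; apply: (derivable_ext oM Mx _ (fi x Mx)) => y; exact: fg.
by apply: IH fCn => x Mx; apply: partial_ext oM Mx _ => y; exact: fg.
Qed.

Lemma Cn_on_cst n M c : Cn_on n M (fun _ => c).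
Proof.
elim: n c => [|n IH] c; first by split=> // x _; exact: cst_continuous.
split=> [x _|i]; first exact: cst_continuous.
split=> [x _|]; first exact: derivable_cst.
rewrite (_ : partial i _ = fun _ => 0); first exact: IH.
by apply/funext => x; rewrite /partial; exact: derive_cst.
Qed.

Lemma is_derive_coord (x : 'cV[R]_m) i j :
  is_derive x (delta_mx i 0 : 'cV[R]_m) (fun y : 'cV[R]_m => y j 0) (j == i)%:R.
Proof.
have h := (is_derive_mxP id x (delta_mx i 0 : 'cV[R]_m) (delta_mx i 0)).1 (is_derive_id _ _) j 0.
by apply: (is_derive_eq h); rewrite mxE andbT.
Qed.

Lemma is_derive_affine (c : R) (l : 'I_m -> R) (x : 'cV[R]_m) i :
  is_derive x (delta_mx i 0 : 'cV[R]_m) (fun y : 'cV[R]_m => c + \sum_j l j * y j 0) (l i).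
Proof.
have h := is_derive_add (is_derive_const x (delta_mx i 0) c)
  (is_derive_bigsum (fun j => is_derive_scal (l j) (is_derive_coord x i j))).
apply: (is_derive_eq h); rewrite add0r (bigD1 i)//= eqxx mulr1 big1 ?addr0// => j ji.
by rewrite (negbTE ji) mulr0.
Qed.

Lemma continuous_affine (c : R) (l : 'I_m -> R) :
  continuous (fun y : 'cV[R]_m => c + \sum_j l j * y j 0).
Proof.
move=> x; apply: continuous_at_add; first exact: continuous_at_cst.
apply: continuous_at_bigsum => j; apply: continuous_at_mul; first exact: continuous_at_cst.
exact: coord_continuous.
Qed.

Lemma Cn_on_affine n M (c : R) (l : 'I_m -> R) :
  Cn_on n M (fun y => c + \sum_j l j * y j 0).
Proof.
case: n => [|n]; first by split=> // x _; exact: continuous_affine.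
split=> [x _|i]; first exact: continuous_affine.
split=> [x _|]; first by have [] := is_derive_affine c l x i.
rewrite (_ : partial i _ = fun _ => l i); first exact: Cn_on_cst.
by apply/funext => x; have [] := is_derive_affine c l x i.
Qed.

Lemma joint_Cn_slice n M (f : R -> 'cV[R]_m -> R) s :
  joint_Cn n M f -> Cn_on n M (f s).
Proof.
have sc (h : R -> 'cV[R]_m -> R) x :
    {for (s, x), continuous (fun z => h z.1 z.2)} -> {for x, continuous (h s)}.
  move=> hc.
  apply: (@continuous_comp _ _ _ (fun x => (s, x)) (fun z : R * 'cV[R]_m => h z.1 z.2)) => //.
  move=> P [[A B] /= [nA nB] AB]; apply: (filterS _ nB) => z Bz.
  by apply: AB; split=> //=; exact: nbhs_singleton nA.
elim: n f => [|n IH] f [fc fd].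
  by split=> // x Mx; apply: sc; exact: fc.
split=> [x Mx|i]; first by apply: sc; exact: fc.
by have [fi fCn] := fd i; split=> [x Mx|]; [exact: fi|exact: IH fCn].
Qed.

Lemma mx_norm_entry p q (A : 'M[R]_(p, q)) i j : `|A i j| <= `|A|.
Proof.
rewrite [leRHS]/Num.Def.normr/= mx_normrE.
exact: (le_bigmax _ (fun ij : 'I_p * 'I_q => `|A ij.1 ij.2|) (i, j)).
Qed.

Lemma mx_norm_le p q (A : 'M[R]_(p, q)) (e : R) : 0 <= e ->
  (forall i j, `|A i j| <= e) -> `|A| <= e.
Proof.
move=> e0 h; rewrite [leLHS]/Num.Def.normr/= mx_normrE.
by apply: bigmax_le => // ij _; exact: h.
Qed.

(* Moving from x to x + d one coordinate at a time. *)
Lemma C1_first_order M f x (e : R) : open M -> M x -> Cn_on 1 M f -> 0 < e ->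
  \forall y \near x, `|f y - f x - \sum_i (y i 0 - x i 0) * partial i f x| <=
    e * \sum_i `|y i 0 - x i 0|.
Proof.
move=> oM Mx [_ fd] e0.
have nP : \forall y \near x, M y /\ forall i, `|partial i f y - partial i f x| <= e.
  apply: filterI; first exact: open_near.
  apply: (@near_forall_imp _ _ (nbhs x) _ (fun i y => `|partial i f y - partial i f x| <= e)) => [y //|i].
  have [_ [pc _]] := fd i.
  by have /cvgrPdist_le /(_ e e0) := pc x Mx; apply: filterS => y; rewrite distrC.
have [r /= r0 rP] : exists2 r : R, 0 < r & forall y : 'cV[R]_m, `|x - y| < r ->
    M y /\ forall i, `|partial i f y - partial i f x| <= e.
  have [r /= r0 rP] := (nbhs_ballP _ _).1 nP; exists r => // y xy.
  by apply: rP; rewrite -ball_normE.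
near=> y.
have yr : `|x - y| < r by near: y; apply: cvgr_dist_lt => //; exact: cvg_id.
pose d i := y i 0 - x i 0.
pose T (j : nat) : 'cV[R]_m := x + \col_i (if (i < j)%N then d i else 0).
have T0 : T 0%N = x.
  by rewrite /T (_ : \col_i _ = 0) ?addr0//; apply/matrixP => i j; rewrite !mxE.
have Tm : T m = y.
  apply/matrixP => i j; rewrite !mxE ltn_ord ord1 /d; ring.
have TS (j : 'I_m) : T j.+1 = T j + d j *: delta_mx j 0.
  apply/matrixP => i k; rewrite !mxE ord1 eqxx andbT ltnS leq_eqVlt.
  have [->|ij] := eqVneq i j; first by rewrite eqxx ltnn mulr1 addr0.
  by rewrite (negbTE (_ : (i : nat) != j)) ?orFb// mulr0 addr0.
have Tr (j : 'I_m) c : `|c| <= `|d j| -> `|x - (T j + c *: delta_mx j 0)| < r.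
  move=> cd; apply: le_lt_trans yr; apply: mx_norm_le => // i k.
  apply: le_trans (mx_norm_entry (x - y) i 0).
  rewrite !mxE !ord1 eqxx andbT -normrN opprB -[leRHS]normrN opprB.
  rewrite [X in `|X|](_ : _ = (if (i < j)%N then d i else 0) + c * (i == j)%:R); last ring.
  have [->|ij] := eqVneq i j; first by rewrite ltnn mulr1 add0r.
  by rewrite mulr0 addr0; case: ifP => // _; rewrite normr0.
have -> : f y - f x = \sum_(j < m) (f (T j.+1) - f (T j)).
  by rewrite -(big_mkord xpredT (fun j => f (T j.+1) - f (T j))) telescope_sumr// T0 Tm.
rewrite -sumrB mulr_sumr; apply: le_trans (ler_norm_sum _ _ _) _.
apply: ler_sum => j _; rewrite -/(d j) TS.
have [d0|d0] := eqVneq (d j) 0.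
  by rewrite d0 scale0r addr0 subrr mul0r subrr !normr0 mulr0.
have := @difference_quotient_bound R _ f (T j) (delta_mx j 0) (partial j f x) e (d j) d0.
move=> h; have {}h := h _.
have : `|(d j)^-1 * (f (T j + d j *: delta_mx j 0) - f (T j)) - partial j f x| <= e.
  apply: h => c cd; have [Mc pc] := rP _ (Tr j c cd); split; last exact: pc.
  by have [dj _] := fd j; exact: dj.
rewrite -ler_pdivrMr ?normr_gt0// -normfV -normrM.
rewrite [X in _ -> `|X| <= _](_ : _ =
  (d j)^-1 * (f (T j + d j *: delta_mx j 0) - f (T j)) - partial j f x)//.
by field.
Unshelve. all: by end_near. Qed.

Lemma is_derive_quotient (V : normedModType R) (f : V -> R) (x v : V) (l : R) :
  is_derive x v f l -> (h^-1 * (f (x + h *: v) - f x)) @[h --> 0^'] --> l.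
Proof.
case=> fd <-; have := fd; rewrite /derivable /derive.
rewrite (_ : (fun h : R => h^-1 *: _) = (fun h : R => h^-1 * (f (x + h *: v) - f x)))//.
by apply/funext => h /=; rewrite [x + _]addrC.
Qed.

(** [Cn_on] speaks of continuous partial derivatives and not of a total differential;
    [C1_first_order] provides the first order expansion that the chain rule rests on. *)
Lemma is_derive_chain M f (g : R -> 'cV[R]_m) (a : R) (dg : 'cV[R]_m) :
  open M -> M (g a) -> Cn_on 1 M f -> is_derive a (1 : R) g dg ->
  is_derive a (1 : R) (fun s => f (g s)) (\sum_i dg i 0 * partial i f (g a)).
Proof.
move=> oM Mg fC gd.
have gdi i : is_derive a (1 : R) (fun s => g s i 0) (dg i 0).
  exact: (is_derive_mxP _ _ _ _).1.
pose q i (h : R) := h^-1 * (g (a + h *: 1) i 0 - g a i 0).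
have qi i : q i h @[h --> 0^'] --> dg i 0 := is_derive_quotient (gdi i).
have gc : {for a, continuous g}.
  by have [gda _] := gd; apply/differentiable_continuous/derivable1_diffP.
apply: is_derive_cvg; apply/cvgrPdist_le => e e0.
have qsum : (\sum_i q i h * partial i f (g a)) @[h --> 0^'] -->
    \sum_i dg i 0 * partial i f (g a).
  by apply: cvg_bigsum => i; apply: cvgM; [exact: qi|exact: cvg_cst].
have qnorm : (\sum_i `|q i h|) @[h --> 0^'] --> \sum_i `|dg i 0|.
  by apply: cvg_bigsum => i; apply: cvg_norm; exact: qi.
(* An eventual bound for the sum of the quotients of the coordinates of [g]. It multiplies the error
   [e'] of the expansion, hence [e' = e / 2 / K]. *)
pose K := \sum_i `|dg i 0| + 1.
have K0 : 0 < K by rewrite /K ltr_wpDl// sumr_ge0.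
pose e' := e / 2 / K.
have e'0 : 0 < e' by rewrite !divr_gt0.
have e2 : 0 < e / 2 by rewrite divr_gt0.
have ga : g (a + h *: 1) @[h --> 0^'] --> g a.
  apply: (@cvg_comp _ _ _ (fun h : R => a + h *: 1) g 0^' (nbhs a)); last exact: gc.
  have : (a + h *: 1) @[h --> (0 : R)] --> a + 0 *: 1.
    apply: cvgD; first exact: cvg_cst.
    by apply: cvgZr_tmp; exact: cvg_id.
  by rewrite scale0r addr0; apply: cvg_trans; apply: cvg_app; exact: nbhs_dnbhs.
have main := ga _ (C1_first_order oM Mg fC e'0).
near=> h.
have h0 : h != 0 by near: h; exact: nbhs_dnbhs_neq.
have h1 : `|\sum_i dg i 0 * partial i f (g a) - \sum_i q i h * partial i f (g a)| <= e / 2.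
  by near: h; move/cvgrPdist_le : qsum; apply.
have h2 : \sum_i `|q i h| <= K.
  have : `|\sum_i `|dg i 0| - \sum_i `|q i h| | <= 1.
    by near: h; move/cvgrPdist_le : qnorm; apply.
  by rewrite ler_norml /K; lra.
have h3 : `|f (g (a + h *: 1)) - f (g a) - \sum_i (g (a + h *: 1) i 0 - g a i 0) * partial i f (g a)| <=
    e' * \sum_i `|g (a + h *: 1) i 0 - g a i 0|.
  by near: h; exact: main.
set S := \sum_i dg i 0 * partial i f (g a) in h1 *.
set Sq := \sum_i q i h * partial i f (g a) in h1 *.
have -> : S - h^-1 * (f (g (a + h *: 1)) - f (g a)) = (S - Sq) -
   h^-1 * (f (g (a + h *: 1)) - f (g a) - \sum_i (g (a + h *: 1) i 0 - g a i 0) * partial i f (g a)).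
  have -> : Sq = h^-1 * \sum_i (g (a + h *: 1) i 0 - g a i 0) * partial i f (g a).
    by rewrite mulr_sumr; apply: eq_bigr => i _; rewrite mulrA.
  by ring.
apply: le_trans (ler_normB _ _) _; rewrite normrM.
have h4 : `|h^-1| * `|f (g (a + h *: 1)) - f (g a) - \sum_i (g (a + h *: 1) i 0 - g a i 0) * partial i f (g a)| <= e / 2.
  apply: le_trans (ler_wpM2l (normr_ge0 _) h3) _.
  rewrite mulrCA mulr_sumr (eq_bigr (fun i => `|q i h|)); last first.
    by move=> i _; rewrite -normrM.
  apply: le_trans (ler_wpM2l (ltW e'0) h2) _.
  by rewrite /e' divfK// gt_eqF.
by lra.
Unshelve. all: by end_near. Qed.

Lemma joint_Cn_scal n M (a : R -> R) (f : R -> 'cV[R]_m -> R) : open M ->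
  continuous a -> joint_Cn n M f -> joint_Cn n M (fun s x => a s * f s x).
Proof.
move=> oM ca; have sc (h : R -> 'cV[R]_m -> R) :
   (forall s x, M x -> {for (s, x), continuous (fun z => h z.1 z.2)}) ->
   forall s x, M x -> {for (s, x), continuous (fun z => a z.1 * h z.1 z.2)}.
  move=> hc s x Mx.
  apply: (@continuous_at_mul R _ (fun z : R * 'cV[R]_m => a z.1)); last exact: hc.
  apply: (@continuous_comp _ _ _ (fun z : R * 'cV[R]_m => z.1) a); last exact: ca.
  exact: cvg_fst.
elim: n f => [|n IH] f [fc fd]; first by split=> //; exact: sc.
split=> [|i]; first exact: sc.
have [fi fCn] := fd i.
have dS s x : M x -> is_derive x (delta_mx i 0) (fun y => a s * f s y) (a s * partial i (f s) x).
  by move=> Mx; apply: is_derive_scal; apply: derivableP; exact: fi.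
split; first by move=> s x Mx; have [] := dS s x Mx.
apply: (joint_Cn_ext oM _ (IH _ fCn)) => s x Mx.
by have [_ e] := dS s x Mx; rewrite /partial e.
Qed.

Lemma joint_Cn_add n M (f g : R -> 'cV[R]_m -> R) : open M ->
  joint_Cn n M f -> joint_Cn n M g -> joint_Cn n M (fun s x => f s x + g s x).
Proof.
move=> oM; have sc (h h' : R -> 'cV[R]_m -> R) :
   (forall s x, M x -> {for (s, x), continuous (fun z => h z.1 z.2)}) ->
   (forall s x, M x -> {for (s, x), continuous (fun z => h' z.1 z.2)}) ->
   forall s x, M x -> {for (s, x), continuous (fun z => h z.1 z.2 + h' z.1 z.2)}.
  by move=> hc hc' s x Mx; apply: continuous_at_add; [exact: hc|exact: hc'].
elim: n f g => [|n IH] f g [fc fd] [gc gd]; first by split=> //; exact: sc.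
split=> [|i]; first exact: sc.
have [fi fCn] := fd i; have [gi gCn] := gd i.
have dS s x : M x -> is_derive x (delta_mx i 0) (fun y => f s y + g s y)
    (partial i (f s) x + partial i (g s) x).
  by move=> Mx; apply: is_derive_add; apply: derivableP; [exact: fi|exact: gi].
split; first by move=> s x Mx; have [] := dS s x Mx.
apply: (joint_Cn_ext oM _ (IH _ _ fCn gCn)) => s x Mx.
by have [_ e] := dS s x Mx; rewrite /partial e.
Qed.

Lemma joint_Cn_bigsum n M (I : Type) (r : seq I) (f : I -> R -> 'cV[R]_m -> R) : open M ->
  (forall i, joint_Cn n M (f i)) -> joint_Cn n M (fun s x => \sum_(i <- r) f i s x).
Proof.
move=> oM fC; elim: r => [|i r IH].
  apply: (joint_Cn_ext oM _ (joint_Cn_cst n M 0)) => s x _.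
  by rewrite big_nil.
apply: (joint_Cn_ext oM _ (joint_Cn_add oM (fC i) IH)) => s x _.
by rewrite big_cons.
Qed.

(** For an affine map the partial derivative in direction i is the sum over j of [E s j i] times
    [partial j f] at [Phi s x]. The factors [E s j i] do not involve x, so the induction stays
    within compositions with the same [Phi]. *)
Lemma joint_Cn_comp_affine n M f (Phi : R -> 'cV[R]_m -> 'cV[R]_m)
    (E : R -> 'M[R]_m) (v : R -> 'cV[R]_m) : open M ->
  (forall s x, M x -> M (Phi s x)) ->
  (forall s x, M x -> Phi s x = E s *m x + v s) ->
  (forall i j, continuous (fun s => E s i j)) ->
  (forall i, continuous (fun s => v s i 0)) ->
  Cn_on n M f -> joint_Cn n M (fun s x => f (Phi s x)).
Proof.
move=> oM PM Pa cE cv.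
have Pc i s x : {for (s, x), continuous (fun z => (E z.1 *m z.2 + v z.1) i 0)}.
  rewrite (_ : (fun z => _) = (fun z : R * 'cV[R]_m => \sum_j E z.1 i j * z.2 j 0 + v z.1 i 0)).
    2: by apply/funext => z; rewrite !mxE.
  apply: continuous_at_add; last first.
    apply: (@continuous_comp _ _ _ (fun z : R * 'cV[R]_m => z.1) (fun s => v s i 0)).
      exact: cvg_fst.
    exact: cv.
  apply: continuous_at_bigsum => j; apply: continuous_at_mul.
    apply: (@continuous_comp _ _ _ (fun z : R * 'cV[R]_m => z.1) (fun s => E s i j)).
      exact: cvg_fst.
    exact: cE.
  apply: (@continuous_comp _ _ _ (fun z : R * 'cV[R]_m => z.2) (fun x : 'cV[R]_m => x j 0)).
    exact: cvg_snd.
  exact: coord_continuous.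
have Pc' s x : {for (s, x), continuous (fun z => E z.1 *m z.2 + v z.1)}.
  apply/cvgrPdist_le => e e0.
  apply: (@near_forall_imp _ _ (nbhs (s, x)) _ (fun i z =>
      `|(E s *m x + v s) i 0 - (E z.1 *m z.2 + v z.1) i 0| <= e)) => [z h|i].
    by apply: mx_norm_le => [|i j]; [exact: ltW|rewrite ord1; have := h i; rewrite !mxE].
  by have /cvgrPdist_le := Pc i s x; apply.
have cc g : (forall x, M x -> {for x, continuous g}) ->
    forall s x, M x -> {for (s, x), continuous (fun z => g (Phi z.1 z.2))}.
  move=> gc s x Mx.
  apply: (@near_eq_continuous R _ (fun z : R * 'cV[R]_m => g (E z.1 *m z.2 + v z.1))).
    exists (setT, M); first by split; [exact: filterT|exact: open_near].
    by move=> [s' y] [_ /= My]; rewrite Pa.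
  apply: (@continuous_comp _ _ _ (fun z : R * 'cV[R]_m => E z.1 *m z.2 + v z.1) g) => /=.
    exact: Pc'.
  by rewrite -Pa//; apply: gc; exact: PM.
elim: n f => [|n IH] f fC; first by split=> //; apply: cc; exact: Cn_on_cont fC.
have fC1 : Cn_on 1 M f.
  have [fc fd] := fC; split=> // i; have [fi fCn] := fd i; split=> //.
  by split=> //; exact: Cn_on_cont fCn.
split=> [|i]; first by apply: cc; exact: Cn_on_cont fC.
have dP s x : M x -> is_derive x (delta_mx i 0) (fun y => f (Phi s y))
    (\sum_j E s j i * partial j f (Phi s x)).
  move=> Mx.
  (* Moving x along the i-th coordinate moves [Phi s x] along the i-th column of [E s]; the chain
     rule is applied to this line. *)
  have dline : is_derive (0 : R) (1 : R) (fun h => Phi s x + h *: col i (E s)) (col i (E s)).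
    apply/is_derive_mxP => k l.
    have h := is_derive_add (is_derive_const (0 : R) (1 : R) (Phi s x k l))
      (is_derive_scal (E s k i) (is_derive_id (0 : R) (1 : R))).
    rewrite add0r mulr1 in h; rewrite mxE (_ : (fun z => _) = (fun z => Phi s x k l + E s k i * z)) //.
    by apply/funext => z; rewrite !mxE mulrC.
  have := @is_derive_chain M f (fun h => Phi s x + h *: col i (E s)) 0 (col i (E s)) oM _ fC1 dline.
  rewrite scale0r addr0 => /(_ (PM s x Mx)) hc.
  apply: is_derive_cvg.
  have := is_derive_quotient hc; rewrite scale0r addr0.
  rewrite (_ : \sum_j _ = \sum_j E s j i * partial j f (Phi s x)); last first.
    by apply: eq_bigr => j _; rewrite mxE.
  apply: cvg_trans; apply: near_eq_cvg.
  have := nbhs_dnbhs (near_segment (delta_mx i 0) (open_near oM Mx)).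
  apply: filterS => h /(_ h (lexx _)) Mh.
  rewrite add0r [h *: 1]mulr1 (Pa s (x + _))// mulmxDr -scalemxAr -colE.
  by rewrite Pa// addrAC.
have [_ /(_ i)] := fC; move=> _.
split; first by move=> s x Mx; have [] := dP s x Mx.
apply: (@joint_Cn_ext _ _ _ M (fun s x => \sum_j E s j i * partial j f (Phi s x))) => //.
  by move=> s x Mx; have [_ e] := dP s x Mx; rewrite /partial e.
apply: joint_Cn_bigsum => // j; apply: joint_Cn_scal => //.
by apply: IH; have [_ /(_ j)[]] := fC.
Qed.

End SmoothFunctions.

(** * Affine flows and equivariance of the coefficients *)

Section AffineFlow.
Context {R : realType} {m : nat}.
Variables (M : set 'cV[R]_m) (Y : 'cV[R]_m -> 'cV[R]_m) (Phi : R -> 'cV[R]_m -> 'cV[R]_m).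
Variables (A : 'M[R]_m) (b : 'cV[R]_m).
Hypothesis Phi_flow : flow_on M Y Phi.
Hypothesis Y_affine : forall x, M x -> Y x = A *m x + b.

Lemma flow_on_in s x : M x -> M (Phi s x).
Proof. by move=> Mx; have [_ /(_ s)[]] := Phi_flow Mx. Qed.

Lemma flow_on_entry_derive s x i j : M x ->
  is_derive s (1 : R) (fun z => Phi z x i j) ((A *m Phi s x + b) i j).
Proof.
move=> Mx; have [_ /(_ s)[Ms h]] := Phi_flow Mx.
by rewrite -Y_affine//; exact: (is_derive_mxP _ _ _ _).1 h i j.
Qed.

Let cstA : forall i j, continuous (fun _ : R => A i j).
Proof. by move=> i j; exact: cst_continuous. Qed.

Lemma affine_ode_uniq (u v : R -> 'cV[R]_m) :
  (forall (s : R) i j, is_derive s (1 : R) (fun z => u z i j) ((A *m u s + b) i j)) ->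
  (forall (s : R) i j, is_derive s (1 : R) (fun z => v z i j) ((A *m v s + b) i j)) ->
  u 0 = v 0 -> forall s, u s = v s.
Proof.
move=> ud vd uv0 s; apply/eqP; rewrite -subr_eq0; apply/eqP.
apply: (@linear_ode_uniq R m 1 (fun _ => A) (fun z => u z - v z) (fun _ => 0) cstA).
- move=> z i j; rewrite (_ : (fun z => _) = (fun z => u z i j - v z i j)).
    apply: (is_derive_eq (is_derive_sub (ud z i j) (vd z i j))).
    by rewrite mulmxBr !mxE; ring.
  by apply/funext => y; rewrite !mxE.
- by move=> z i j; rewrite mulmx0 [X in is_derive _ _ _ X]mxE; exact: is_derive_const.
- by rewrite uv0 subrr.
Qed.

(** [flow_on] only says that each trajectory solves the equation; the group law follows from
    uniqueness for the affine equation. *)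
Lemma flow_on_add s a x : M x -> Phi s (Phi a x) = Phi (s + a) x.
Proof.
move=> Mx; have Ma := flow_on_in a Mx.
apply: (@affine_ode_uniq (fun s => Phi s (Phi a x)) (fun s => Phi (s + a) x)).
- by move=> z i j; exact: flow_on_entry_derive.
- move=> z i j; have h := flow_on_entry_derive (z + a) i j Mx.
  rewrite -[X in is_derive _ _ _ X]mulr1.
  apply: (@is_derive1_comp _ (fun z => Phi z x i j) (fun z => z + a)) => //.
  rewrite -[X in is_derive _ _ _ X]addr0.
  exact: is_derive_add (is_derive_id _ _) (is_derive_const _ _ _).
- by rewrite add0r (Phi_flow Ma).1.
Qed.

Lemma flow_on_cancel a x : M x -> Phi (- a) (Phi a x) = x.
Proof. by move=> Mx; rewrite flow_on_add// addNr (Phi_flow Mx).1. Qed.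

(** Differences of two trajectories solve the homogeneous equation and are therefore transported by
    its fundamental matrix [E]. The translation part is read off from a single reference
    trajectory. *)
Lemma flow_on_affine : exists (E : R -> 'M[R]_m) (v : R -> 'cV[R]_m),
  [/\ E 0 = 1%:M /\ is_ode_solution (fun _ => A) E,
      forall s x, M x -> Phi s x = E s *m x + v s
    & forall i, continuous (fun s => v s i 0)].
Proof.
have [E [E0 Ed]] := linear_ode_exists 1%:M cstA.
have EP (u : R -> 'cV[R]_m) : is_ode_solution (fun _ => A) u -> forall s, u s = E s *m u 0.
  move=> ud; apply: (@linear_ode_uniq R m 1 (fun _ => A)) => //; last by rewrite E0 mul1mx.
  move=> s i j; rewrite (_ : (fun z => _) = (fun z => \sum_l u 0 l j * E z i l)).
    apply: (is_derive_eq (is_derive_bigsum (fun l => is_derive_scal (u 0 l j) (Ed s i l)))).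
    by rewrite mulmxA mxE; apply: eq_bigr => l _; rewrite mulrC.
  by apply/funext => z; rewrite mxE; apply: eq_bigr => l _; rewrite mulrC.
(* For empty [M] there is no reference trajectory, and any continuous [v] will do. *)
have [[x0 Mx0]|M0] := pselect (exists x, M x); last first.
  exists E, (fun _ => 0); split=> // [s x Mx|i]; first by case: M0; exists x.
  exact: cst_continuous.
exists E, (fun s => Phi s x0 - E s *m x0); split=> // [s x Mx|i s].
  have : Phi s x - Phi s x0 = E s *m (x - x0).
    rewrite -[in RHS](Phi_flow Mx).1 -[in RHS](Phi_flow Mx0).1.
    apply: (EP (fun s => Phi s x - Phi s x0)) => z i j.
    rewrite (_ : (fun z => _) = (fun z => Phi z x i j - Phi z x0 i j)).
      have h1 := flow_on_entry_derive z i j Mx.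
      have h2 := flow_on_entry_derive z i j Mx0.
      apply: (is_derive_eq (is_derive_sub h1 h2)).
      by rewrite mulmxBr !mxE; ring.
    by apply/funext => y; rewrite !mxE.
  by rewrite mulmxBr => /eqP; rewrite subr_eq => /eqP ->; rewrite addrAC addrA.
rewrite (_ : (fun s => _) = (fun s => Phi s x0 i 0 + \sum_l E s i l * - x0 l 0)).
  apply: continuous_at_add; first exact: is_derive_continuous (flow_on_entry_derive s i 0 Mx0).
  apply: continuous_at_bigsum => l; apply: continuous_at_mul; last exact: continuous_at_cst.
  exact: is_derive_continuous (Ed s i l).
apply/funext => z; rewrite !mxE -sumrN; congr (_ + _).
by apply: eq_bigr => l _; rewrite mulrN.
Qed.

End AffineFlow.

Section QuasiStrongSymmetry.
Context {R : realType} {m k : nat}.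
Variables (M : set 'cV[R]_m) (mu : 'cV[R]_m -> 'cV[R]_m) (sigma : 'cV[R]_m -> 'M[R]_(m, k)).
Variables (Y : 'cV[R]_m -> 'cV[R]_m) (C : 'cV[R]_m -> 'M[R]_k).
Hypotheses (M_open : open M) (mu_smooth : smooth_on M mu) (sigma_smooth : smooth_on M sigma).
Hypothesis V_sym : quasi_strong_symmetry M mu sigma Y C.
Variables (Phi : R -> 'cV[R]_m -> 'cV[R]_m) (A : 'M[R]_m) (b : 'cV[R]_m).
Hypothesis Phi_flow : flow_on M Y Phi.
Hypothesis Y_affine : forall x, M x -> Y x = A *m x + b.

Let Phi_in s x : M x -> M (Phi s x) := flow_on_in Phi_flow s (x := x).

Let cstA : forall i j, continuous (fun _ : R => A i j).
Proof. by move=> i j; exact: cst_continuous. Qed.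

Lemma partial_affine_field i j x : M x -> partial i (fun y => Y y j 0) x = A j i.
Proof.
move=> Mx; rewrite (@partial_ext _ _ M _ _ (fun y => b j 0 + \sum_l A j l * y l 0))//.
  by have [_] := is_derive_affine (b j 0) (A j) x i.
by move=> y My; rewrite Y_affine// !mxE addrC.
Qed.

Lemma lie_drift x j : M x -> lie Y (fun y => mu y j 0) x = (A *m mu x) j 0.
Proof.
move=> Mx; have [_ _ _ /(_ x Mx j)/eqP + _] := V_sym.
rewrite subr_eq0 => /eqP ->; rewrite /generator big1 ?mulr0 ?add0r.
  rewrite mxE; apply: eq_bigr => i _.
  by rewrite partial_affine_field// mulrC.
move=> a _; rewrite big1// => i _; rewrite big1// => l _.
rewrite (@partial_ext _ _ M _ _ (fun _ => A j l)).
- by rewrite /partial derive_cst mulr0.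
- by [].
- by [].
- by move=> y My; rewrite partial_affine_field.
Qed.

Lemma lie_diffusion x j a : M x ->
  lie Y (fun y => sigma y j a) x = (A *m sigma x - sigma x *m C x) j a.
Proof.
move=> Mx; have [_ _ _ _ /(_ x Mx j a)/eqP] := V_sym.
rewrite addr_eq0 subr_eq => /eqP ->; rewrite addrC !mxE; congr (_ - _).
by apply: eq_bigr => i _; rewrite partial_affine_field// mulrC.
Qed.

Let C1 p q (g : 'cV[R]_m -> 'M[R]_(p, q)) i j : smooth_on M g ->
  Cn_on 1 M (fun x => g x i j).
Proof. by move=> h; exact: h. Qed.

Lemma is_derive_along_flow (f : 'cV[R]_m -> R) s x : Cn_on 1 M f -> M x ->
  is_derive s (1 : R) (fun z => f (Phi z x)) (lie Y f (Phi s x)).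
Proof.
move=> fC Mx; have [_ /(_ s)[Ms d]] := Phi_flow Mx.
exact: is_derive_chain M_open Ms fC d.
Qed.

Lemma drift_equivariant (E : R -> 'M[R]_m) : E 0 = 1%:M -> is_ode_solution (fun _ => A) E ->
  forall s x, M x -> mu (Phi s x) = E s *m mu x.
Proof.
move=> E0 Ed s x Mx.
apply: (@linear_ode_uniq R m 1 (fun _ => A) (fun s => mu (Phi s x)) (fun s => E s *m mu x) cstA).
- move=> z i j; rewrite ord1 -lie_drift; last exact: Phi_in.
  exact: is_derive_along_flow (C1 i 0 mu_smooth) Mx.
- move=> z i j; rewrite (_ : (fun z => _) = (fun z => \sum_l mu x l j * E z i l)).
    apply: (is_derive_eq (is_derive_bigsum (fun l => is_derive_scal (mu x l j) (Ed z i l)))).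
    by rewrite mulmxA [RHS]mxE; apply: eq_bigr => l _; rewrite mulrC.
  by apply/funext => y; rewrite mxE; apply: eq_bigr => l _; rewrite mulrC.
- by rewrite E0 mul1mx (Phi_flow Mx).1.
Qed.

Lemma diffusion_equivariant (E : R -> 'M[R]_m) (B : R -> 'M[R]_k) x :
  E 0 = 1%:M -> is_ode_solution (fun _ => A) E -> M x ->
  B 0 = 1%:M -> is_ode_solution (fun s => C (Phi s x)) B ->
  forall s, sigma (Phi s x) *m B s = E s *m sigma x.
Proof.
move=> E0 Ed Mx B0 Bd.
apply: (@linear_ode_uniq R m k (fun _ => A) (fun s => sigma (Phi s x) *m B s)
  (fun s => E s *m sigma x) cstA).
- move=> z i j; rewrite (_ : (fun z => _) = (fun z => \sum_l sigma (Phi z x) i l * B z l j)).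
    apply: (is_derive_eq (is_derive_bigsum (fun l => is_derive_mul
       (is_derive_along_flow z (C1 i l sigma_smooth) Mx) (Bd z l j)))).
    rewrite big_split/=; under eq_bigr do rewrite (lie_diffusion _ _ (Phi_in z Mx)).
    (* The rotation [B] is there for this cancellation: the term [- sigma C B] from the determining
       equation meets [sigma B' = sigma C B]. *)
    have -> : A *m (sigma (Phi z x) *m B z) =
       (A *m sigma (Phi z x) - sigma (Phi z x) *m C (Phi z x)) *m B z
       + sigma (Phi z x) *m (C (Phi z x) *m B z).
      by rewrite mulmxBl !mulmxA subrK.
    rewrite [RHS]mxE; congr (_ + _); first by rewrite [RHS]mxE.
    by rewrite [RHS]mxE.
  by apply/funext => y; rewrite mxE.
- move=> z i j; rewrite (_ : (fun z => _) = (fun z => \sum_l sigma x l j * E z i l)).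
    apply: (is_derive_eq (is_derive_bigsum (fun l => is_derive_scal (sigma x l j) (Ed z i l)))).
    by rewrite mulmxA [RHS]mxE; apply: eq_bigr => l _; rewrite mulrC.
  by apply/funext => y; rewrite mxE; apply: eq_bigr => l _; rewrite mulrC.
- by rewrite E0 B0 mul1mx mulmx1 (Phi_flow Mx).1.
Qed.

(** The product differentiated is the transpose of [B] times [B], whose derivative vanishes at once
    because [C] is skew; for the opposite order one would only get a commutator. A left inverse of a
    square matrix is also a right inverse. *)
Lemma rotation_orthogonal (B : R -> 'M[R]_k) x : M x ->
  B 0 = 1%:M -> is_ode_solution (fun s => C (Phi s x)) B ->
  forall s, B s *m (B s)^T = 1%:M.
Proof.
move=> Mx B0 Bd s; apply: mulmx1C.
have [_ Cskew _ _ _] := V_sym.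
have d (z : R) i j : is_derive z (1 : R) (fun z => ((B z)^T *m B z) i j) 0.
  rewrite (_ : (fun z => _) = (fun z => \sum_l B z l i * B z l j)).
    apply: (is_derive_eq (is_derive_bigsum (fun l => is_derive_mul (Bd z l i) (Bd z l j)))).
    rewrite big_split/=.
    have -> : \sum_l (C (Phi z x) *m B z) l i * B z l j = ((C (Phi z x) *m B z)^T *m B z) i j.
      by rewrite [RHS]mxE; apply: eq_bigr => l _; rewrite [in RHS]mxE.
    have -> : \sum_l B z l i * (C (Phi z x) *m B z) l j = ((B z)^T *m (C (Phi z x) *m B z)) i j.
      by rewrite [RHS]mxE; apply: eq_bigr => l _; rewrite [in RHS]mxE.
    rewrite trmx_mul Cskew; last exact: Phi_in.
    by rewrite mulmxN mulNmx mulmxA [X in X + _]mxE addNr.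
  by apply/funext => y; rewrite mxE; apply: eq_bigr => l _; rewrite mxE.
apply/matrixP => i j; have -> : 1%:M = (B 0)^T *m B 0 by rewrite B0 trmx1 mulmx1.
have [s0|/ltW s0] := leP 0 s.
  by apply/esym; exact: (is_derive0_eq (f := fun z => ((B z)^T *m B z) i j) s0).
exact: (is_derive0_eq (f := fun z => ((B z)^T *m B z) i j) s0).
Qed.

(** The coefficients [C (Phi s x)] are of class [joint_Cn] for every n by affinity of the flow, and
    [joint_Cn_ode] passes this on to the solution. *)
Lemma rotation_exists : exists B : R -> 'cV[R]_m -> 'M[R]_k,
  (forall x, M x -> B 0 x = 1%:M /\ is_ode_solution (fun s => C (Phi s x)) (B ^~ x)) /\
  forall s, smooth_on M (B s).
Proof.
have [E [v [[E0 Ed] Pa cv]]] := flow_on_affine Phi_flow Y_affine.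
have [[_ C_smooth] _ _ _ _] := V_sym.
have cE i j : continuous (fun s => E s i j).
  by move=> s; exact: is_derive_continuous (Ed s i j).
have CC n i j : joint_Cn n M (fun s x => C (Phi s x) i j).
  by apply: (joint_Cn_comp_affine (f := fun x => C x i j) M_open Phi_in Pa cE cv).
have /choice[B BP] : forall x, exists B : R -> 'M[R]_k, M x ->
    B 0 = 1%:M /\ is_ode_solution (fun s => C (Phi s x)) B.
  move=> x; have [Mx|nMx] := pselect (M x); last by exists (fun _ => 0).
  have cC i j : continuous (fun s => C (Phi s x) i j).
    apply: (@joint_continuous_slice _ _ (fun s x => C (Phi s x) i j)) => s.
    by have [h _] := CC 0%N i j; exact: h.
  by have [B [B0 Bd]] := linear_ode_exists 1%:M cC; exists B.
exists (fun s x => B x s); split=> // s n i j.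
apply: (@joint_Cn_slice _ _ n M (fun s x => B x s i j)).
exact: (@joint_Cn_ode _ _ n k k M (fun s x => C (Phi s x)) 1%:M (fun s x => B x s)
  M_open (CC n) BP).
Qed.

Lemma affine_flow_diffeo a : diffeo_on M (Phi a).
Proof.
have [E [v [_ Pa _]]] := flow_on_affine Phi_flow Y_affine.
have sm s : smooth_on M (Phi s).
  move=> n i j; apply: (Cn_on_ext M_open _ (Cn_on_affine n M (v s i 0) (E s i))) => x Mx.
  by rewrite Pa// ord1 !mxE addrC.
exists (Phi (- a)); split=> // x Mx; split; try exact: Phi_in.
  exact: (flow_on_cancel Phi_flow Y_affine).
by rewrite -{1}(opprK a); exact: (flow_on_cancel Phi_flow Y_affine).
Qed.

End QuasiStrongSymmetry.

(** * Freezing a sub-sigma-algebra *)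

Section WeightedImage.
Context {d d' : measure_display} {T : measurableType d} {T' : measurableType d'} {R : realType}.
Variables (P : {measure set T -> \bar R}) (phi : T -> T') (g : T -> R).

(** The push-forward by [phi] of the measure with density [g]. The measurability and sign proofs are
    arguments so that the term itself determines the measure structure attached to it below. *)
Definition weighted_image (mphi : measurable_fun setT phi) (mg : measurable_fun setT g)
    (g0 : forall x, 0 <= g x) (A : set T') : \bar R :=
  (\int[P]_(x in phi @^-1` A) (g x)%:E)%E.

Hypotheses (mphi : measurable_fun setT phi) (mg : measurable_fun setT g)
  (g0 : forall x, 0 <= g x).
Local Notation nu := (weighted_image mphi mg g0).

Let mpre (A : set T') : measurable A -> measurable (phi @^-1` A).
Proof. by move=> mA; rewrite -[_ @^-1` _]setTI; exact: mphi. Qed.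

Let nu0 : nu set0 = 0%E.
Proof. by rewrite /weighted_image preimage_set0 integral_set0. Qed.

Let nu_ge0 A : (0 <= nu A)%E.
Proof. by apply: integral_ge0 => x _; rewrite lee_fin. Qed.

Let nu_sigma_additive : semi_sigma_additive nu.
Proof.
move=> F mF tF mUF; rewrite /weighted_image preimage_bigcup.
apply: cvg_toP.
  apply: ereal_nondecreasing_is_cvgn => m n mn.
  apply: lee_sum_nneg_natr => // k _ _.
  by apply: integral_ge0 => x _; rewrite lee_fin.
rewrite ge0_integral_bigcup//=.
- by move=> n; exact: mpre.
- by apply: measurable_funTS; exact/measurable_EFinP.
- by move=> x _; rewrite lee_fin.
- apply/trivIsetP => /= i j _ _ ij; rewrite -preimage_setI.
  by move/trivIsetP : tF => /(_ _ _ _ _ ij) ->//; rewrite preimage_set0.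
Qed.

HB.instance Definition _ := isMeasure.Build _ _ _ nu nu0 nu_ge0 nu_sigma_additive.

Import HBNNSimple.

Lemma ge0_integral_weighted_image (f : T' -> \bar R) : measurable_fun setT f ->
  (forall y, (0 <= f y)%E) ->
  (\int[nu]_y f y = \int[P]_x (f (phi x) * (g x)%:E))%E.
Proof.
move=> mf f0.
have mgE : measurable_fun setT (EFin \o g) by exact/measurable_EFinP.
pose f_ := nnsfun_approx measurableT mf.
have mfphi n : measurable_fun setT (fun x => (f_ n (phi x))%:E).
  apply/measurable_EFinP; apply: (measurableT_comp (f := f_ n)) => //.
transitivity (limn (fun n => \int[nu]_x (f_ n x)%:E)%E).
  rewrite -monotone_convergence//.
  - by apply: eq_integral => y _; apply/esym/cvg_lim => //; exact: cvg_nnsfun_approx.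
  - by move=> n; exact/measurable_EFinP/measurable_funP.
  - by move=> n y _; rewrite lee_fin.
  - by move=> y _ m n mn; rewrite lee_fin; exact/lefP/nd_nnsfun_approx.
transitivity (limn (fun n => \int[P]_x ((f_ n (phi x))%:E * (g x)%:E))%E); last first.
  rewrite -monotone_convergence//.
  - apply: eq_integral => x _; apply/cvg_lim => //.
    by apply: cvgeMr => //; exact: cvg_nnsfun_approx.
  - by move=> n; apply: emeasurable_funM.
  - by move=> n x _; rewrite -EFinM lee_fin mulr_ge0.
  - by move=> x _ m n mn; rewrite lee_wpmul2r ?lee_fin//; exact/lefP/nd_nnsfun_approx.
congr (limn _); apply/funext => n.
have mp (A : set T') x : (x \in phi @^-1` A) = (phi x \in A).
  by apply/idP/idP; rewrite !inE.
have mind r : measurable_fun setT (fun x => \1_(f_ n @^-1` [set r]) (phi x) : R).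
  rewrite (_ : (fun x => _) = \1_(phi @^-1` (f_ n @^-1` [set r]))).
    by apply: measurable_indic; exact: mpre.
  by apply/funext => x; rewrite !indicE mp.
transitivity (\sum_(k \in range (f_ n))
    \int[P]_x (((k * \1_(f_ n @^-1` [set k]) (phi x))%:E) * (g x)%:E))%E.
  under eq_integral do rewrite fimfunE -fsumEFin//.
  rewrite ge0_integral_fsum//; last 2 first.
  - by move=> y; exact/measurable_EFinP/measurable_funM.
  - by move=> y x _; rewrite nnfun_muleindic_ge0.
  apply: eq_fsbigr => r _; rewrite integralZl_indic_nnsfun// integral_indic//= setIT.
  rewrite -[LHS]/(r%:E * \int[P]_(x in phi @^-1` (f_ n @^-1` [set r])) (g x)%:E)%E.
  have [r0|r0] := ltP r 0.
    rewrite preimage_nnfun0// preimage_set0 integral_set0 mule0 integral0_eq// => x _.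
    by rewrite indic0 mulr0 mul0e.
  under [RHS]eq_integral do rewrite EFinM -muleA.
  have m1 : measurable_fun setT (fun x => (\1_(f_ n @^-1` [set r]) (phi x))%:E * (g x)%:E)%E.
    apply: emeasurable_funM => //; apply/measurable_EFinP.
    exact: mind.
  rewrite ge0_integralZl_EFin//; last by move=> x _; rewrite mule_ge0// lee_fin.
  congr (_ * _)%E; rewrite integral_mkcond; apply: eq_integral => x _.
  rewrite patchE indicE mp; case: ifP => _; rewrite ?mul1e ?mul0e//.
rewrite -ge0_integral_fsum//; last 2 first.
- move=> y; apply: emeasurable_funM => //; apply/measurable_EFinP; apply: measurable_funM => //.
- by move=> y x _; apply: mule_ge0; rewrite ?lee_fin// -lee_fin EFinM nnfun_muleindic_ge0.
apply: eq_integral => x _; rewrite [in RHS]fimfunE -fsumEFin// ge0_mule_fsuml// => y.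
by rewrite EFinM nnfun_muleindic_ge0.
Qed.

End WeightedImage.

Section SubSigmaAlgebra.
Context {d : measure_display} {T : measurableType d} {R : realType}.
Variable G : set (set T).
Hypothesis G_sigma : sigma_algebra setT G.

Definition sub_measurable (X : T -> R) := forall A : set R, measurable A -> G (X @^-1` A).

(** [G] is a bare family of sets. Its generated structure adds no sets, since [G] is a
    sigma-algebra, and makes the theorems on measurable functions applicable relative to [G]. *)
Let TG : measurableType _ := g_sigma_algebraType G.

Lemma sub_measurableP (X : T -> R) :
  sub_measurable X <-> measurable_fun setT (X : TG -> R).
Proof.
split=> [GX _ A mA|mX A mA]; last first.
  have := mX measurableT A mA; rewrite setTI.
  by rewrite /measurable/= sigma_algebra_id.
by rewrite setTI /measurable/= sigma_algebra_id//; exact: GX.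
Qed.

Lemma sub_measurable_bigcup (I : countType) (F : I -> set T) :
  (forall i, G (F i)) -> G (\bigcup_i F i).
Proof.
move=> GF; have : measurable (\bigcup_i (F i : set TG)).
  apply: countable_bigcupT_measurable; first exact: countableP.
  by move=> i; rewrite /measurable/= sigma_algebra_id.
by rewrite /measurable/= sigma_algebra_id.
Qed.

Lemma sub_measurable_bigcap (I : finType) (F : I -> set T) :
  (forall i, G (F i)) -> G (\bigcap_i F i).
Proof.
move=> GF; have : measurable (\bigcap_i (F i : set TG)).
  apply: fin_bigcap_measurable; first exact: finite_finset.
  by move=> i _; rewrite /measurable/= sigma_algebra_id.
by rewrite /measurable/= sigma_algebra_id.
Qed.

(** Nothing is known of f outside [M], so f need not be Borel. But the part of [M] where f exceeds a
    is open, hence a countable union of rational boxes, and membership of [X] in a box is decided by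
    its coordinates. *)
Lemma sub_measurable_continuous n (M : set 'cV[R]_n) (f : 'cV[R]_n -> R) (X : T -> 'cV[R]_n) :
  open M -> (forall w, M (X w)) -> (forall x, M x -> {for x, continuous f}) ->
  (forall i, sub_measurable (fun w => X w i 0)) -> sub_measurable (fun w => f (X w)).
Proof.
move=> oM MX fc GX; apply/sub_measurableP.
apply: (measurability _ (RGenOInfty.measurableE R)) => //= _ [_ [a ->] <-].
rewrite setTI /measurable/= sigma_algebra_id//.
pose W : set 'cV[R]_n := [set x | M x /\ a < f x].
pose box (qk : 'cV[rat]_n * nat) : set 'cV[R]_n :=
  [set x | forall i, `|x i 0 - ratr (qk.1 i 0)| < qk.2.+1%:R^-1].
(* A box of half-width [d0 < r / 2] whose rational centre is within [d0] of [X w] contains [X w] and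
   lies within distance [2 d0 < r] of it. *)
rewrite (_ : _ @^-1` _ = \bigcup_qk [set w | box qk `<=` W /\ box qk (X w)]); last first.
  apply/seteqP; split=> w /=; last first.
    by move=> [qk _ [/(_ (X w)) h /h[]]]; rewrite in_itv/= andbT.
  rewrite in_itv/= andbT => aw.
  have nW : \forall y \near X w, W y.
    apply: filterI; first exact: open_near.
    by have /cvgr_gt := fc _ (MX w); apply.
  have [r r0 rW] : exists2 r : R, 0 < r & forall y : 'cV[R]_n, `|X w - y| < r -> W y.
    have [r /= r0 rP] := (nbhs_ballP _ _).1 nW; exists r => // y xy.
    by apply: rP; rewrite -ball_normE.
  have [d0 d00 [k kd kr]] : exists2 d0 : R, 0 < d0 & exists2 k : nat, k.+1%:R^-1 = d0 & d0 < r / 2.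
    have r2 : 0 < r / 2 by rewrite divr_gt0.
    by have [k _ h] := near_infty_natSinv_lt (PosNum r2); exists k.+1%:R^-1; [rewrite invr_gt0|exists k => //; exact: (h k (leqnn k))].
  have /choice[q qP] : forall i, exists q : rat, `|X w i 0 - ratr q| < d0.
    move=> i; have lt2 : X w i 0 - d0 < X w i 0 + d0 by lra.
    have [q] := rat_in_itvoo lt2.
    by rewrite in_itv/= => /andP[h1 h2]; exists q; rewrite ltr_norml; lra.
  exists (\col_i q i, k) => //; split=> [y yb|i]; last by rewrite /= kd mxE.
  apply: rW; apply: (@le_lt_trans _ _ (2 * d0)); last by lra.
  apply: mx_norm_le => [|i j]; first by lra.
  have := yb i; have := qP i; rewrite /= kd !mxE ord1 => h1 h2.
  have -> : X w i 0 - y i 0 = (X w i 0 - ratr (q i)) - (y i 0 - ratr (q i)) by ring.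
  by apply: le_trans (ler_normB _ _) _; lra.
apply: sub_measurable_bigcup => qk.
(* Inclusion of the box does not depend on w: the set is either empty or a finite intersection of
   events on single coordinates. *)
have [bW|nbW] := pselect (box qk `<=` W); last first.
  rewrite (_ : [set _ | _] = set0); first by case: G_sigma.
  by apply/seteqP; split=> w //= [].
rewrite (_ : [set _ | _] = \bigcap_i [set w | `|X w i 0 - ratr (qk.1 i 0)| < qk.2.+1%:R^-1]).
  apply: sub_measurable_bigcap => i.
  rewrite (_ : [set _ | _] = (fun w => X w i 0) @^-1` `]ratr (qk.1 i 0) - qk.2.+1%:R^-1, ratr (qk.1 i 0) + qk.2.+1%:R^-1[).
    exact: GX.
  by apply/seteqP; split=> w /=; rewrite in_itv/= ltr_distl.
by apply/seteqP; split=> w /= => [[_ h] i _|h]; [exact: h|split=> // i; exact: h].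
Qed.
End SubSigmaAlgebra.

Section FiniteCopy.
Context d (U : measurableType d) (R : realType) (Q : {measure set U -> \bar R}).
Hypothesis Q_fin : fin_num_fun Q.
(** A synonym that remembers a proof of finiteness, which uniqueness of product measures expects as
    part of the structure. *)
Definition finite_copy (Q_fin : fin_num_fun Q) : set U -> \bar R := Q.
HB.instance Definition _ := Measure.copy (finite_copy Q_fin) Q.
HB.instance Definition _ := Measure_isFinite.Build _ _ _ (finite_copy Q_fin) Q_fin.
End FiniteCopy.

Section FreezeOne.
Context {d d' dE : measure_display} {T : measurableType d} {TG : measurableType d'}.
Context {E : measurableType dE} {R : realType} (P : probability T R).
Variables (gam : probability E R) (iota : T -> TG) (V : T -> E).
Variables (g H : T -> R) (K : R).
Hypotheses (miota : measurable_fun setT iota) (mV : measurable_fun setT V).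
Hypotheses (mg : measurable_fun setT g) (g0 : forall w, 0 <= g w).
Hypotheses (mH : measurable_fun setT H) (H0 : forall w, 0 <= H w) (HK : forall w, H w <= K).
Hypothesis rect : forall (S : set TG) (A : set E), measurable S -> measurable A ->
  (\int[P]_(w in iota @^-1` S `&` V @^-1` A) (g w)%:E =
   (\int[P]_(w in iota @^-1` S) (H w)%:E) * gam A)%E.

(* The law of (iota, V) under the density g is the product of the law of iota
   under the density H with gam, since both agree on rectangles. *)
Lemma freeze_one (f : TG * E -> \bar R) : measurable_fun setT f ->
  (forall z, (0 <= f z)%E) ->
  (\int[P]_w (f (iota w, V w) * (g w)%:E) =
   \int[P]_w ((\int[gam]_z f (iota w, z)) * (H w)%:E))%E.
Proof.
move=> mf f0.
have mpair : measurable_fun setT (fun w : T => (iota w, V w) : TG * E).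
  by apply/measurable_fun_pairP; split.
have Qfin : fin_num_fun (weighted_image P miota mH H0).
  move=> B mB; rewrite /weighted_image.
  have mB' : measurable (iota @^-1` B) by rewrite -[_ @^-1` _]setTI; exact: miota.
  apply: integrable_fin_num => //; apply: measurable_bounded_integrable => //.
  - by apply: le_lt_trans (probability_le1 _ mB') _; rewrite ltry.
  - exact: measurable_funTS.
  exists K; split; first exact: num_real.
  by move=> x Kx w _; apply: le_trans (ltW Kx); rewrite ger0_norm.
rewrite -(ge0_integral_weighted_image P mpair mg g0 mf f0).
have nuE (A : set (TG * E)) : measurable A -> A `<=` setT ->
    weighted_image P mpair mg g0 A = (finite_copy Qfin \x gam)%E A.
  move=> mA _; apply/esym.
  have := @product_measure_unique _ _ _ _ R (finite_copy Qfin) gam (weighted_image P mpair mg g0).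
  apply => //.
rewrite (eq_measure_integral _ nuE).
rewrite fubini_tonelli1//.
rewrite (ge0_integral_weighted_image P miota mH H0)//.
- exact: measurable_fun_fubini_tonelli_F.
- by move=> w; apply: integral_ge0.
Qed.

End FreezeOne.

Section Freezing.
Context {d dE : measure_display} {T : measurableType d} {E : measurableType dE}.
Context {R : realType} (P : probability T R).
Variable G : set (set T).
Hypotheses (G_sigma : sigma_algebra setT G) (G_sub : G `<=` measurable).
Variables (k : nat) (W : 'I_k -> T -> E) (gam : probability E R).
Hypothesis mW : forall i, measurable_fun setT (W i).
Hypothesis W_indep : forall (S : set T) (A : 'I_k -> set E), G S ->
  (forall i, measurable (A i)) ->
  P (S `&` [set w | forall i, A i (W i w)]) = (P S * \prod_(i < k) gam (A i))%E.

Let TG : measurableType _ := g_sigma_algebraType G.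

Let mTG (A : set T) : measurable (A : set TG) = G A.
Proof. by rewrite /measurable/= sigma_algebra_id. Qed.

Let mid : measurable_fun setT (id : T -> TG).
Proof. by move=> _ A; rewrite mTG setTI => /G_sub. Qed.

Let mTGT (X : T -> R) : measurable_fun setT (X : TG -> R) -> measurable_fun setT X.
Proof. by move=> mX; exact: (measurableT_comp mX mid). Qed.

Let pair_W j : measurable_fun setT (fun w : T => (w, W j w) : TG * E).
Proof. by apply/measurable_fun_pairP; split; [exact: mid|exact: mW]. Qed.

Let average (f : TG * E -> R) (w : T) : R := (\int[gam]_z f (w, z))%R.

Let gam_integrable (f : TG * E -> R) (K : R) w : measurable_fun setT f ->
  (forall z, 0 <= f z <= K) -> gam.-integrable setT (fun z => (f (w, z))%:E).
Proof.
move=> mf fK; apply: (@measurable_bounded_integrable _ _ _ gam) => //.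
- by rewrite [X in (X < _)%E](@probability_setT _ _ _ gam) ltry.
- apply: (measurableT_comp mf (g := fun z : E => (w, z))).
  by apply/measurable_fun_pairP; split; [exact: measurable_cst|exact: measurable_id].
- exists K; split; first exact: num_real.
  move=> x Kx z _; apply: le_trans (ltW Kx); have /andP[f0 fK'] := fK (w, z).
  by rewrite ger0_norm.
Qed.

Let averageE (f : TG * E -> R) (K : R) w : measurable_fun setT f ->
  (forall z, 0 <= f z <= K) -> (average f w)%:E = (\int[gam]_z (f (w, z))%:E)%E.
Proof.
move=> mf fK; rewrite /average /Rintegral fineK//.
by apply: integrable_fin_num => //; exact: gam_integrable.
Qed.

Let average_bound (f : TG * E -> R) (K : R) w : measurable_fun setT f ->
  (forall z, 0 <= f z <= K) -> 0 <= average f w <= K.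
Proof.
move=> mf fK; rewrite -!lee_fin (averageE _ mf fK); apply/andP; split.
  by apply: integral_ge0 => z _; rewrite lee_fin; have /andP[] := fK (w, z).
have -> : K%:E = (\int[gam]_z K%:E)%E.
  by rewrite integral_cst// [X in (_ * X)%E](@probability_setT _ _ _ gam) mule1.
apply: ge0_le_integral => //.
- by move=> z _; rewrite lee_fin; have /andP[] := fK (w, z).
- by case/integrableP : (gam_integrable w mf fK).
- by move=> z _; rewrite lee_fin; have /andP[] := fK (w, z).
Qed.

Let measurable_average (f : TG * E -> R) (K : R) : measurable_fun setT f ->
  (forall z, 0 <= f z <= K) -> measurable_fun setT (average f : TG -> R).
Proof.
move=> mf fK; apply/measurable_EFinP.
rewrite (_ : EFin \o _ = fubini_F gam (EFin \o f)).
  apply: measurable_fun_fubini_tonelli_F; first exact/measurable_EFinP.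
  by move=> z; rewrite lee_fin; have /andP[] := fK z.
by apply/funext => w; rewrite /= (averageE _ mf fK).
Qed.

Let prod_bound (I : finType) (p : pred I) (h : I -> R) (K : R) : 1 <= K ->
  (forall i, 0 <= h i <= K) -> 0 <= \prod_(i | p i) h i <= K ^+ #|I|.
Proof.
move=> K1 hK; have K0 : 0 <= K by lra.
rewrite prodr_ge0/=; last by move=> i _; case/andP: (hK i).
apply: (@le_trans _ _ (\prod_(i : I) K)); last by rewrite prodr_const.
rewrite big_mkcond/=; apply: ler_prod => i _.
by case: ifP => _; rewrite ?hK// ler01.
Qed.

Let measurable_indic_snd (A : set E) : measurable A ->
  measurable_fun setT (fun z : TG * E => \1_A z.2 : R).
Proof.
move=> mA; apply: (measurableT_comp (f := \1_A : E -> R)); last exact: measurable_snd.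
exact: measurable_indic.
Qed.

(** The hypothesis [W_indep] covers indicators only. They are exchanged for general factors one slot
    at a time: the slots below j are already general. *)
Definition slots j (f : 'I_k -> TG * E -> R) (A : 'I_k -> set E) (i : 'I_k) : TG * E -> R :=
  if (i < j)%N then f i else fun z => \1_(A i) z.2.

Let slots_ok j (f : 'I_k -> TG * E -> R) (A : 'I_k -> set E) (K : R) : 1 <= K -> (forall i, measurable_fun setT (f i)) ->
  (forall i z, 0 <= f i z <= K) -> (forall i, measurable (A i)) ->
  forall i, measurable_fun setT (slots j f A i) /\ forall z, 0 <= slots j f A i z <= K.
Proof.
move=> K1 mf fK mA i; rewrite /slots; case: ifP => _; first by split.
split; first exact: measurable_indic_snd.
by move=> z; rewrite indicE; case: (_ \in _); rewrite ?lexx ?ler01//=; lra.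
Qed.

Let freezing_slots (K : R) (f : 'I_k -> TG * E -> R) : 1 <= K ->
  (forall i, measurable_fun setT (f i)) -> (forall i z, 0 <= f i z <= K) ->
  forall j (S : set T) (A : 'I_k -> set E), G S -> (forall i, measurable (A i)) ->
  (\int[P]_(w in S) (\prod_i slots j f A i (w, W i w))%:E =
   \int[P]_(w in S) (\prod_i average (slots j f A i) w)%:E)%E.
Proof.
move=> K1 mf fK; elim=> [|j IH] S A GS mA; have mS := G_sub GS.
  transitivity (P (S `&` [set w | forall i, A i (W i w)])).
    rewrite setIC -integral_indic//; last first.
      rewrite (_ : [set w | _] = \bigcap_i (W i @^-1` A i)); last first.
        by apply/seteqP; split=> [w h i _|w h i]; exact: h.
      apply: fin_bigcap_measurable; first exact: finite_finset.
      by move=> i _; rewrite -[_ @^-1` _]setTI; exact: mW.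
    apply: eq_integral => w _; congr (_%:E); rewrite /slots/= indicE.
    case: (boolP (w \in _)) => [|]; rewrite ?inE ?notin_setE /= => h.
      by rewrite big1// => i _; rewrite indicE mem_set.
    have [i nA] : exists i, ~ A i (W i w) by apply/existsNP.
    by rewrite (bigD1 i)//= indicE memNset// mul0r.
  rewrite W_indep// (eq_integral (fun _ => (\prod_(i < k) gam (A i))%E)); last first.
    move=> w _; rewrite /slots/= -prodEFin; apply: eq_bigr => i _.
    rewrite (averageE w (K := 1)).
    - by apply: etrans (integral_indic gam measurableT (mA i)) _; rewrite setIT.
    - exact: measurable_indic_snd.
    - by move=> z; rewrite indicE; case: (_ \in _); rewrite ?lexx ?ler01.
  by rewrite integral_cst// muleC.
have [jk|kj] := ltnP j k; last first.
  have e i : slots j.+1 f A i = slots j f A i.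
    by rewrite /slots !(leq_trans (ltn_ord i))// (leq_trans kj).
  under eq_integral do under eq_bigr do rewrite e.
  under [RHS]eq_integral do under eq_bigr do rewrite e.
  exact: IH.
pose j0 : 'I_k := Ordinal jk.
pose h := slots j.+1 f A.
have hok i := slots_ok j.+1 K1 mf fK mA i.
have [mh0 h0K] := hok j0.
pose A' (B : set E) i := if i == j0 then B else A i.
have mA' B : measurable B -> forall i, measurable (A' B i).
  by move=> mB i; rewrite /A'; case: ifP.
have h'E B i : i != j0 -> slots j f (A' B) i = h i.
  move=> ij; rewrite /h /slots /A' (negbTE ij) [(i < j.+1)%N]ltnS [(i <= j)%N]leq_eqVlt.
  by have /negbTE -> : (i : nat) != j by [].
have h'0 B : slots j f (A' B) j0 = fun z => \1_B z.2.
  by rewrite /slots/= ltnn /A' eqxx.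
pose g w := \prod_(i | i != j0) h i (w, W i w).
pose H w := \prod_(i | i != j0) average (h i) w.
have g0 w : 0 <= g w.
  by rewrite /g prodr_ge0// => i _; have [_ hi] := hok i; case/andP: (hi (w, W i w)).
have H0 w : 0 <= H w.
  rewrite /H prodr_ge0// => i _; have [mhi hi] := hok i.
  by case/andP: (average_bound w mhi hi).
have mhW i : measurable_fun setT (fun w : T => h i (w, W i w)).
  by have [mhi _] := hok i; exact: (measurableT_comp mhi (pair_W i)).
have mg : measurable_fun setT g.
  by rewrite /g; under eq_fun do rewrite -big_filter; apply: measurable_prod.
have mH : measurable_fun setT (H : TG -> R).
  rewrite /H; under eq_fun do rewrite -big_filter; apply: measurable_prod => i _.
  by have [mhi hi] := hok i; exact: (measurable_average mhi hi).
have HK w : H w <= K ^+ #|'I_k|.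
  have hi i : 0 <= average (h i) w <= K by have [mhi hi] := hok i; exact: average_bound.
  by case/andP : (prod_bound (fun i => i != j0) K1 hi).
(* The induction hypothesis with the indicator of [B] in slot [j0], for all [S'] and [B], is the
   rectangle condition of [freeze_one], the other slots serving as density. *)
have rect (S' : set TG) (B : set E) : measurable S' -> measurable B ->
  (\int[P]_(w in id @^-1` S' `&` W j0 @^-1` B) (g w)%:E =
   (\int[P]_(w in id @^-1` S') (H w)%:E) * gam B)%E.
  rewrite mTG => GS' mB; have mS' := G_sub GS'.
  transitivity (\int[P]_(w in S') (\prod_i slots j f (A' B) i (w, W i w))%:E)%E.
    rewrite integral_mkcondr; apply: eq_integral => w _; rewrite (bigD1 j0)//= h'0.
    under eq_bigr => i ij do rewrite h'E//.
    rewrite patchE indicE/= -/(g w).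
    rewrite (_ : (w \in W j0 @^-1` B) = (W j0 w \in B)); last by apply/idP/idP; rewrite !inE.
    by case: ifP => _; rewrite ?mul1r ?mul0r.
  rewrite (IH S' (A' B) GS' (mA' B mB)) muleC -ge0_integralZl//; last 2 first.
  - by apply/measurable_EFinP; apply: measurable_funTS; exact: mTGT.
  - by move=> w _; rewrite lee_fin.
  apply: eq_integral => w _; rewrite (bigD1 j0)//= h'0 EFinM.
  under eq_bigr => i ij do rewrite h'E//.
  rewrite -/(H w) (averageE w (K := 1)).
  - by congr (_ * _)%E; apply: etrans (integral_indic gam measurableT mB) _; rewrite setIT.
  - exact: measurable_indic_snd.
  - by move=> z; rewrite indicE; case: (_ \in _); rewrite ?lexx ?ler01.
pose f' (z : TG * E) : \bar R := (\1_S z.1 * h j0 z)%:E.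
have mf' : measurable_fun setT f'.
  apply/measurable_EFinP; apply: measurable_funM; last exact: mh0.
  apply: (measurableT_comp (f := \1_S : TG -> R)); last exact: measurable_fst.
  by apply: measurable_indic; rewrite mTG.
have f'0 z : (0 <= f' z)%E.
  by rewrite lee_fin mulr_ge0// ?indicE//; case/andP: (h0K z).
transitivity (\int[P]_w (f' (w, W j0 w) * (g w)%:E))%E.
  rewrite integral_mkcond; apply: eq_integral => w _; rewrite patchE /f' indicE/=.
  case: ifP => _; last by rewrite mul0r mul0e.
  by rewrite (bigD1 j0)//= mul1r -EFinM.
rewrite (freeze_one mid (mW j0) mg g0 (mTGT mH) H0 HK rect mf' f'0).
rewrite [RHS]integral_mkcond; apply: eq_integral => w _; rewrite patchE /f'/=.
case: ifP => wS; last first.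
  by rewrite integral0_eq ?mul0e// => z _; rewrite indicE wS mul0r.
under eq_integral do rewrite indicE wS mul1r.
by rewrite -(averageE w mh0 h0K) -EFinM (bigD1 j0).
Qed.

(** Given [G], the variables [W i] are independent with law [gam], so each is integrated out while
    whatever [G] knows is kept fixed. Products of functions of one coordinate each are all that
    Gaussian test functions call for. *)
Theorem freezing (K : R) (f : 'I_k -> TG * E -> R) (S : set T) :
  (forall i, measurable_fun setT (f i)) -> (forall i z, 0 <= f i z <= K) -> G S ->
  (\int[P]_(w in S) (\prod_i f i (w, W i w))%:E =
   \int[P]_(w in S) (\prod_i \int[gam]_z f i (w, z))%:E)%E.
Proof.
move=> mf fK GS.
(* The common bound is raised to at least 1 so that it also covers the indicators occupying the
   slots not yet exchanged. *)
have fK' i z : 0 <= f i z <= Num.max 1 K.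
  by have /andP[-> h] := fK i z; rewrite le_max h orbT.
have K1 : 1 <= Num.max 1 K by rewrite le_max lexx.
(* With all k slots exchanged no indicator is left, so the sets are arbitrary; empty ones are
   measurable for free. *)
have := freezing_slots K1 mf fK' k GS (fun _ => measurable0).
have e A i : slots k f A i = f i by rewrite /slots ltn_ord.
under eq_integral do under eq_bigr do rewrite e.
by under [X in _ = X -> _]eq_integral do under eq_bigr do rewrite e.
Qed.

End Freezing.

(** * Rotation invariance of the Gaussian increments *)

Section NormalLaw.
Context {R : realType}.
Local Notation leb := (@lebesgue_measure R).

Lemma normal_pdfS (m s x : R) : s != 0 ->
  normal_pdf m s x = normal_peak s * expR (- (x - m) ^+ 2 / (s ^+ 2 *+ 2)).
Proof. by move=> s0; rewrite normal_pdfE. Qed.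

Lemma normal_pdf_sym (m s x : R) : s != 0 -> normal_pdf m s x = normal_pdf x s m.
Proof. by move=> s0; rewrite !normal_pdfS// -sqrrN opprB. Qed.

Lemma normal_peakM (s t : R) : 0 < s -> 0 < t ->
  normal_peak (s * t) = s^-1 * normal_peak t.
Proof.
move=> s0 t0; rewrite /normal_peak exprMn -mulrA -mulrnAr.
by rewrite sqrtrM ?sqr_ge0// sqrtr_sqr gtr0_norm// invfM -mulrnAr.
Qed.

Lemma ge0_integral_normal_prob (m s : R) (f : R -> \bar R) :
  measurable_fun setT f -> (forall x, 0 <= f x)%E ->
  (\int[normal_prob m s]_x f x = \int[leb]_x (f x * (normal_pdf m s x)%:E))%E.
Proof.
move=> mf f0.
have mpdf : measurable_fun setT (normal_pdf m s) by exact: measurable_normal_pdf.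
have mid : measurable_fun setT (@id (measurableTypeR R)) by exact: measurable_id.
rewrite -(@ge0_integral_weighted_image _ _ _ _ R leb id (normal_pdf m s) mid mpdf (normal_pdf_ge0 m s) f)//.
Qed.

(** The convolution of two centred Gaussians. Completing the square turns the product of the
    densities into a constant times the density in z with mean [c s^2 / u^2] and deviation
    [v = s t / u], whose integral is 1. *)
Lemma integral_normal_pdf_normal_prob (s t c : R) : 0 < s -> 0 < t ->
  (\int[normal_prob 0 s]_z (normal_pdf c t z)%:E =
   (normal_pdf 0 (Num.sqrt (s ^+ 2 + t ^+ 2)) c)%:E)%E.
Proof.
move=> s0 t0.
set u := Num.sqrt (s ^+ 2 + t ^+ 2).
have st0 : 0 < s ^+ 2 + t ^+ 2 by rewrite addr_gt0// exprn_gt0.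
have u0 : 0 < u by rewrite sqrtr_gt0.
have u2 : u ^+ 2 = s ^+ 2 + t ^+ 2 by rewrite sqr_sqrtr// ltW.
pose v := s * t / u.
have v0 : 0 < v by rewrite /v divr_gt0// mulr_gt0.
rewrite ge0_integral_normal_prob; last 2 first.
- by apply/measurable_EFinP; exact: measurable_normal_pdf.
- by move=> x; rewrite lee_fin normal_pdf_ge0.
have E z : normal_pdf c t z * normal_pdf 0 s z =
    normal_pdf 0 u c * normal_pdf (c * s ^+ 2 / u ^+ 2) v z.
  rewrite !normal_pdfS ?gt_eqF//.
  have P : normal_peak t * normal_peak s = normal_peak u * normal_peak v.
    have -> : v = u^-1 * (s * t) by rewrite /v mulrC.
    have -> : normal_peak (u^-1 * (s * t)) = u * (s^-1 * normal_peak t).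
      by rewrite !normal_peakM ?invr_gt0 ?mulr_gt0// invrK.
    have p1 x : 0 < x -> normal_peak x = x^-1 * normal_peak 1 :> R.
      by move=> x0; rewrite -normal_peakM// mulr1.
    by rewrite (p1 s)// (p1 u)//; field; rewrite !gt_eqF.
  rewrite mulrACA [RHS]mulrACA P; congr (_ * _); rewrite -!expRD; congr expR.
  have -> : v ^+ 2 = s ^+ 2 * t ^+ 2 / (s ^+ 2 + t ^+ 2).
    by rewrite /v !exprMn exprVn u2.
  by rewrite u2; field; rewrite !gt_eqF.
under eq_integral do rewrite -EFinM E EFinM.
rewrite ge0_integralZl//.
- by rewrite integral_normal_pdf mule1.
- by apply/measurable_EFinP; exact: measurable_normal_pdf.
- by move=> x _; rewrite lee_fin normal_pdf_ge0.
- by rewrite lee_fin normal_pdf_ge0.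
Qed.

Lemma measurable_normal_pdf_joint (t : R) : t != 0 ->
  measurable_fun setT (fun z : measurableTypeR R * measurableTypeR R => normal_pdf z.1 t z.2).
Proof.
move=> t0; rewrite (_ : (fun z => _) = fun z : measurableTypeR R * measurableTypeR R =>
   normal_peak t * expR (- (z.2 - z.1) ^+ 2 / (t ^+ 2 *+ 2))).
  apply: measurable_funM => //; apply: measurableT_comp => //.
  apply: measurable_funM => //; apply: measurableT_comp => //.
  apply: (@measurable_funX _ _ _ _ (fun z : measurableTypeR R * measurableTypeR R => z.2 - z.1)).
  by apply: measurable_funB; [exact: measurable_snd|exact: measurable_fst].
by apply/funext => z; rewrite normal_pdfS.
Qed.

Lemma measurable_normal_prob_mean (t : R) (D : set R) : t != 0 -> measurable D ->
  measurable_fun setT (fun v : measurableTypeR R => normal_prob v t D).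
Proof.
move=> t0 mD.
have := @measurable_fun_fubini_tonelli_F _ _ (measurableTypeR R) (measurableTypeR R) R
  leb (fun z => (normal_pdf z.1 t z.2 * \1_D z.2)%:E).
move=> h; have {h} h := h _ _.
rewrite (_ : (fun v => _) = fubini_F leb
  (fun z : measurableTypeR R * measurableTypeR R => (normal_pdf z.1 t z.2 * \1_D z.2)%:E)).
  apply: h => [|z].
    apply/measurable_EFinP; apply: measurable_funM; first exact: measurable_normal_pdf_joint.
    apply: (measurableT_comp (f := \1_D : measurableTypeR R -> R)); last exact: measurable_snd.
    exact: measurable_indic.
  by rewrite lee_fin mulr_ge0// normal_pdf_ge0.
apply/funext => v; rewrite /fubini_F/= /normal_prob integral_mkcond.
apply: eq_integral => z _; rewrite patchE indicE/=.
by case: ifP => _; rewrite ?mulr1 ?mulr0.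
Qed.

(** A Chebyshev-type bound obtained by giving up half of the exponent [-2 a]. One factor
    [exp (- a) <= 1 / a <= 4 (t / e)^2] is the gain; the other is, up to [sqrt 2 <= 2], the density
    of deviation [sqrt 2 * t], whose mass is at most 1. Hence the constant 8. *)
Lemma normal_prob_tail (v t e : R) (D : set R) : 0 < t -> 0 < e -> measurable D ->
  (forall z, D z -> e <= `|z - v|) ->
  (normal_prob v t D <= (8 * (t / e) ^+ 2)%:E)%E.
Proof.
move=> t0 e0 mD De.
pose u := Num.sqrt 2 * t.
have s20 : 0 < Num.sqrt 2 :> R by rewrite sqrtr_gt0.
have s22 : Num.sqrt 2 ^+ 2 = 2 :> R by rewrite sqr_sqrtr.
have s2le : Num.sqrt 2 <= 2 :> R.
  by rewrite -(@ler_pXn2r _ 2)// ?nnegrE ?ltW// s22 expr2; lra.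
have u0 : 0 < u by rewrite mulr_gt0.
have bound z : D z -> normal_pdf v t z <= 8 * (t / e) ^+ 2 * normal_pdf v u z.
  move=> /De ez; rewrite !normal_pdfS ?gt_eqF// normal_peakM//.
  set a := (z - v) ^+ 2 / (t ^+ 2 *+ 2) / 2.
  have -> : - (z - v) ^+ 2 / (t ^+ 2 *+ 2) = - a - a by rewrite /a; field; rewrite gt_eqF.
  have -> : - (z - v) ^+ 2 / (u ^+ 2 *+ 2) = - a.
    by rewrite /a /u exprMn s22; field; rewrite gt_eqF.
  have ea : (e / t) ^+ 2 / 4 <= a.
    have -> : a = ((z - v) / t) ^+ 2 / 4 by rewrite /a; field; rewrite gt_eqF.
    rewrite ler_pM2r ?invr_gt0// -[leRHS]real_normK ?num_real//.
    have et1 : 0 <= e / t by rewrite ltW// divr_gt0.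
    rewrite ler_pXn2r ?nnegrE//.
    by rewrite normrM normfV (gtr0_norm t0) ler_pM2r ?invr_gt0.
  have et0 : 0 < (e / t) ^+ 2 / 4 by rewrite divr_gt0// exprn_gt0// divr_gt0.
  have a0 : 0 < a by apply: lt_le_trans ea.
  rewrite expRD.
  have e1 : expR (- a) <= 4 * (t / e) ^+ 2.
    have : expR (- a) <= a^-1.
      rewrite expRN lef_pV2 ?posrE ?expR_gt0//.
      by apply: le_trans (expR_ge1Dx a); lra.
    move/le_trans; apply; have -> : 4 * (t / e) ^+ 2 = ((e / t) ^+ 2 / 4)^-1.
      by field; rewrite !gt_eqF.
    by rewrite lef_pV2 ?posrE.
  have p0 : 0 < normal_peak t by rewrite normal_peak_gt0// gt_eqF.
  have x0 := expR_gt0 (- a).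
  rewrite mulrA [leRHS](_ : _ = (8 * (t / e) ^+ 2 * (Num.sqrt 2)^-1 * normal_peak t) * expR (- a)); last by ring.
  rewrite ler_pM2r// mulrC ler_pM2r//.
  apply: le_trans e1 _; rewrite ler_pdivlMr//.
  have := sqr_ge0 (t / e); nra.
rewrite /normal_prob.
apply: (@le_trans _ _ (\int[leb]_(x in D) ((8 * (t / e) ^+ 2)%:E * (normal_pdf v u x)%:E))%E).
  apply: ge0_le_integral => //.
  - by move=> x _; rewrite lee_fin normal_pdf_ge0.
  - by apply: measurable_funTS; apply/measurable_EFinP; exact: measurable_normal_pdf.
  - by apply: measurable_funTS; apply: emeasurable_funM => //; apply/measurable_EFinP; exact: measurable_normal_pdf.
have k0 : 0 <= 8 * (t / e) ^+ 2 by rewrite mulr_ge0// sqr_ge0.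
rewrite ge0_integralZl//; last 2 first.
- by apply: measurable_funTS; apply/measurable_EFinP; exact: measurable_normal_pdf.
- by move=> x _; rewrite lee_fin normal_pdf_ge0.
have h : (normal_prob v u D <= 1)%E by exact: probability_le1.
by rewrite -[leRHS]mule1 lee_wpmul2l// lee_fin.
Qed.

End NormalLaw.

Section Concentration.
Context {R : realType}.
Local Notation leb := (@lebesgue_measure R).

Definition normal_mass (t : R) (D : set R) (v : R) : R := fine (normal_prob v t D).

Lemma normal_massE (t v : R) (D : set R) : measurable D ->
  (normal_mass t D v)%:E = normal_prob v t D.
Proof. by move=> mD; rewrite /normal_mass fineK// fin_num_measure. Qed.

Lemma normal_mass_bound (t v : R) (D : set R) : measurable D -> 0 <= normal_mass t D v <= 1.
Proof.
by move=> mD; rewrite -!lee_fin normal_massE// measure_ge0 probability_le1.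
Qed.

Lemma measurable_normal_mass (t : R) (D : set R) : t != 0 -> measurable D ->
  measurable_fun setT (normal_mass t D : measurableTypeR R -> R).
Proof.
move=> t0 mD; apply/measurable_EFinP.
rewrite (_ : EFin \o _ = fun v => normal_prob v t D); first exact: measurable_normal_prob_mean.
by apply/funext => v; rewrite /= normal_massE.
Qed.

Lemma normal_massC (t v : R) (D : set R) : measurable D ->
  normal_mass t (~` D) v = 1 - normal_mass t D v.
Proof.
move=> mD; apply: EFin_inj; rewrite normal_massE; last exact: measurableC.
by rewrite EFinB normal_massE//; exact: probability_setC.
Qed.

Definition shrinking (n : nat) : R := n.+1%:R^-1.

Lemma shrinking_gt0 n : 0 < shrinking n. Proof. by rewrite invr_gt0. Qed.

Lemma shrinking_lt (e : R) : 0 < e -> \forall n \near \oo, shrinking n < e.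
Proof. by move=> e0; exact: (near_infty_natSinv_lt (PosNum e0)). Qed.

(** The deviation is the square of the shift, so it is negligible against it: a mean at a is left
    outside the shifted interval and a mean at b inside it. The convergence to the indicator of the
    half-open interval thus holds at every point, endpoints included. *)
Lemma normal_mass_concentrates (a b v : R) :
  (fun n => normal_mass (shrinking n ^+ 2) `]a + shrinking n, b + shrinking n[ v) @ \oo
    --> (\1_`]a, b] v : R).
Proof.
have tail n (D : set R) : measurable D ->
    (forall z, D z -> shrinking n <= `|z - v|) ->
    normal_mass (shrinking n ^+ 2) D v <= 8 * shrinking n ^+ 2.
  move=> mD h; have d0 := shrinking_gt0 n; rewrite -lee_fin normal_massE//.
  have := normal_prob_tail (exprn_gt0 2 d0) d0 mD h.
  have -> : shrinking n ^+ 2 / shrinking n = shrinking n by field; rewrite gt_eqF.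
  by [].
have far n (D : set R) : measurable D -> (forall z, D z -> shrinking n <= `|z - v|) ->
    `|0 - normal_mass (shrinking n ^+ 2) D v| <= 8 * shrinking n ^+ 2.
  move=> mD h; rewrite sub0r normrN ger0_norm ?tail//.
  by case/andP: (normal_mass_bound (shrinking n ^+ 2) v mD).
suff H : \forall n \near \oo,
    `|\1_`]a, b] v - normal_mass (shrinking n ^+ 2) `]a + shrinking n, b + shrinking n[ v|
      <= 8 * shrinking n ^+ 2.
  apply/cvgrPdist_le => e e0.
  (* Below 1 the square is at most the number itself, so [shrinking n < e / 8] is enough. *)
  have e8 : 0 < Num.min 1 (e / 8) by rewrite lt_min ltr01 divr_gt0.
  near=> n; apply: (@le_trans _ _ (8 * shrinking n ^+ 2)); first by near: n.
  have : shrinking n < Num.min 1 (e / 8) by near: n; exact: shrinking_lt.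
  rewrite lt_min => /andP[]; have := shrinking_gt0 n; nra.
have mo n : measurable (`]a + shrinking n, b + shrinking n[ : set R) by exact: measurable_itv.
rewrite indicE; case: (boolP (v \in _)) => [|]; rewrite ?inE ?notin_setE /= in_itv/=.
  move=> /andP[av vb]; have av2 : 0 < (v - a) / 2 by rewrite divr_gt0// subr_gt0.
  near=> n; rewrite -normal_massC//.
  rewrite -[X in X <= _]normrN -sub0r; apply: far; first exact: measurableC.
  move=> z /=; rewrite in_itv/= => /negP; rewrite negb_and -!leNgt.
  have dn : shrinking n < (v - a) / 2 by near: n; exact: shrinking_lt.
  have d0 := shrinking_gt0 n.
  by rewrite ler_normr => /orP[h|h]; apply/orP; [right|left]; lra.
move=> /negP; rewrite negb_and -leNgt -ltNge.
have [va _|av /= vb] := leP v a.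
  near=> n; apply: far => // z /=; rewrite in_itv/= => /andP[h1 h2].
  by rewrite ler_normr; apply/orP; left; lra.
have vb2 : 0 < (v - b) / 2 by rewrite divr_gt0// subr_gt0.
near=> n; apply: far => // z /=; rewrite in_itv/= => /andP[h1 h2].
have dn : shrinking n < (v - b) / 2 by near: n; exact: shrinking_lt.
have d0 := shrinking_gt0 n.
by rewrite ler_normr; apply/orP; right; lra.
Unshelve. all: by end_near.
Qed.

End Concentration.

Lemma cvg_bigprod (R : realType) (U : Type) (F : set_system U) {FF : Filter F}
    (I : Type) (r : seq I) (f : I -> U -> R) (l : I -> R) :
  (forall i, f i x @[x --> F] --> l i) ->
  (\prod_(i <- r) f i x) @[x --> F] --> \prod_(i <- r) l i.
Proof.
move=> fl; elim: r => [|i r IH].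
  rewrite big_nil (_ : (fun x => _) = fun=> 1); first exact: cvg_cst.
  by apply/funext => x; rewrite big_nil.
rewrite big_cons (_ : (fun x => _) = fun x => f i x * \prod_(j <- r) f j x).
  exact: cvgM.
by apply/funext => x; rewrite big_cons.
Qed.

Lemma prod_indic (R : realType) (T : Type) (I : finType) (E : Type) (A : I -> set E)
    (v : T -> I -> E) (w : T) :
  \prod_i \1_(A i) (v w i) = \1_[set w | forall i, A i (v w i)] w :> R.
Proof.
rewrite [RHS]indicE; case: (boolP (w \in _)) => [|]; rewrite ?inE ?notin_setE => h.
  by rewrite big1// => i _; rewrite indicE mem_set//; exact: h.
have [i nA] : exists i, ~ A i (v w i) by apply/existsNP.
by rewrite (bigD1 i)//= indicE memNset// mul0r.
Qed.

Section RotatedDensity.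
Context {R : realType} {k : nat}.

Lemma prod_normal_pdf (t : R) (c x : 'cV[R]_k) : t != 0 ->
  \prod_(i < k) normal_pdf (c i 0) t (x i 0) =
  normal_peak t ^+ k * expR (- ((x - c)^T *m (x - c)) 0 0 / (t ^+ 2 *+ 2)).
Proof.
move=> t0; under eq_bigr do rewrite normal_pdfS//.
rewrite big_split/= prodr_const card_ord; congr (_ * _).
rewrite -expR_sum; congr expR.
rewrite mxE -sumrN mulr_suml; apply: eq_bigr => i _.
by rewrite !mxE -expr2.
Qed.

Lemma prod_normal_pdf_rotation (t : R) (Q : 'M[R]_k) (c x : 'cV[R]_k) : t != 0 ->
  Q *m Q^T = 1%:M ->
  \prod_(i < k) normal_pdf (c i 0) t ((Q *m x) i 0) =
  \prod_(i < k) normal_pdf ((Q^T *m c) i 0) t (x i 0).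
Proof.
move=> t0 QQ; rewrite !prod_normal_pdf//.
have -> : Q *m x - c = Q *m (x - Q^T *m c) by rewrite mulmxBr mulmxA QQ mul1mx.
by rewrite trmx_mul -mulmxA [Q^T *m (Q *m _)]mulmxA (mulmx1C QQ) mul1mx.
Qed.

Lemma prod_centered_pdf_rotation (t : R) (Q : 'M[R]_k) (c : 'cV[R]_k) : t != 0 ->
  Q *m Q^T = 1%:M ->
  \prod_(i < k) normal_pdf 0 t ((Q^T *m c) i 0) = \prod_(i < k) normal_pdf 0 t (c i 0).
Proof.
(* The previous lemma at the point 0, where centre and argument of the densities are then exchanged
   by symmetry. *)
move=> t0 QQ; have := prod_normal_pdf_rotation c 0 t0 QQ.
rewrite mulmx0; under eq_bigr do rewrite mxE normal_pdf_sym//.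
move=> ->; apply: eq_bigr => i _.
by rewrite [X in _ = normal_pdf _ _ X]mxE [RHS]normal_pdf_sym.
Qed.

End RotatedDensity.

Section Rotation.
Context {d : measure_display} {T : measurableType d} {R : realType} (P : probability T R).
Variable G : set (set T).
Hypotheses (G_sigma : sigma_algebra setT G) (G_sub : G `<=` measurable).
Variables (k : nat) (W : T -> 'cV[R]_k) (s : R).
Hypothesis s_gt0 : 0 < s.
Hypothesis mW : forall i, measurable_fun setT (fun w => W w i 0).
Hypothesis W_indep : forall (S : set T) (A : 'I_k -> set R), G S ->
  (forall i, measurable (A i)) ->
  P (S `&` [set w | forall i, A i (W w i 0)]) =
  (P S * \prod_(i < k) normal_prob 0 s (A i))%E.

Section Rotated.
Variable B : T -> 'M[R]_k.
Hypothesis B_orth : forall w, B w *m (B w)^T = 1%:M.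
Hypothesis B_G : forall i j, sub_measurable G (fun w => B w i j).

Let V w : 'cV[R]_k := B w *m W w.
Let TG : measurableType _ := g_sigma_algebraType G.
Local Notation leb := (@lebesgue_measure R).

Let mTG (A : set T) : measurable (A : set TG) = G A.
Proof. by rewrite /measurable/= sigma_algebra_id. Qed.

Let mid : measurable_fun setT (id : T -> TG).
Proof. by move=> _ A; rewrite mTG setTI => /G_sub. Qed.

Let mTGT (X : T -> R) : measurable_fun setT (X : TG -> R) -> measurable_fun setT X.
Proof. by move=> mX; exact: (measurableT_comp mX mid). Qed.

Lemma measurable_rotated i : measurable_fun setT (fun w => V w i 0).
Proof.
rewrite /V; under eq_fun do rewrite mxE.
apply: measurable_sum => j; apply: measurable_funM; last exact: mW.
by apply: mTGT; apply/sub_measurableP => //; exact: B_G.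
Qed.

Let inflated (t : R) : R := Num.sqrt (s ^+ 2 + t ^+ 2).

(** After the rotation the centre is the transpose of [B] applied to c, a [G]-measurable vector.
    Freezing leaves centred densities evaluated there, and these see only its length, which is that
    of c. No trace of [B] remains. *)
Let rotated_bump (t : R) (c : 'cV[R]_k) (S : set T) : 0 < t -> G S ->
  (\int[P]_(w in S) (\prod_(i < k) normal_pdf (c i 0) t (V w i 0))%:E =
   P S * (\prod_(i < k) normal_pdf 0 (inflated t) (c i 0))%:E)%E.
Proof.
move=> t0 GS; have tn0 : t != 0 by rewrite gt_eqF.
have st0 : 0 < inflated t.
  by rewrite sqrtr_gt0 addr_gt0// exprn_gt0.
pose eta (w : T) i := ((B w)^T *m c) i 0.
pose f i (z : TG * measurableTypeR R) := normal_pdf (eta z.1 i) t z.2.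
have meta i : measurable_fun setT (eta ^~ i : TG -> measurableTypeR R).
  rewrite /eta; under eq_fun do rewrite mxE.
  apply: measurable_sum => j; apply: measurable_funM; last exact: measurable_cst.
  under eq_fun do rewrite mxE.
  by apply/sub_measurableP => //; exact: B_G.
have mf i : measurable_fun setT (f i).
  apply: (measurableT_comp (measurable_normal_pdf_joint tn0) (g := fun z : TG * measurableTypeR R => (eta z.1 i, z.2))).
  apply/measurable_fun_pairP; split; last exact: measurable_snd.
  exact: (measurableT_comp (meta i) measurable_fst).
have fK i z : 0 <= f i z <= normal_peak t by rewrite normal_pdf_ge0 normal_pdf_ub.
under eq_integral do rewrite prod_normal_pdf_rotation//.
have := @freezing _ _ T (measurableTypeR R) R P G G_sigma G_sub k
  (fun i w => W w i 0) (normal_prob 0 s) mW W_indep (normal_peak t) f S mf fK GS.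
move=> ->.
transitivity (\int[P]_(w in S) (\prod_(i < k) normal_pdf 0 (inflated t) (c i 0))%:E)%E.
  apply: eq_integral => w _; congr (_%:E).
  rewrite -(prod_centered_pdf_rotation c _ (B_orth w)) ?gt_eqF//.
  apply: eq_bigr => i _; rewrite /Rintegral /f/= integral_normal_pdf_normal_prob//.
rewrite integral_cst; first by rewrite muleC.
exact: G_sub.
Qed.

Let measurable_bump (t : R) i : t != 0 ->
  measurable_fun setT (fun z : T * measurableTypeR R => normal_pdf z.2 t (V z.1 i 0)).
Proof.
move=> t0.
apply: (measurableT_comp (measurable_normal_pdf_joint t0)
  (g := fun z : T * measurableTypeR R => (z.2, V z.1 i 0))).
apply/measurable_fun_pairP; split; first exact: measurable_snd.
exact: (measurableT_comp (measurable_rotated i) measurable_fst).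
Qed.

(** The centre of the test density is integrated over the product of the [D i], one coordinate at a
    time. Slots below j have been integrated and carry a mass; the others still carry a density
    centred at [c i]. *)
Let slot_mass (t : R) (D : 'I_k -> set R) j (c : 'cV[R]_k) (i : 'I_k) (v : R) :=
  if (i < j)%N then normal_mass t (D i) v else normal_pdf (c i 0) t v.

Let slot_value (t : R) (D : 'I_k -> set R) j (c : 'cV[R]_k) (i : 'I_k) :=
  if (i < j)%N then normal_mass (inflated t) (D i) 0 else normal_pdf 0 (inflated t) (c i 0).

Let slot_mass_ge0 (t : R) D j c i v : (forall i, measurable (D i)) -> 0 <= slot_mass t D j c i v.
Proof.
move=> mD; rewrite /slot_mass; case: ifP => _; last exact: normal_pdf_ge0.
by case/andP: (normal_mass_bound t v (mD i)).
Qed.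

Let slot_value_ge0 (t : R) D j c i : (forall i, measurable (D i)) -> 0 <= slot_value t D j c i.
Proof.
move=> mD; rewrite /slot_value; case: ifP => _; last exact: normal_pdf_ge0.
by case/andP: (normal_mass_bound (inflated t) 0 (mD i)).
Qed.

Let measurable_slot_mass (t : R) D j c i : t != 0 -> (forall i, measurable (D i)) ->
  measurable_fun setT (fun w => slot_mass t D j c i (V w i 0)).
Proof.
move=> t0 mD; rewrite /slot_mass; case: (i < j)%N.
  exact: (measurableT_comp (measurable_normal_mass t0 (mD i)) (measurable_rotated i)).
exact: (measurableT_comp (measurable_normal_pdf (c i 0) t) (measurable_rotated i)).
Qed.

Let rotated_slots (t : R) (D : 'I_k -> set R) (S : set T) : 0 < t -> G S ->
  (forall i, measurable (D i)) -> forall j (c : 'cV[R]_k),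
  (\int[P]_(w in S) (\prod_(i < k) slot_mass t D j c i (V w i 0))%:E =
   P S * (\prod_(i < k) slot_value t D j c i)%:E)%E.
Proof.
move=> t0 GS mD; have mS := G_sub GS; have tn0 : t != 0 by rewrite gt_eqF.
elim=> [|j IH] c; first by rewrite -rotated_bump.
have [jk|kj] := ltnP j k; last first.
  have e (i : 'I_k) : (i < j.+1)%N = (i < j)%N.
    by rewrite !(leq_trans (ltn_ord i))// (leq_trans kj).
  rewrite /slot_mass /slot_value.
  under eq_integral do under eq_bigr do rewrite e.
  under [in RHS]eq_bigr do rewrite e.
  exact: IH.
pose j0 : 'I_k := Ordinal jk.
have mD0 := mD j0.
pose c' x : 'cV[R]_k := \col_i (if i == j0 then x else c i 0).
have other (i : 'I_k) : i != j0 -> (i < j.+1)%N = (i < j)%N.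
  by move=> ij; rewrite ltnS leq_eqVlt; have /negbTE -> : (i : nat) != j by [].
have massE x i v : i != j0 -> slot_mass t D j (c' x) i v = slot_mass t D j.+1 c i v.
  by move=> ij; rewrite /slot_mass other// mxE (negbTE ij).
have valueE x i : i != j0 -> slot_value t D j (c' x) i = slot_value t D j.+1 c i.
  by move=> ij; rewrite /slot_value other// mxE (negbTE ij).
have mass0 x v : slot_mass t D j (c' x) j0 v = normal_pdf x t v.
  by rewrite /slot_mass ltnn mxE eqxx.
have value0 x : slot_value t D j (c' x) j0 = normal_pdf 0 (inflated t) x.
  by rewrite /slot_value ltnn mxE eqxx.
pose g w := \prod_(i < k | i != j0) slot_mass t D j.+1 c i (V w i 0).
pose r := \prod_(i < k | i != j0) slot_value t D j.+1 c i.
have g0 w : 0 <= g w by apply: prodr_ge0 => i _; exact: slot_mass_ge0.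
have r0 : 0 <= r by apply: prodr_ge0 => i _; exact: slot_value_ge0.
have mg : measurable_fun setT g.
  rewrite /g; under eq_fun do rewrite -big_filter; apply: measurable_prod => i _.
  exact: measurable_slot_mass.
(* The second variable is the centre in coordinate [j0], restricted to [D j0]; Tonelli exchanges its
   integration with that over w, and the inner integral falls under the induction hypothesis. *)
pose F (z : T * measurableTypeR R) : \bar R :=
  (\1_S z.1 * \1_(D j0) z.2 * (normal_pdf z.2 t (V z.1 j0 0) * g z.1))%:E.
have mF : measurable_fun setT F.
  apply/measurable_EFinP; apply: measurable_funM; apply: measurable_funM.
  - apply: (measurableT_comp (f := \1_S : T -> R)); last exact: measurable_fst.
    exact: measurable_indic.
  - apply: (measurableT_comp (f := \1_(D j0) : measurableTypeR R -> R)); last exact: measurable_snd.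
    by apply: measurable_indic; exact: mD.
  - exact: measurable_bump.
  - exact: (measurableT_comp mg measurable_fst).
have F0 z : (0 <= F z)%E.
  by rewrite lee_fin !mulr_ge0 ?indicE ?ler0n// normal_pdf_ge0.
transitivity (\int[P]_w \int[leb]_x F (w, x))%E.
  rewrite integral_mkcond; apply: eq_integral => w _.
  rewrite patchE; case: ifPn => wS; last first.
    by rewrite integral0_eq// => x _; rewrite /F/= indicE (negbTE wS) !mul0r.
  rewrite (bigD1 j0)//= -/(g w) EFinM.
  transitivity (\int[leb]_(x in D j0) ((normal_pdf x t (V w j0 0))%:E * (g w)%:E))%E.
    rewrite ge0_integralZr//; last 3 first.
    - apply/measurable_EFinP; apply: measurable_funTS.
      under eq_fun do rewrite normal_pdf_sym//.
      exact: measurable_normal_pdf.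
    - by move=> x _; rewrite lee_fin normal_pdf_ge0.
    - by rewrite lee_fin.
    rewrite (_ : (\int[leb]_(x in _) _)%E = normal_prob (V w j0 0) t (D j0)).
      by rewrite -(normal_massE _ _ mD0) /slot_mass/= ltnSn.
    by apply: eq_integral => x _; rewrite normal_pdf_sym.
  rewrite integral_mkcond; apply: eq_integral => x _; rewrite patchE /F/= !indicE wS mul1r.
  by case: ifP => _; rewrite ?mul1r ?mul0r// EFinM.
rewrite fubini_tonelli//.
transitivity (\int[leb]_(x in D j0) ((P S * r%:E) * (normal_pdf 0 (inflated t) x)%:E))%E.
  rewrite [RHS]integral_mkcond; apply: eq_integral => x _.
  rewrite patchE; case: ifPn => xD; last first.
    by rewrite integral0_eq// => w _; rewrite /F/= [\1_(D j0) x]indicE (negbTE xD) mulr0 mul0r.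
  transitivity (\int[P]_(w in S) (\prod_(i < k) slot_mass t D j (c' x) i (V w i 0))%:E)%E.
    rewrite [RHS]integral_mkcond; apply: eq_integral => w _.
    rewrite patchE /F/= !indicE xD mulr1; case: ifPn => wS; last by rewrite mul0r.
    rewrite mul1r (bigD1 j0)//= mass0; congr (_ * _)%:E.
    by apply: eq_bigr => i ij; rewrite massE.
  rewrite IH (bigD1 j0)//= value0 EFinM muleCA muleC; congr (_ * _ * _)%E; congr (_%:E).
  by apply: eq_bigr => i ij; rewrite valueE.
rewrite ge0_integralZl//; last 3 first.
- by apply/measurable_EFinP; apply: measurable_funTS; exact: measurable_normal_pdf.
- by move=> x _; rewrite lee_fin normal_pdf_ge0.
- by rewrite mule_ge0// lee_fin.
rewrite -muleA; congr (_ * _)%E; rewrite (bigD1 j0)//= EFinM muleC; congr (_ * _)%E.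
by rewrite /slot_value/= ltnSn normal_massE.
Qed.

Let rotated_mass (t : R) (D : 'I_k -> set R) (S : set T) : 0 < t -> G S ->
  (forall i, measurable (D i)) ->
  (\int[P]_(w in S) (\prod_(i < k) normal_mass t (D i) (V w i 0))%:E =
   P S * (\prod_(i < k) normal_mass (inflated t) (D i) 0)%:E)%E.
Proof.
move=> t0 GS mD; have := rotated_slots t0 GS mD k 0.
rewrite /slot_mass /slot_value.
under eq_integral do under eq_bigr do rewrite ltn_ord.
by under [X in _ = (_ * X%:E)%E -> _]eq_bigr do rewrite ltn_ord.
Qed.

Let measurable_box (A : 'I_k -> set R) : (forall i, measurable (A i)) ->
  measurable [set w | forall i, A i (V w i 0)].
Proof.
move=> mA; rewrite (_ : [set w | _] = \bigcap_i ((fun w => V w i 0) @^-1` A i)); last first.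
  by apply/seteqP; split=> [w h i _|w h i]; exact: h.
apply: fin_bigcap_measurable; first exact: finite_finset.
by move=> i _; rewrite -[_ @^-1` _]setTI; apply: measurable_rotated => //; exact: mA.
Qed.

(** Dominated convergence as the width of the test densities tends to 0. The approximating numbers
    do not involve [B], and that is the point. *)
Lemma rotated_box_limit (a b : 'I_k -> R) (S : set T) : G S ->
  (fun n => P S * (\prod_(i < k) normal_mass (inflated (shrinking n ^+ 2))
      `]a i + shrinking n, b i + shrinking n[ 0)%:E)%E @ \oo
  --> P (S `&` [set w | forall i, `]a i, b i]%classic (V w i 0)]).
Proof.
move=> GS; have mS := G_sub GS.
have mo n i : measurable (`]a i + shrinking n, b i + shrinking n[%classic : set R).
  exact: measurable_itv.
have mI i : measurable (`]a i, b i]%classic : set R) by exact: measurable_itv.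
have d2 n : 0 < shrinking n ^+ 2 :> R by rewrite exprn_gt0// shrinking_gt0.
pose f_ n w : \bar R := (\prod_(i < k) normal_mass (shrinking n ^+ 2)
      `]a i + shrinking n, b i + shrinking n[ (V w i 0))%:E.
pose f w : \bar R := (\prod_(i < k) \1_`]a i, b i] (V w i 0))%:E.
rewrite (_ : (fun n => _) = fun n => (\int[P]_(w in S) f_ n w)%E); last first.
  by apply/funext => n; rewrite /f_ rotated_mass.
have <- : (\int[P]_(w in S) f w)%E = P (S `&` [set w | forall i, `]a i, b i]%classic (V w i 0)]).
  rewrite setIC -integral_indic//; last exact: (measurable_box mI).
  by apply: eq_integral => w _; rewrite /f (prod_indic _ (fun i => `]a i, b i]%classic) (fun w i => V w i 0)).
have bound n w : 0 <= \prod_(i < k) normal_mass (shrinking n ^+ 2)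
      `]a i + shrinking n, b i + shrinking n[ (V w i 0) <= 1.
  have q i := normal_mass_bound (shrinking n ^+ 2) (V w i 0) (mo n i).
  rewrite prodr_ge0/=; last by move=> i _; case/andP: (q i).
  by apply: prodr_ile1 => i _; exact: q.
have mf_ n : measurable_fun S (f_ n).
  apply: measurable_funTS; apply/measurable_EFinP; apply: measurable_prod => i _.
  apply: (measurableT_comp (measurable_normal_mass _ (mo n i)) (measurable_rotated i)).
  by rewrite gt_eqF.
have mf : measurable_fun S f.
  apply: measurable_funTS; apply/measurable_EFinP; apply: measurable_prod => i _.
  apply: (measurableT_comp (f := \1_`]a i, b i] : measurableTypeR R -> R)); last exact: measurable_rotated.
  by apply: measurable_indic; exact: mI.
have f_f : {ae P, forall w, S w -> f_ n w @[n --> \oo] --> f w}.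
  apply: aeW => w _; apply: cvg_EFin; first by near=> n.
  by apply: cvg_bigprod => i; exact: normal_mass_concentrates.
have ig : P.-integrable S (cst 1%:E).
  by apply: finite_measure_integrable_cst.
have fg : {ae P, forall w, forall n, S w -> (`|f_ n w| <= cst 1%:E w)%E}.
  apply: aeW => w n _; have /andP[h0 h1] := bound n w.
  by rewrite /f_ gee0_abs ?lee_fin.
by have [] := dominated_convergence mS mf_ mf f_f ig fg.
Unshelve. all: by end_near.
Qed.

End Rotated.
End Rotation.

(** * From half-open boxes to products of measurable sets *)

Section BoxExtension.
Context {d : measure_display} {T : measurableType d} {R : realType} (P : probability T R).
Variables (k : nat) (V : 'I_k -> T -> R) (gam : probability (measurableTypeR R) R).
Variable S : set T.
Hypothesis mV : forall i, measurable_fun setT (V i).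
Hypothesis mS : measurable S.
Hypothesis boxes : forall a b : 'I_k -> R,
  P (S `&` [set w | forall i, `]a i, b i]%classic (V i w)]) =
  (P S * \prod_(i < k) gam `]a i, b i]%classic)%E.

Let measurable_box (p : pred 'I_k) (A : 'I_k -> set R) : (forall i, measurable (A i)) ->
  measurable [set w | forall i, p i -> A i (V i w)].
Proof.
move=> mA; rewrite (_ : [set w | _] =
    \bigcap_i (if p i then V i @^-1` A i else setT)); last first.
  apply/seteqP; split=> [w h i _|w h i pi].
    by case: ifP => // pi; exact: h.
  by have := h i I; rewrite pi.
apply: fin_bigcap_measurable; first exact: finite_finset.
move=> i _; case: ifP => // _; rewrite -[_ @^-1` _]setTI.
by apply: mV => //; exact: mA.
Qed.

Lemma ocitv_itv (A : set R) : ocitv A -> exists a b, A = `]a, b]%classic.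
Proof.
case/ocitvP => [->|[[a b] /= _ ->]]; last by exists a, b.
by exists 0, 0; rewrite set_itvoc0.
Qed.

(** The coordinates below j may carry arbitrary measurable sets, the others half-open intervals;
    raising j by one is uniqueness of measures in a single coordinate. *)
Let box_slots j (A : 'I_k -> set R) : (forall i, measurable (A i)) ->
  (forall i : 'I_k, (j <= i)%N -> ocitv (A i)) ->
  P (S `&` [set w | forall i, A i (V i w)]) = (P S * \prod_(i < k) gam (A i))%E.
Proof.
elim: j A => [|j IH] A mA oA.
  have /choice[a /choice[b AE]] : forall i, exists a b, A i = `]a, b]%classic.
    by move=> i; apply: ocitv_itv; exact: oA.
  by rewrite (funext AE); exact: boxes.
have [jk|kj] := ltnP j k; last first.
  by apply: IH => // i ji; move: (ltn_ord i); rewrite ltnNge (leq_trans kj ji).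
pose j0 : 'I_k := Ordinal jk.
pose A' (D : set R) i := if i == j0 then D else A i.
have mA' D : measurable D -> forall i, measurable (A' D i).
  by move=> mD i; rewrite /A'; case: ifP => // _; exact: mA.
pose Q := S `&` [set w | forall i, i != j0 -> A i (V i w)].
have mQ : measurable Q by apply: measurableI => //; exact: (measurable_box (fun i => i != j0)).
pose r := fine (P S * \prod_(i < k | i != j0) gam (A i))%E.
have p0 : (0 <= P S * \prod_(i < k | i != j0) gam (A i))%E.
  by rewrite mule_ge0// prode_ge0.
have r0 : 0 <= r by exact: fine_ge0.
have rE : (r%:E = P S * \prod_(i < k | i != j0) gam (A i))%E.
  rewrite /r fineK// fin_numM//; first exact: fin_num_measure.
  by apply: prode_fin_num => i _; apply: fin_num_measure; exact: mA.
have mind : measurable_fun setT (\1_Q : T -> R) by exact: measurable_indic.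
have ind0 w : 0 <= \1_Q w :> R by rewrite indicE.
have mVj : measurable_fun setT (V j0 : T -> measurableTypeR R) by exact: mV.
(* Both sides as measures of the set in slot [j0], the other slots being fixed. By induction they
   agree on half-open intervals, which are stable under intersection. *)
pose m1 : {measure set (measurableTypeR R) -> \bar R} := weighted_image P mVj mind ind0.
pose m2 : {measure set (measurableTypeR R) -> \bar R} := mscale (NngNum r0) gam.
have m1E (D : set R) : measurable D -> m1 D = P (S `&` [set w | forall i, A' D i (V i w)]).
  move=> mD; rewrite -[m1 D]/(\int[P]_(x in V j0 @^-1` D) (\1_Q x)%:E)%E integral_indic//; last first.
    by rewrite -[_ @^-1` _]setTI; exact: mV.
  congr (P _); apply/seteqP; split=> w /=.
    move=> [[Sw h] Dw]; split=> // i; rewrite /A'; case: eqP => [->//|/eqP ij].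
    exact: h.
  move=> [Sw h]; split; last by have := h j0; rewrite /A' eqxx.
  split=> // i ij; have := h i; rewrite /A' (negbTE ij).
  exact.
have m2E (D : set R) : m2 D = (P S * \prod_(i < k) gam (A' D i))%E.
  rewrite -[m2 D]/(r%:E * gam D)%E rE [in RHS](bigD1 j0)//=.
  have -> : A' D j0 = D by rewrite /A' eqxx.
  rewrite [RHS]muleCA [RHS]muleC; congr (_ * _)%E.
  by congr (_ * _)%E; apply: eq_bigr => i ij; rewrite /A' (negbTE ij).
have AE : A = A' (A j0) by apply/funext => i; rewrite /A'; case: eqP => [->|].
rewrite AE -m1E// -m2E.
apply: (@measure_unique _ R (measurableTypeR R) (@ocitv R) (fun n => `](- n%:R), n%:R]%classic) _ _ _ _ m1 m2) => //.
- exact: ocitvI.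
- by move=> n; exact: is_ocitv.
- by apply/seteqP; split=> // x _; exists (Num.truncn `|x|).+1 => //=; rewrite in_itv/=; have := truncnS_gt `|x|; rewrite ltr_norml => /andP[-> /ltW ->].
- move=> D oD; have mD : measurable D by exact: sub_sigma_algebra.
  rewrite [LHS]m1E// m2E; apply: IH; first exact: mA'.
  move=> i; rewrite leq_eqVlt /A' => /orP[/eqP ji|ji].
    by have -> : i = j0; [exact/val_inj|rewrite eqxx].
  by case: ifP => // _; exact: oA.
- move=> n; have mn : measurable (`](- n%:R), n%:R]%classic : set R) by exact: measurable_itv.
  rewrite [X in (X < _)%E]m1E//; apply: le_lt_trans (ltry 1); apply: probability_le1.
  apply: measurableI => //; rewrite (_ : [set w | _] = [set w | forall i, xpredT i -> A' `](- n%:R), n%:R]%classic i (V i w)]).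
    by apply: measurable_box; exact: mA'.
  by apply/seteqP; split=> w /= h i; [move=> _|]; exact: h.
- exact: mA.
Qed.

Theorem box_law_extension (A : 'I_k -> set R) : (forall i, measurable (A i)) ->
  P (S `&` [set w | forall i, A i (V i w)]) = (P S * \prod_(i < k) gam (A i))%E.
Proof.
by move=> mA; apply: (box_slots mA (j := k)) => i; rewrite leqNgt ltn_ord.
Qed.

End BoxExtension.

Section RotationLaw.
Context {d : measure_display} {T : measurableType d} {R : realType} (P : probability T R).
Variable G : set (set T).
Hypotheses (G_sigma : sigma_algebra setT G) (G_sub : G `<=` measurable).
Variables (k : nat) (W : T -> 'cV[R]_k) (s : R).
Hypothesis s_gt0 : 0 < s.
Hypothesis mW : forall i, measurable_fun setT (fun w => W w i 0).
Hypothesis W_indep : forall (S : set T) (A : 'I_k -> set R), G S ->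
  (forall i, measurable (A i)) ->
  P (S `&` [set w | forall i, A i (W w i 0)]) =
  (P S * \prod_(i < k) normal_prob 0 s (A i))%E.
Variable B : T -> 'M[R]_k.
Hypothesis B_orth : forall w, B w *m (B w)^T = 1%:M.
Hypothesis B_G : forall i j, sub_measurable G (fun w => B w i j).

(** The probabilities of a half-open box for [B] and for the identity are limits of one and the same
    sequence, hence equal, and the one for the identity is given by [W_indep]. *)
Theorem gaussian_rotation (S : set T) (A : 'I_k -> set R) : G S ->
  (forall i, measurable (A i)) ->
  P (S `&` [set w | forall i, A i ((B w *m W w) i 0)]) =
  (P S * \prod_(i < k) normal_prob 0 s (A i))%E.
Proof.
move=> GS; apply: (box_law_extension (V := fun i w => (B w *m W w) i 0) (gam := normal_prob 0 s)).
- by move=> i; exact: (measurable_rotated G_sigma G_sub mW B_G).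
- exact: G_sub.
move=> a b.
have lB := rotated_box_limit G_sigma G_sub s_gt0 mW W_indep B_orth B_G (a := a) (b := b) GS.
have one_orth (w : T) : (1%:M : 'M[R]_k) *m (1%:M : 'M[R]_k)^T = 1%:M by rewrite trmx1 mulmx1.
have one_G i j : sub_measurable G (fun w => (1%:M : 'M[R]_k) i j).
  by apply/sub_measurableP => //; exact: measurable_cst.
have l1 := rotated_box_limit G_sigma G_sub s_gt0 mW W_indep one_orth one_G (a := a) (b := b) GS.
have uniq := cvg_unique (@ereal_hausdorff R) (FF := _) lB l1.
have mI i : measurable (`]a i, b i]%classic : set R) by exact: measurable_itv.
apply: etrans (W_indep GS mI); apply: etrans (uniq _) _; congr (P (S `&` _)).
by apply/seteqP; split=> w /= h i; have := h i; rewrite mul1mx.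
Qed.

End RotationLaw.

(** * Fields of first degree generate weak symmetries *)

Section SubMeasurableAlgebra.
Context {d : measure_display} {T : measurableType d} {R : realType}.
Implicit Types (G : set (set T)) (X : T -> R).

Lemma sub_measurable_le G G' X : G `<=` G' -> sub_measurable G X -> sub_measurable G' X.
Proof. by move=> GG GX A mA; exact/GG/GX. Qed.

Lemma sub_measurable_measurable G X : G `<=` measurable -> sub_measurable G X ->
  measurable_fun setT X.
Proof. by move=> GG GX _ A mA; rewrite setTI; exact/GG/GX. Qed.

Lemma sub_measurable_cst G (c : R) : sigma_algebra setT G -> sub_measurable G (fun=> c).
Proof. by move=> sG; apply/sub_measurableP => //; exact: measurable_cst. Qed.

Lemma sub_measurable_sub G X X' : sigma_algebra setT G ->
  sub_measurable G X -> sub_measurable G X' -> sub_measurable G (fun w => X w - X' w).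
Proof.
move=> sG /(sub_measurableP sG) mX /(sub_measurableP sG) mX'.
by apply/sub_measurableP => //; exact: measurable_funB.
Qed.

Lemma sub_measurable_add G X X' : sigma_algebra setT G ->
  sub_measurable G X -> sub_measurable G X' -> sub_measurable G (fun w => X w + X' w).
Proof.
move=> sG /(sub_measurableP sG) mX /(sub_measurableP sG) mX'.
by apply/sub_measurableP => //; exact: measurable_funD.
Qed.

Lemma sub_measurable_mul G X X' : sigma_algebra setT G ->
  sub_measurable G X -> sub_measurable G X' -> sub_measurable G (fun w => X w * X' w).
Proof.
move=> sG /(sub_measurableP sG) mX /(sub_measurableP sG) mX'.
by apply/sub_measurableP => //; exact: measurable_funM.
Qed.

Lemma sub_measurable_sum G n (X : 'I_n -> T -> R) : sigma_algebra setT G ->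
  (forall j, sub_measurable G (X j)) -> sub_measurable G (fun w => \sum_j X j w).
Proof.
move=> sG mX; apply/sub_measurableP => //; apply: measurable_sum => j.
by apply/(sub_measurableP sG); exact: mX.
Qed.

End SubMeasurableAlgebra.

Section TransformedSolution.
Context {R : realType} {m k : nat}.
Variables (M : set 'cV[R]_m) (mu : 'cV[R]_m -> 'cV[R]_m) (sigma : 'cV[R]_m -> 'M[R]_(m, k)).
Variables (t : nat -> R) (Phi : 'cV[R]_m -> 'cV[R]_m) (B : 'cV[R]_m -> 'M[R]_k).
Hypotheses (M_open : open M) (t_grid : time_grid t).

Lemma jump_transform_driver (T : Type) (X : nat -> T -> 'cV[R]_m)
    (Z : nat -> T -> 'cV[R]_(1 + k)) l w :
  jump (transform_driver t B X Z) l w =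
  col_mx (grid_step t l)%:M (B (X l w) *m dsubmx (jump Z l w)).
Proof. by rewrite /jump /transform_driver big_ord_recr/= [LHS]addrC addKr. Qed.

Lemma transform_driver_time (T : Type) (X : nat -> T -> 'cV[R]_m)
    (Z : nat -> T -> 'cV[R]_(1 + k)) l w : transform_driver t B X Z l w 0 0 = t l.
Proof.
elim: l => [|l IH]; first by rewrite /transform_driver big_ord0 mxE t_grid.1.
have := congr1 (fun u : 'cV_(1 + k) => u 0 0) (jump_transform_driver X Z l w).
rewrite /jump mxE [X in _ + X]mxE IH => /eqP; rewrite subr_eq => /eqP ->.
have -> : (0 : 'I_(1 + k)) = lshift k 0 by exact/val_inj.
by rewrite col_mxEu !mxE/= mulr1n /grid_step subrK.
Qed.

Hypothesis Phi_in : forall x, M x -> M (Phi x).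
Hypothesis Phi_cont : forall i x, M x -> {for x, continuous (fun y => Phi y i 0)}.
Hypothesis B_cont : forall i j x, M x -> {for x, continuous (fun y => B y i j)}.
Hypothesis B_orth : forall x, M x -> B x *m (B x)^T = 1%:M.
Hypothesis equivariant : forall x l w, M x ->
  Phi (euler mu sigma x (grid_step t l) w) =
  euler mu sigma (Phi x) (grid_step t l) (B x *m w).

Lemma euler_solution_transform d (T : measurableType d) (P : probability T R) X Z :
  euler_solution t M mu sigma P X Z ->
  euler_solution t M mu sigma P (transform_state Phi X) (transform_driver t B X Z).
Proof.
move=> [G [[G_sigma G_sub G_le] [GX MX] [GZ Z0 Zt Zlaw] X_step]].
have G_mono l l' : (l <= l')%N -> G l `<=` G l'.
  elim: l' => [|l' IH]; first by rewrite leqn0 => /eqP ->.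
  rewrite leq_eqVlt => /orP[/eqP -> //|]; rewrite ltnS => /IH h.
  exact: subset_trans h (G_le l').
have GjZ l i : sub_measurable (G l.+1) (fun w => jump Z l w i 0).
  rewrite /jump (_ : (fun w => _) = fun w => Z l.+1 w i 0 - Z l w i 0); last first.
    by apply/funext => w; rewrite !mxE.
  apply: sub_measurable_sub => //; first exact: GZ.
  exact: sub_measurable_le (G_le l) (GZ l i).
have GdZ l i : sub_measurable (G l.+1) (fun w => dsubmx (jump Z l w) i 0).
  by under eq_fun do rewrite mxE; exact: GjZ.
have GBX l i j : sub_measurable (G l) (fun w => B (X l w) i j).
  by apply: (sub_measurable_continuous (G_sigma l) (f := fun y => B y i j) M_open (MX l)); [exact: B_cont|exact: GX].
(* The filtration is kept: [B (X l w)] is known at time l, so the rotated increments are adapted to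
   it. *)
exists G; split.
- by [].
- split=> [l i|l w]; last exact: Phi_in.
  by apply: (sub_measurable_continuous (G_sigma l) (f := fun y => Phi y i 0) M_open (MX l)); [exact: Phi_cont|exact: GX].
- split.
  + move=> l i; rewrite -/(sub_measurable _ _) /transform_driver.
    under eq_fun do rewrite summxE; apply: sub_measurable_sum => // j.
    apply: (sub_measurable_le (G_mono _ _ (ltn_ord j))).
    case: (splitP i) => i' ii'.
      have -> : i = lshift k i' by exact/val_inj.
      under eq_fun do rewrite col_mxEu; exact: sub_measurable_cst.
    have -> : i = rshift 1 i' by exact/val_inj.
    under eq_fun do rewrite col_mxEd mxE; apply: sub_measurable_sum => // l'.
    apply: sub_measurable_mul => //.
    exact: sub_measurable_le (G_le j) (GBX j i' l').
  + by apply: aeW => w; rewrite /transform_driver big_ord0.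
  + by move=> l; apply: aeW => w; exact: transform_driver_time.
  + move=> l S A GS mA; under eq_set do under eq_forall do rewrite jump_transform_driver col_mxKd.
    apply: (@gaussian_rotation _ _ _ P (G l) (G_sigma l) (G_sub l) k
      (fun w => dsubmx (jump Z l w)) (Num.sqrt (grid_step t l)) _ _ _ (fun w => B (X l w))) => //.
    * by rewrite sqrtr_gt0 subr_gt0 t_grid.2.
    * by move=> i; apply: sub_measurable_measurable (GdZ l i); exact: G_sub.
    * by move=> S' A' GS' mA'; exact: Zlaw.
    * by move=> w; exact: B_orth.
(* The time component of [Z] equals the grid only almost surely, so its values at both ends of the
   step join the exceptional sets; the new driver has exact times. *)
- move=> l; move: (X_step l) (Zt l) (Zt l.+1); apply: filterS3 => w Xw tw tw'.
  have jt : jump Z l w 0 0 = grid_step t l by rewrite /jump !mxE tw tw'.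
  have -> : jump (transform_driver t B X Z) l w 0 0 = grid_step t l.
    by rewrite /jump mxE [X in _ + X]mxE !transform_driver_time.
  by rewrite /transform_state Xw jt equivariant// jump_transform_driver col_mxKd.
Qed.

End TransformedSolution.

Section AffineCase.
Context {R : realType} {m k : nat}.
Variables (M : set 'cV[R]_m) (mu : 'cV[R]_m -> 'cV[R]_m) (sigma : 'cV[R]_m -> 'M[R]_(m, k)).
Variables (t : nat -> R) (Y : 'cV[R]_m -> 'cV[R]_m) (C : 'cV[R]_m -> 'M[R]_k).
Hypotheses (M_open : open M) (mu_smooth : smooth_on M mu) (sigma_smooth : smooth_on M sigma).
Hypotheses (t_grid : time_grid t) (V_sym : quasi_strong_symmetry M mu sigma Y C).
Hypothesis euler_in_M : forall (x : 'cV[R]_m) (l : nat) (w : 'cV[R]_k),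
  M x -> M (euler mu sigma x (grid_step t l) w).

Theorem first_degree_weak_symmetry : (forall i, first_degree_on M (fun x => Y x i 0)) ->
  euler_infinitesimal_weak_symmetry t M mu sigma Y C.
Proof.
move=> /choice[c /choice[a ca]].
pose A : 'M[R]_m := \matrix_(i, j) a i j; pose b : 'cV[R]_m := \col_i c i.
have Y_affine x : M x -> Y x = A *m x + b.
  move=> Mx; apply/matrixP => i j; rewrite ord1 ca// !mxE addrC; congr (_ + _).
  by apply: eq_bigr => l _; rewrite mxE.
have [_ _ [Phi Phi_flow] _ _] := V_sym.
have [E [v [[E0 Ed] Pa cv]]] := flow_on_affine Phi_flow Y_affine.
have [B [BP Bs]] := rotation_exists M_open V_sym Phi_flow Y_affine.
have orth s x : M x -> B s x *m (B s x)^T = 1%:M.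
  move=> Mx; have [B0 Bd] := BP x Mx.
  exact: (rotation_orthogonal V_sym Phi_flow Mx B0 Bd).
exists Phi, B; split=> //.
  move=> x Mx; have [B0 Bd] := BP x Mx; split=> // s.
  by apply/is_derive_mxP => i j; exact: Bd.
move=> s; split=> //.
- exact: (affine_flow_diffeo M_open Phi_flow Y_affine).
- exact: orth.
move=> d T P X Z; apply: euler_solution_transform => //.
- by move=> x Mx; exact: (flow_on_in Phi_flow).
- have [Psi [_ _ sm _]] := affine_flow_diffeo M_open Phi_flow Y_affine s.
  by move=> i x Mx; have [h _] := sm 0%N i 0; exact: h.
- by move=> i j x Mx; have [h _] := Bs s 0%N i j; exact: h.
- exact: orth.
(* [Phi] is affine on [M] only, so the image of the Euler step has to lie in [M] before the formula
   applies to it. *)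
move=> x l w Mx; rewrite Pa; last exact: euler_in_M.
have [B0 Bd] := BP x Mx.
rewrite /euler (drift_equivariant M_open mu_smooth V_sym Phi_flow Y_affine E0 Ed s Mx).
rewrite mulmxA (diffusion_equivariant M_open sigma_smooth V_sym Phi_flow Y_affine E0 Ed Mx B0 Bd s).
rewrite Pa// !mulmxDr -scalemxAr mulmxA addrAC; congr (_ + _).
by rewrite addrAC.
Qed.

End AffineCase.

(** * An independent sequence on the unit interval *)

Section HalfLines.
Context {R : realType}.

Lemma halfline_measure_unique (m1 m2 : {measure set (measurableTypeR R) -> \bar R}) :
  (forall s : R, m1 `]s, +oo[%classic = m2 `]s, +oo[%classic) ->
  (forall s : R, (m1 `]s, +oo[%classic < +oo)%E) ->
  forall A : set (measurableTypeR R), measurable A -> m1 A = m2 A.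
Proof.
move=> m12 fin A mA.
pose g n : set (measurableTypeR R) := `](- n%:R), +oo[%classic.
have gI : setI_closed (@RGenOInfty.G R).
  move=> _ _ [a ->] [b ->]; exists (Num.max a b).
  apply/seteqP; split=> x /=; rewrite !in_itv/= !andbT gt_max; first by move=> [-> ->].
  by move/andP.
have gG n : @RGenOInfty.G R (g n) by exists (- n%:R).
have gT : \bigcup_n g n = setT.
  apply/seteqP; split=> // x _; exists (Num.truncn `|x|).+1 => //=.
  by rewrite /g/= in_itv/= andbT; have := truncnS_gt `|x|; rewrite ltr_norml => /andP[].
have mE : (measurable : set (set (measurableTypeR R))) = <<s @RGenOInfty.G R>>.
  exact: RGenOInfty.measurableE.
refine (measure_unique (T := measurableTypeR R) (@RGenOInfty.G R) g mE gI gG gT m1 m2 _ _ A mA).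
- by move=> _ [a ->].
- by move=> n; exact: fin.
Qed.

(** Half-lines are stable under intersection and generate the Borel sets. The event [S] and the
    weight [c] are carried along so that independence, and not only a law, can be tested on
    half-lines. *)
Lemma halfline_law d (T : measurableType d) (P : probability T R) (gam : probability (measurableTypeR R) R)
    (f : T -> measurableTypeR R) (S : set T) (c : R) :
  measurable_fun setT f -> measurable S -> 0 <= c ->
  (forall s : R, P (S `&` f @^-1` `]s, +oo[%classic) = (c%:E * gam `]s, +oo[%classic)%E) ->
  forall A : set (measurableTypeR R), measurable A -> P (S `&` f @^-1` A) = (c%:E * gam A)%E.
Proof.
move=> mf mS c0 h A mA.
have mind : measurable_fun setT (\1_S : T -> R) by exact: measurable_indic.
have ind0 x : 0 <= \1_S x :> R by rewrite indicE.
have mpre (D : set (measurableTypeR R)) : measurable D -> measurable (f @^-1` D).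
  by move=> mD; rewrite -[_ @^-1` _]setTI; exact: mf.
pose m1 : {measure set (measurableTypeR R) -> \bar R} := weighted_image P mf mind ind0.
pose m2 : {measure set (measurableTypeR R) -> \bar R} := mscale (NngNum c0) gam.
have m1E (D : set (measurableTypeR R)) : measurable D -> m1 D = P (S `&` f @^-1` D).
  move=> mD; rewrite -[m1 D]/(\int[P]_(x in f @^-1` D) (\1_S x)%:E)%E.
  by rewrite integral_indic//; exact: mpre.
rewrite -m1E// -[RHS]/(m2 A); apply: halfline_measure_unique => // s.
  by rewrite [LHS]m1E; [exact: h|exact: measurable_itv].
rewrite [X in (X < _)%E]m1E; last exact: measurable_itv.
apply: le_lt_trans (ltry 1); apply: probability_le1.
by apply: measurableI => //; apply: mpre; exact: measurable_itv.
Qed.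

End HalfLines.

Section FairBits.
Context {R : realType}.
Local Notation leb := (@lebesgue_measure R).

Definition uniform01 : probability (measurableTypeR R) R := uniform_prob (@ltr01 R).
Local Notation P := uniform01.

(** The tail function of the uniform law, the probability of exceeding s. *)
Definition survival (s : R) : R := if s < 0 then 1 else if s < 1 then 1 - s else 0.

Lemma uniform01E (A : set R) : measurable A -> P A = leb (A `&` `[0, 1]).
Proof.
move=> mA; rewrite -[LHS]/(uniform_prob (@ltr01 R) A) /uniform_prob integral_uniform_pdf.
rewrite (eq_integral (fun=> 1%:E)); last first.
  by move=> x; rewrite inE/= in_itv/= /uniform_pdf => -[_ ->]; rewrite subr0 invr1.
by rewrite integral_cst ?mul1e//; apply: measurableI => //; exact: measurable_itv.
Qed.

Lemma uniform01_halfline (s : R) : P `]s, +oo[%classic = (survival s)%:E.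
Proof.
rewrite uniform01E; last exact: measurable_itv.
rewrite /survival; case: (ltP s 0) => s0.
  rewrite (_ : _ `&` _ = `[0, 1]%classic).
    by rewrite lebesgue_measure_itv/= lte_fin ltr01 oppr0 adde0.
  by apply/seteqP; split=> x /=; rewrite !in_itv/=; lra.
case: (ltP s 1) => s1.
  rewrite (_ : _ `&` _ = `]s, 1]%classic).
    by rewrite lebesgue_measure_itv/= lte_fin s1.
  by apply/seteqP; split=> x /=; rewrite !in_itv/=; lra.
rewrite (_ : _ `&` _ = set0) ?measure0//.
by apply/seteqP; split=> x //=; rewrite !in_itv/=; lra.
Qed.

(** The first binary digit; [doubling] removes it and shifts the rest. At the point 1 the digit is 1
    and the shift fixes the point, so [[0, 1]] is mapped into itself. *)
Definition leading_bit (x : R) : bool := 2^-1 <= x.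
Definition doubling (x : R) : R := 2 * x - (leading_bit x)%:R.

Lemma measurable_leading_bit : measurable_fun setT (leading_bit : measurableTypeR R -> bool).
Proof. by rewrite /leading_bit; apply: measurable_fun_ler. Qed.

Lemma measurable_doubling : measurable_fun setT (doubling : measurableTypeR R -> measurableTypeR R).
Proof.
rewrite /doubling; apply: measurable_funB; first exact: measurable_funM.
rewrite (_ : (fun x => _) = \1_`[2^-1, +oo[); first exact: measurable_indic.
apply/funext => x; rewrite indicE /leading_bit.
have -> // : (x \in `[2^-1, +oo[%classic) = (2^-1 <= x).
by apply/idP/idP; rewrite inE/= in_itv/= andbT.
Qed.

Lemma measurable_leading_doubling (b : bool) (A : set R) : measurable A ->
  measurable [set x | leading_bit x = b /\ A (doubling x)].
Proof.
move=> mA; rewrite (_ : [set x | _] = leading_bit @^-1` [set b] `&` doubling @^-1` A)//.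
by apply: measurableI; rewrite -[_ @^-1` _]setTI; [exact: measurable_leading_bit|exact: measurable_doubling].
Qed.

Lemma leading_bit_halfline (b : bool) (s : R) :
  P [set x | leading_bit x = b /\ s < doubling x] = (2^-1 * survival s)%:E.
Proof.
have mA : measurable [set x | leading_bit x = b /\ s < doubling x].
  have := measurable_leading_doubling b (measurable_itv `]s, +oo[).
  by under eq_set do rewrite /= in_itv/= andbT.
rewrite uniform01E// /survival /doubling /leading_bit; case: b mA => mA.
- case: (ltP s 0) => s0.
    rewrite (_ : _ `&` _ = `[2^-1, 1]%classic).
      by rewrite lebesgue_measure_itv/= lte_fin ifT -?EFinB; [congr (_%:E)|]; lra.
    apply/seteqP; split=> x /=; rewrite !in_itv/=; first by lra.
    by move=> /andP[h1 h2]; rewrite h1/=; split; [split=> //|]; lra.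
  case: (ltP s 1) => s1.
    rewrite (_ : _ `&` _ = `]((s + 1) / 2), 1]%classic).
      by rewrite lebesgue_measure_itv/= lte_fin ifT -?EFinB; [congr (_%:E)|]; lra.
    apply/seteqP; split=> x /=; rewrite !in_itv/=; first by move=> [[h]]; rewrite h/=; lra.
    by move=> /andP[h1 h2]; have h3 : 2^-1 <= x by [lra]; rewrite h3/=; split; [split=> //|]; lra.
  rewrite mulr0 (_ : _ `&` _ = set0) ?measure0//.
  by apply/seteqP; split=> x //=; rewrite !in_itv/= => -[[->/=]]; lra.
- case: (ltP s 0) => s0.
    rewrite (_ : _ `&` _ = `[0, 2^-1[%classic).
      by rewrite lebesgue_measure_itv/= lte_fin ifT -?EFinB; [congr (_%:E)|]; lra.
    apply/seteqP; split=> x /=; rewrite !in_itv/=.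
      by move=> [[/negbT]]; rewrite -ltNge => h1 h2 /andP[h3 h4]; rewrite h1 h3.
    move=> /andP[h1 h2]; have h3 : (2^-1 <= x) = false by apply/negbTE; rewrite -ltNge.
    by rewrite h3/=; split; [split=> //|]; lra.
  case: (ltP s 1) => s1.
    rewrite (_ : _ `&` _ = `](s / 2), 2^-1[%classic).
      by rewrite lebesgue_measure_itv/= lte_fin ifT -?EFinB; [congr (_%:E)|]; lra.
    apply/seteqP; split=> x /=; rewrite !in_itv/=.
      by move=> [[h]]; rewrite h/=; move/negbT: h; rewrite -ltNge; lra.
    move=> /andP[h1 h2]; have h3 : (2^-1 <= x) = false by apply/negbTE; rewrite -ltNge.
    by rewrite h3/=; split; [split=> //|]; lra.
  rewrite mulr0 (_ : _ `&` _ = set0) ?measure0//.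
  apply/seteqP; split=> x //=; rewrite !in_itv/= => -[[h]].
  by rewrite h/=; move/negbT: h; rewrite -ltNge; lra.
Qed.

(** The first digit is fair and independent of the shifted number, which is again uniform. *)
Lemma leading_bit_doubling (b : bool) (A : set R) : measurable A ->
  P [set x | leading_bit x = b /\ A (doubling x)] = (2^-1%:E * P A)%E.
Proof.
have mb : measurable [set x | leading_bit x = b] by rewrite -[X in measurable X]setTI; exact: (measurable_leading_bit measurableT (Y := [set b])).
have half0 : 0 <= 2^-1 :> R by [].
apply: (halfline_law (P := P) measurable_doubling mb half0) => s.
rewrite uniform01_halfline -EFinM -(leading_bit_halfline b).
by congr (P _); apply/seteqP; split=> x /=; rewrite in_itv/= andbT.
Qed.

End FairBits.

Section EvenBits.
Context {R : realType}.
Local Notation P := (@uniform01 R).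
Local Notation bit := (@leading_bit R).
Local Notation D := (@doubling R).
Implicit Types (x s r : R).

Lemma fair_bit (A : bool -> set R) : (forall b, measurable (A b)) ->
  P [set x | A (bit x) (D x)] = (2^-1%:E * (P (A true) + P (A false)))%E.
Proof.
move=> mA.
have split_bit : [set x | A (bit x) (D x)] =
    [set x | bit x = true /\ A true (D x)] `|` [set x | bit x = false /\ A false (D x)].
  apply/seteqP; split=> x /=; first by case: (bit x) => h; [left|right].
  by move=> [[-> h]|[-> h]].
rewrite split_bit measureU//; last 3 first.
- exact: measurable_leading_doubling.
- exact: measurable_leading_doubling.
- by apply/seteqP; split=> x //= [[->] _ []].
have h b := leading_bit_doubling b (mA b).
by rewrite ge0_muleDr//; apply: congr2; exact: h.
Qed.

(** Keeps every second binary digit, starting with the first, and closes the gaps. The digits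
    skipped form the same number for [doubling x]. *)
Fixpoint even_approx n x : R :=
  if n is p.+1 then ((bit x)%:R + even_approx p (D (D x))) / 2 else 0.

Lemma even_approx_bound n x : 0 <= even_approx n x <= 1.
Proof.
elim: n x => [|n IH] x /=; first by rewrite lexx ler01.
by have := IH (D (D x)); case: (bit x) => /=; lra.
Qed.

Lemma even_approx_nondecreasing x : nondecreasing_seq (even_approx ^~ x).
Proof.
apply/nondecreasing_seqP => n; elim: n x => [|n IH] x.
  by have /andP[] := even_approx_bound 1 x.
by rewrite -[leLHS]/(((bit x)%:R + even_approx n (D (D x))) / 2); have := IH (D (D x)); rewrite /=; lra.
Qed.

Definition even_bits x : R := limn (even_approx ^~ x).

Lemma cvg_even_approx x : even_approx ^~ x @ \oo --> even_bits x.
Proof.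
apply: (@nondecreasing_is_cvgn _ _ (even_approx_nondecreasing x)).
by exists 1 => _ [n _ <-]; have /andP[] := even_approx_bound n x.
Qed.

Lemma even_bitsE x : even_bits x = ((bit x)%:R + even_bits (D (D x))) / 2.
Proof.
have h1 : even_approx n.+1 x @[n --> \oo] --> even_bits x.
  by have := @cvg_even_approx x; rewrite -cvg_shiftS.
have h2 : even_approx n.+1 x @[n --> \oo] --> ((bit x)%:R + even_bits (D (D x))) / 2.
  rewrite /=; apply: cvgMl; apply: cvgD; first exact: cvg_cst.
  exact: cvg_even_approx.
exact: (cvg_unique (@Rhausdorff R) h1 h2).
Qed.

Lemma even_bits_bound x : 0 <= even_bits x <= 1.
Proof.
apply/andP; split.
  by apply: limr_ge; [apply/cvg_ex; eexists; exact: cvg_even_approx|near=> n; have /andP[] := even_approx_bound n x].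
by apply: limr_le; [apply/cvg_ex; eexists; exact: cvg_even_approx|near=> n; have /andP[] := even_approx_bound n x].
Unshelve. all: by end_near.
Qed.

Lemma measurable_even_bits : measurable_fun setT (even_bits : measurableTypeR R -> measurableTypeR R).
Proof.
have mD := @measurable_doubling R.
have ma n : measurable_fun setT (even_approx n : measurableTypeR R -> measurableTypeR R).
  elim: n => [|n IH] /=; first exact: measurable_cst.
  apply: measurable_funM => //; apply: measurable_funD.
    rewrite (_ : (fun x => _) = fun x => 2 * x - D x); first exact: measurable_funB (measurable_funM _ _) mD.
    by apply/funext => x; rewrite /doubling; ring.
  exact: (measurableT_comp IH (measurableT_comp mD mD)).
by apply: (measurable_fun_cvg ma) => x _; exact: cvg_even_approx.
Qed.

Lemma survival_half s :
  survival s = (survival (2 * s - 1) + survival (2 * s)) / 2 :> R.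
Proof.
rewrite /survival.
have [s0|s0] := ltP s 0; have [|] := ltP (2 * s) 0; have [|] := ltP (2 * s - 1) 0;
  have [|] := ltP s 1; have [|] := ltP (2 * s) 1; have [|] := ltP (2 * s - 1) 1; lra.
Qed.

Lemma eq0_geometric (a : R) : (forall n, `|a| <= 2^-1 ^+ n) -> a = 0.
Proof.
move=> h; apply/eqP; rewrite -normr_le0; apply/ler_addgt0Pr => e e0; rewrite add0r.
have half1 : `|2^-1 : R| < 1 by rewrite gtr0_norm//; lra.
have /cvgrPdist_lt/(_ e e0)[N _ /(_ N (leqnn N))] := cvg_expr half1.
rewrite /= sub0r normrN ger0_norm ?exprn_ge0// => /ltW.
exact: le_trans (h N).
Qed.

Let mE := @measurable_even_bits.
Let mD := @measurable_doubling R.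

Let measurable_gt (f : measurableTypeR R -> measurableTypeR R) s :
  measurable_fun setT f -> measurable [set x | s < f x].
Proof.
move=> mf; rewrite (_ : [set x | _] = f @^-1` `]s, +oo[%classic); last first.
  by apply/seteqP; split=> x /=; rewrite in_itv/= andbT.
by rewrite -[_ @^-1` _]setTI; apply: mf => //; exact: measurable_itv.
Qed.

Let upper s : R := fine (P [set x | s < even_bits x]).
Let upper2 s r : R := fine (P [set x | s < even_bits x /\ r < even_bits (D x)]).

Let mupper s : measurable [set x | s < even_bits x].
Proof. exact: (measurable_gt s mE). Qed.

Let mupperD s : measurable [set x | s < even_bits (D x)].
Proof. exact: (measurable_gt s (measurableT_comp mE mD)). Qed.

Let mupper2 s r : measurable [set x | s < even_bits x /\ r < even_bits (D x)].
Proof. by rewrite (_ : [set x | _] = [set x | s < even_bits x] `&` [set x | r < even_bits (D x)])//; exact: measurableI. Qed.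

Let finP (A : set R) : measurable A -> (fine (P A))%:E = P A.
Proof. by move=> mA; rewrite fineK// fin_num_measure. Qed.

Lemma doubling_law (A : set R) : measurable A -> P (D @^-1` A) = P A.
Proof.
move=> mA; have := @fair_bit (fun=> A) (fun=> mA) => /= ->.
by rewrite -(finP mA) -EFinD -EFinM; congr (_%:E); lra.
Qed.

Let even_gt s x : (s < even_bits x) = (2 * s - (bit x)%:R < even_bits (D (D x))).
Proof. by rewrite even_bitsE; apply/idP/idP; lra. Qed.

Let upper_rec s : upper s = (upper (2 * s - 1) + upper (2 * s)) / 2.
Proof.
apply: EFin_inj; rewrite /upper finP//.
rewrite (_ : [set x | _] = [set x | [set y | 2 * s - (bit x)%:R < even_bits (D y)] (D x)]); last first.
  by apply/seteqP; split=> x /=; rewrite even_gt.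
rewrite (@fair_bit (fun b => [set y | 2 * s - b%:R < even_bits (D y)])); last first.
  by move=> b; exact: mupperD.
rewrite muleC EFinM; congr (_ * _)%E; rewrite EFinD subr0.
by rewrite !finP// -!(doubling_law (mupper _)).
Qed.

(** Reading off one digit exchanges the two subsequences, so r comes first on the right, and it
    rescales the threshold of the subsequence that lost the digit. *)
Let upper2_rec s r : upper2 s r = (upper2 r (2 * s - 1) + upper2 r (2 * s)) / 2.
Proof.
apply: EFin_inj; rewrite /upper2 finP//.
rewrite (_ : [set x | _] = [set x | [set y | r < even_bits y /\ 2 * s - (bit x)%:R < even_bits (D y)] (D x)]); last first.
  by apply/seteqP; split=> x /=; rewrite (even_gt s x) => -[h1 h2]; split.
rewrite (@fair_bit (fun b => [set y | r < even_bits y /\ 2 * s - b%:R < even_bits (D y)])); last first.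
  by move=> b; exact: mupper2.
by rewrite muleC EFinM; congr (_ * _)%E; rewrite EFinD subr0 !finP.
Qed.

Let fine_P_bound (A : set R) : measurable A -> 0 <= fine (P A) <= 1.
Proof. by move=> mA; rewrite -!lee_fin finP// measure_ge0 probability_le1. Qed.

Let survival_bound s : 0 <= survival s <= (1 : R).
Proof. by rewrite /survival; case: ltP => ?; [|case: ltP => ?]; lra. Qed.

Let fine_PT : fine (P setT) = 1.
Proof. by rewrite (@probability_setT _ _ _ P). Qed.

Let fine_P0 : fine (P set0) = 0.
Proof. by rewrite measure0. Qed.

Let upper_lt0 s : s < 0 -> upper s = 1.
Proof.
move=> s0; rewrite /upper -[RHS]fine_PT; congr (fine (P _)); apply/seteqP; split=> x //= _.
by have /andP[h _] := even_bits_bound x; lra.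
Qed.

Let upper_ge1 s : 1 <= s -> upper s = 0.
Proof.
move=> s0; rewrite /upper -[RHS]fine_P0; congr (fine (P _)); apply/seteqP; split=> x //= h'.
by have /andP[_ h] := even_bits_bound x; lra.
Qed.

(** Both functions satisfy [f s = (f (2 s - 1) + f (2 s)) / 2] and agree outside [[0, 1)]. For s
    inside, one of the two new arguments is outside, so the bound on the difference halves at every
    application. *)
Let upperE s : upper s = survival s.
Proof.
apply/eqP; rewrite -subr_eq0; apply/eqP/eq0_geometric => n.
elim: n s => [|n IH] s.
  have /andP[h1 h2] := fine_P_bound (mupper s); have /andP[h3 h4] := survival_bound s.
  by rewrite expr0 ler_norml /upper; lra.
have [s0|s0] := ltP s 0; first by rewrite upper_lt0// /survival s0 subrr normr0 exprn_ge0.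
have [s1|s1] := leP 1 s.
  by rewrite upper_ge1// /survival ltNge s0/= ltNge s1/= subrr normr0 exprn_ge0.
rewrite upper_rec survival_half.
have := IH (2 * s - 1); have := IH (2 * s); rewrite !ler_norml exprS.
have [h|h] := ltP (2 * s) 1.
  have e1 : survival (2 * s - 1) = 1 :> R by rewrite /survival ifT//; lra.
  have e2 : upper (2 * s - 1) = 1 by rewrite upper_lt0//; lra.
  by rewrite e1 e2; lra.
have e1 : survival (2 * s) = 0 :> R by rewrite /survival !ifF//; apply/negbTE; rewrite -leNgt; lra.
have e2 : upper (2 * s) = 0 by rewrite upper_ge1.
by rewrite e1 e2; lra.
Qed.

Let upper2_edge s r : s < 0 \/ 1 <= s -> upper2 s r = survival s * survival r.
Proof.
move=> [s0|s1].
  rewrite {1}/survival s0 mul1r -upperE /upper2 /upper -(doubling_law (mupper r)).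
  congr (fine (P _)); apply/seteqP; split=> x /=; first by case.
  by have /andP[h _] := even_bits_bound x; split=> //; lra.
rewrite (_ : survival s = 0) ?mul0r; last first.
  by rewrite /survival !ifF//; apply/negbTE; rewrite -leNgt; lra.
rewrite /upper2 -[RHS]fine_P0; congr (fine (P _)); apply/seteqP; split=> x //= [h' _].
by have /andP[_ h] := even_bits_bound x; lra.
Qed.

Let upper2_edger s r : r < 0 \/ 1 <= r -> upper2 s r = survival s * survival r.
Proof.
move=> [r0|r1].
  rewrite [survival r]/survival r0 mulr1 -upperE /upper2 /upper.
  congr (fine (P _)); apply/seteqP; split=> x /=; first by case.
  by have /andP[h _] := even_bits_bound (D x); split=> //; lra.
rewrite (_ : survival r = 0) ?mulr0; last first.
  by rewrite /survival !ifF//; apply/negbTE; rewrite -leNgt; lra.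
rewrite /upper2 -[RHS]fine_P0; congr (fine (P _)); apply/seteqP; split=> x //= [_ h'].
by have /andP[_ h] := even_bits_bound (D x); lra.
Qed.

(** The halving argument of [upperE] again: the recursion works on s and r alternately, and each
    time one of its two terms is known exactly. *)
Let upper2E s r : upper2 s r = survival s * survival r.
Proof.
apply/eqP; rewrite -subr_eq0; apply/eqP/eq0_geometric => n.
elim: n s r => [|n IH] s r.
  have /andP[h1 h2] := fine_P_bound (mupper2 s r).
  have /andP[h3 h4] := survival_bound s; have /andP[h5 h6] := survival_bound r.
  by rewrite expr0 ler_norml /upper2; nra.
have [s0|s0] := ltP s 0; first by rewrite upper2_edge ?subrr ?normr0 ?exprn_ge0//; left.
have [s1|s1] := leP 1 s; first by rewrite upper2_edge ?subrr ?normr0 ?exprn_ge0//; right.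
rewrite upper2_rec (survival_half s).
have := IH r (2 * s - 1); have := IH r (2 * s); rewrite !ler_norml exprS.
have [h|h] := ltP (2 * s) 1.
  have e : upper2 r (2 * s - 1) = survival r * survival (2 * s - 1).
    by rewrite upper2_edger//; left; lra.
  by rewrite e; lra.
have e : upper2 r (2 * s) = survival r * survival (2 * s) by rewrite upper2_edger//; right.
by rewrite e; lra.
Qed.

Definition odd_bits x : R := even_bits (D x).

Lemma measurable_odd_bits : measurable_fun setT (odd_bits : measurableTypeR R -> measurableTypeR R).
Proof. exact: (measurableT_comp mE mD). Qed.

Theorem even_odd_law (A A' : set R) : measurable A -> measurable A' ->
  P (even_bits @^-1` A `&` odd_bits @^-1` A') = (P A * P A')%E.
Proof.
move=> mA mA'.
have mEA : measurable (even_bits @^-1` A).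
  by rewrite -[_ @^-1` _]setTI; apply: mE => //; exact: mA.
rewrite -(finP mA).
have [PA0 _] := andP (fine_P_bound mA).
apply: (halfline_law (P := P) measurable_odd_bits mEA PA0 _ mA') => r.
rewrite uniform01_halfline finP// muleC setIC.
rewrite (_ : odd_bits @^-1` _ = [set x | r < even_bits (D x)]); last first.
  by apply/seteqP; split=> x /=; rewrite in_itv/= andbT.
have [r0 _] := andP (survival_bound r).
apply: (halfline_law (P := P) mE (mupperD r) r0 _ mA) => s.
rewrite uniform01_halfline -EFinM mulrC -upper2E /upper2 finP//.
by congr (P _); apply/seteqP; split=> x /=; rewrite in_itv/= andbT => -[].
Qed.

End EvenBits.

Section Stream.
Context {R : realType}.
Local Notation P := (@uniform01 R).
Local Notation mR := (measurableTypeR R).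

(** The odd digits serve as a reservoir: each term of the stream takes the even digits of what is
    left and passes the odd ones on. *)
Definition stream_tail l : R -> R := iter l odd_bits.
Definition stream l (w : R) : R := even_bits (stream_tail l w).

(* Events decided by the first l terms of the stream. *)
Fixpoint history l : set (set R) :=
  if l is n.+1 then
    preimage_set_system setT (fun w : R => (w, stream n w) : g_sigma_algebraType (history n) * mR)
      measurable
  else preimage_set_system setT (fun=> 0 : mR) measurable.

Lemma history_sigma l : sigma_algebra setT (history l).
Proof.
by case: l => [|l]; apply: sigma_algebra_preimage; exact: sigma_algebra_measurable.
Qed.

Lemma measurable_stream_tail l : measurable_fun setT (stream_tail l : mR -> mR).
Proof.
elim: l => [|l IH]; first exact: measurable_id.
exact: (measurableT_comp (@measurable_odd_bits R) IH).
Qed.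

Lemma measurable_stream l : measurable_fun setT (stream l : mR -> mR).
Proof. exact: (measurableT_comp (@measurable_even_bits R) (measurable_stream_tail l)). Qed.

Lemma measurable_history l S :
  measurable (S : set (g_sigma_algebraType (history l))) = history l S.
Proof. by rewrite /measurable/= sigma_algebra_id//; exact: history_sigma. Qed.

Lemma history_measurable l S : history l S -> measurable (S : set mR).
Proof.
elim: l S => [|l IH] S /= [C mC <-]; rewrite setTI.
  by rewrite -[_ @^-1` _]setTI; exact: (@measurable_cst _ _ mR mR setT 0).
rewrite -[_ @^-1` _]setTI.
have mpair : measurable_fun setT (fun w : mR => (w, stream l w) : g_sigma_algebraType (history l) * mR).
  apply/measurable_fun_pairP; split; last exact: measurable_stream.
  by move=> _ A; rewrite measurable_history setTI => /IH.
exact: mpair.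
Qed.

Lemma history_succ l : history l `<=` history l.+1.
Proof.
move=> S HS; exists (S `*` setT).
  by apply: measurableX => //; rewrite measurable_history.
by rewrite setTI; apply/seteqP; split=> w //= -[].
Qed.

Lemma history_le l l' : (l <= l')%N -> history l `<=` history l'.
Proof.
elim: l' => [|l' IH]; first by rewrite leqn0 => /eqP ->.
rewrite leq_eqVlt => /orP[/eqP -> //|]; rewrite ltnS => /IH h.
exact: subset_trans h (@history_succ l').
Qed.

Lemma history_stream l (A : set mR) : measurable A -> history l.+1 (stream l @^-1` A).
Proof.
move=> mA; exists (setT `*` A); first exact: measurableX.
by rewrite setTI; apply/seteqP; split=> w //= -[].
Qed.

Lemma uniform01_even_bits (A : set mR) : measurable A -> P (even_bits @^-1` A) = P A.
Proof.
move=> mA; have := even_odd_law mA measurableT.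
by rewrite preimage_setT setIT [X in (_ * X)%E](@probability_setT _ _ _ P) mule1.
Qed.

(** For an event in the first l terms and the next one, [freeze_one] is used with the indicator of
    the remaining tail as density. Its rectangle condition is the induction hypothesis combined with
    [even_odd_law]. *)
Lemma history_tail_indep l S (A : set mR) : history l S -> measurable A ->
  P (S `&` stream_tail l @^-1` A) = (P S * P A)%E.
Proof.
elim: l S A => [|l IH] S A.
  move=> [C mC <-] mA; rewrite setTI.
  have [C0|nC0] := pselect (C 0).
    rewrite (_ : _ @^-1` C = setT); last by apply/seteqP; split.
    by rewrite setTI [X in (X * _)%E](@probability_setT _ _ _ P) mul1e.
  rewrite (_ : _ @^-1` C = set0); last by apply/seteqP; split.
  by rewrite set0I measure0 mul0e.
move=> [C mC <-] mA; rewrite setTI.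
pose TG : measurableType _ := g_sigma_algebraType (history l).
have mid : measurable_fun setT (id : mR -> TG).
  by move=> _ S'; rewrite measurable_history setTI; exact: history_measurable.
have mpre D : measurable (D : set mR) -> measurable (stream_tail l.+1 @^-1` D : set mR).
  by move=> mD; rewrite -[_ @^-1` _]setTI; apply: measurable_stream_tail.
have mC' : measurable ((fun w : mR => (w, stream l w) : TG * mR) @^-1` C).
  by apply: (@history_measurable l.+1); exists C => //; rewrite setTI.
have key (D : set mR) : measurable D ->
    (P ((fun w : mR => (w, stream l w) : TG * mR) @^-1` C `&` stream_tail l.+1 @^-1` D) =
     (\int[P]_w \int[P]_z (\1_C ((w, z) : TG * mR))%:E) * P D)%E.
  move=> mD.
  have finD : ((fine (P D))%:E = P D)%E by rewrite fineK// fin_num_measure.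
  have [D0 D1] : 0 <= fine (P D) /\ fine (P D) <= 1.
    by rewrite -!lee_fin finD; split; [exact: measure_ge0|exact: probability_le1].
  pose g : mR -> R := \1_(stream_tail l.+1 @^-1` D).
  have mg : measurable_fun setT g by apply: measurable_indic; exact: mpre.
  have g0 w : 0 <= g w by rewrite /g indicE.
  pose H : mR -> R := cst (fine (P D)).
  have mH : measurable_fun setT H by exact: measurable_cst.
  have H0 w : 0 <= H w by [].
  have H1 w : H w <= 1 by [].
  have rect (S' : set TG) (A' : set mR) : measurable S' -> measurable A' ->
    (\int[P]_(w in id @^-1` S' `&` stream l @^-1` A') (g w)%:E =
     (\int[P]_(w in id @^-1` S') (H w)%:E) * P A')%E.
    rewrite measurable_history => HS mA'; have mS' := history_measurable HS.
    have mVA : measurable (stream l @^-1` A' : set mR).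
      by rewrite -[_ @^-1` _]setTI; apply: measurable_stream.
    rewrite integral_indic//; last 2 first.
    - exact: measurableI.
    - exact: mpre.
    have -> : (\int[P]_(w in id @^-1` S') (H w)%:E = P D * P S')%E.
      by apply: etrans (integral_cst P mS' (fine (P D))%:E) _; rewrite finD.
    transitivity (P (S' `&` stream_tail l @^-1` (even_bits @^-1` A' `&` odd_bits @^-1` D))).
      by congr (P _); apply/seteqP; split=> w /= [h1 [h2 h3]].
    have mEA : measurable (even_bits @^-1` A' : set mR).
      by rewrite -[_ @^-1` _]setTI; apply: measurable_even_bits.
    have mOD : measurable (odd_bits @^-1` D : set mR).
      by rewrite -[_ @^-1` _]setTI; apply: measurable_odd_bits.
    rewrite IH//; last exact: measurableI.
    rewrite even_odd_law// [LHS]muleC [RHS]muleAC; congr (_ * _)%E; exact: muleC.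
  have mf : measurable_fun setT (fun z : TG * mR => (\1_C z)%:E : \bar R).
    by apply/measurable_EFinP; exact: measurable_indic.
  have f0 z : (0 <= (\1_C (z : TG * mR))%:E :> \bar R)%E by rewrite lee_fin indicE.
  have := @freeze_one _ _ _ mR TG mR R P P id (stream l) g H 1 mid (@measurable_stream l) mg g0 mH H0 H1 rect
    (fun z => (\1_C z)%:E) mf f0.
  have mav : measurable_fun setT (fun w : mR => \int[P]_z (\1_C ((w, z) : TG * mR))%:E)%E.
    have mF : measurable_fun setT (fubini_F P (fun z : TG * mR => (\1_C z)%:E) : TG -> \bar R).
      exact: measurable_fun_fubini_tonelli_F.
    exact: (measurableT_comp mF mid).
  have av0 (w : mR) : setT w -> (0 <= \int[P]_z (\1_C ((w, z) : TG * mR))%:E)%E.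
    by move=> _; apply: integral_ge0.
  have pull := @ge0_integralZr _ mR R P setT measurableT _ mav (fine (P D))%:E av0 D0.
  move/(fun e => etrans e pull).
  rewrite finD => <-.
  rewrite -[X in P X]setIT -(integral_indic P measurableT); last exact: measurableI mC' (mpre _ mD).
  apply: eq_integral => w _; rewrite -EFinM /g indicI; congr ((_ * _)%:E).
(* The double integral is not computed: [key] for the whole space identifies it with the probability
   of the event. *)
rewrite (key A mA) -[in RHS](setIT (_ @^-1` C)) (key setT measurableT).
by rewrite [X in (_ * X * _)%E](@probability_setT _ _ _ P) mule1.
Qed.

Corollary history_stream_indep l S (A : set mR) : history l S -> measurable A ->
  P (S `&` stream l @^-1` A) = (P S * P A)%E.
Proof.
move=> HS mA; rewrite -(uniform01_even_bits mA) -(@history_tail_indep l)//.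
by rewrite -[_ @^-1` _]setTI; exact: measurable_even_bits.
Qed.

End Stream.

Section Quantile.
Context {R : realType} (gam : probability (measurableTypeR R) R).
Local Notation P := (@uniform01 R).
Local Notation mR := (measurableTypeR R).

(** Distribution functions are defined for random variables; that of [gam] itself is the one of the
    identity. *)
Let idR : mR -> R := idfun.

#[local] HB.instance Definition _ :=
  @isMeasurableFun.Build _ _ _ _ idR (@measurable_id _ _ setT).

Let F (r : R) : R := fine (cdf (idR : {RV gam >-> R}) r).

Let FE r : (F r)%:E = gam `]-oo, r]%classic.
Proof. by rewrite /F fineK ?fin_num_measure//; exact: measurable_itv. Qed.

Let F_nondecreasing r s : r <= s -> F r <= F s.
Proof. by move=> rs; rewrite -lee_fin !FE; exact: (cdf_nondecreasing (idR : {RV gam >-> R}) rs). Qed.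

Let F_right r u : F r < u -> exists2 s, r < s & F s < u.
Proof.
move=> ru; have : F x @[x --> r^'+] --> F r.
  apply: fine_cvg; rewrite FE; exact: cdf_right_continuous.
move=> /cvgr_lt/(_ _ ru) h.
have : \forall s \near r^'+, r < s /\ F s < u.
  by near=> s; split; [near: s; exact: nbhs_right_gt|near: s; exact: h].
by move=> /filter_ex[s [rs su]]; exists s.
Unshelve. all: by end_near.
Qed.

Let F_large u : u < 1 -> exists r, u < F r.
Proof.
move=> u1; have : F x @[x --> +oo] --> (1 : R) by apply: fine_cvg; exact: cvg_cdfy1.
by move=> /cvgr_gt/(_ _ u1)/filter_ex[s su]; exists s.
Qed.

Let F_small u : 0 < u -> exists r, F r < u.
Proof.
move=> u0; have : F x @[x --> -oo] --> (0 : R) by apply: fine_cvg; exact: cvg_cdfNy0.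
by move=> /cvgr_lt/(_ _ u0)/filter_ex[s su]; exists s.
Qed.

(** The generalised inverse of the distribution function. Outside []0, 1[] the set may be empty or
    unbounded, so the value 0 is imposed there. Right continuity of [F] makes [s < quantile u]
    equivalent to [F s < u] inside. *)
Definition quantile (u : R) : R := if (0 < u) && (u < 1) then sup [set z | F z < u] else 0.

Let quantile_gt s u : 0 < u < 1 -> (s < quantile u) = (F s < u).
Proof.
move=> u01; rewrite /quantile u01; have /andP[u0 u1] := u01.
have ne : [set z | F z < u] !=set0 by have [r] := F_small u0; exists r.
have ub : has_ubound [set z | F z < u].
  have [r ur] := F_large u1; exists r => z /= zu.
  by rewrite leNgt; apply/negP => /ltW/F_nondecreasing; lra.
apply/idP/idP => [/(sup_gt ne)[z /= zu sz]|su].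
  by apply: le_lt_trans zu; apply: F_nondecreasing; exact: ltW.
have [z sz zu] := F_right su.
by apply: (lt_le_trans sz); apply: ub_le_sup.
Qed.

Let quantile_halfline s : quantile @^-1` `]s, +oo[%classic =
  (`]F s, +oo[%classic `&` `]0, 1[%classic) `|` (if s < 0 then ~` `]0, 1[%classic else set0).
Proof.
apply/seteqP; split=> u /=; rewrite !in_itv/= !andbT.
  have [u01|u01] := boolP (0 < u < 1); first by rewrite quantile_gt// => h; left.
  by rewrite /quantile (negbTE u01) => h; right; rewrite h/= in_itv/=; exact/negP.
move=> [[h u01]|]; first by rewrite quantile_gt.
case: ifP => // s0 /=; rewrite in_itv/= => /negP u01.
by rewrite /quantile (negbTE u01).
Qed.

Lemma measurable_quantile : measurable_fun setT (quantile : mR -> mR).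
Proof.
apply: (measurability _ (RGenOInfty.measurableE R)) => //= _ [_ [s ->] <-].
rewrite setTI [X in measurable X]quantile_halfline.
apply: measurableU; first by apply: measurableI; exact: measurable_itv.
by case: ifP => _; [apply: measurableC; exact: measurable_itv|exact: measurable0].
Qed.

Let uniform01_endpoints : P (~` `]0, 1[%classic) = 0%E.
Proof.
rewrite probability_setC; last exact: measurable_itv.
rewrite uniform01E; last exact: measurable_itv.
rewrite (_ : _ `&` _ = `]0, 1[%classic); last first.
  by apply/seteqP; split=> x /=; rewrite !in_itv/=; [case|move=> /andP[h1 h2]; rewrite h1 h2 !ltW].
rewrite (_ : lebesgue_measure _ = 1%E) ?subee//.
by apply: etrans (lebesgue_measure_itv _) _; rewrite /= lte_fin ltr01 oppr0 adde0.
Qed.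

Lemma quantile_law (A : set mR) : measurable A -> P (quantile @^-1` A) = gam A.
Proof.
move=> mA; rewrite -[_ @^-1` A]setTI -[RHS]mul1e.
apply: (halfline_law (P := P) measurable_quantile measurableT ler01 _ mA) => s.
rewrite setTI mul1e quantile_halfline.
pose I := `]0, 1[%classic : set mR.
have mI : measurable I by exact: measurable_itv.
have mB : measurable (`]F s, +oo[%classic : set mR) by exact: measurable_itv.
(* The value imposed outside []0, 1[] affects a null set only, so parts there may be dropped or
   added freely. *)
have null (N : set mR) : measurable N -> N `<=` ~` I -> P N = 0%E.
  move=> mN NI; apply/eqP; rewrite eq_le measure_ge0 andbT -uniform01_endpoints.
  by apply: le_measure => //; rewrite inE//; exact: measurableC.
have split_null (B N : set mR) : measurable B -> measurable N -> N `<=` ~` I ->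
    P ((B `&` I) `|` N) = P (B `&` I).
  move=> mB' mN NI; rewrite measureU//; last 2 first.
  - exact: measurableI.
  - by apply/seteqP; split=> x //= [[_ Ix] /NI].
  by rewrite [X in (_ + X)%E](null _ mN NI) adde0.
rewrite split_null//; last 2 first.
- by case: ifP => _; [exact: measurableC|exact: measurable0].
- by case: ifP => _ x.
rewrite -(split_null _ (`]F s, +oo[%classic `&` ~` I))//; last first.
  by apply: measurableI => //; exact: measurableC.
rewrite -setIUr setUv setIT uniform01_halfline.
rewrite (_ : `]s, +oo[%classic = ~` `]-oo, s]%classic); last first.
  by rewrite setCitvl.
rewrite probability_setC; last exact: measurable_itv.
rewrite -FE -EFinB; congr (_%:E).
have F0 : 0 <= F s by rewrite -lee_fin FE.
have F1 : F s <= 1 by rewrite -lee_fin FE; apply: probability_le1; exact: measurable_itv.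
by rewrite /survival; case: ltP => [|_]; [lra|case: ltP => ?; lra].
Qed.

End Quantile.

(** * The converse *)

Section GaussianDriver.
Context {R : realType} {k : nat}.
Local Notation P := (@uniform01 R).
Local Notation mR := (measurableTypeR R).

(** Coordinate i uses the term [n + i]; with n a multiple of k, successive blocks use disjoint parts
    of the stream. *)
Definition stream_block (gam : probability mR R) n (w : R) : 'cV[R]_k :=
  \col_i quantile gam (stream (n + i) w).

Lemma history_stream_block gam n i :
  sub_measurable (history (n + k)) (fun w : mR => stream_block gam n w i 0).
Proof.
move=> A mA; apply: (@history_le _ (n + i).+1); first by rewrite -addnS leq_add2l.
rewrite (_ : _ @^-1` A = stream (n + i) @^-1` (quantile gam @^-1` A)); last first.
  by apply/seteqP; split=> w /=; rewrite mxE.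
apply: history_stream; rewrite -[_ @^-1` _]setTI.
by apply: measurable_quantile => //; exact: mA.
Qed.

Lemma historyI l (S S' : set R) : history l S -> history l S' -> history l (S `&` S').
Proof. by rewrite -!measurable_history; exact: measurableI. Qed.

Lemma history_block_indep gam n (S : set mR) (A : 'I_k -> set R) : history n S ->
  (forall i, measurable (A i)) ->
  P (S `&` [set w | forall i, A i (stream_block gam n w i 0)]) =
  (P S * \prod_(i < k) gam (A i))%E.
Proof.
move=> HS mA.
have mqA i : measurable (quantile gam @^-1` A i : set mR).
  by rewrite -[_ @^-1` _]setTI; apply: measurable_quantile => //; exact: mA.
have step j : (j <= k)%N ->
    history (n + j) (S `&` [set w | forall i : 'I_k, (i < j)%N -> A i (stream_block gam n w i 0)]) /\
    P (S `&` [set w | forall i : 'I_k, (i < j)%N -> A i (stream_block gam n w i 0)]) =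
    (P S * \prod_(i < k | (i < j)%N) gam (A i))%E.
  elim: j => [|j IH] jk.
    rewrite big_pred0 ?mule1// addn0 (_ : [set w | _] = setT) ?setIT//.
    by apply/seteqP; split.
  have [HSj PSj] := IH (ltnW jk); pose j0 : 'I_k := Ordinal jk.
  have lt_succ (i : 'I_k) : (i < j.+1)%N = (i == j0) || (i < j)%N by rewrite ltnS leq_eqVlt.
  have E : S `&` [set w | forall i : 'I_k, (i < j.+1)%N -> A i (stream_block gam n w i 0)] =
     (S `&` [set w | forall i : 'I_k, (i < j)%N -> A i (stream_block gam n w i 0)])
     `&` stream (n + j) @^-1` (quantile gam @^-1` A j0).
    rewrite -setIA; congr (S `&` _); apply/seteqP; split=> w /=.
      move=> h; split=> [i ij|]; first by apply: h; exact: ltnW.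
      by have := h j0 (ltnSn j); rewrite mxE.
    move=> [h h0] i; rewrite lt_succ => /orP[/eqP ->|]; last exact: h.
    by rewrite mxE.
  have Hst := @history_stream R (n + j) _ (mqA j0).
  split.
    rewrite E addnS.
    by apply: historyI => //; exact: history_succ.
  rewrite E (history_stream_indep HSj (mqA j0)) PSj quantile_law; last exact: mA.
  rewrite -muleA; congr (_ * _)%E.
  rewrite [RHS](bigD1 j0)//= muleC; congr (_ * _)%E; apply: eq_bigl => i.
  by rewrite lt_succ; case: eqP => [->|]; rewrite ?ltnn ?andbF//= andbT.
have [_] := step k (leqnn k).
rewrite (_ : [set w | _] = [set w | forall i, A i (stream_block gam n w i 0)]).
  by move=> ->; congr (_ * _)%E; apply: eq_bigl => i; rewrite ltn_ord.
by apply/seteqP; split=> w /= h i; [apply: h|move=> _; exact: h].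
Qed.

End GaussianDriver.

Section EulerExistence.
Context {R : realType} {m k : nat}.
Variables (M : set 'cV[R]_m) (mu : 'cV[R]_m -> 'cV[R]_m) (sigma : 'cV[R]_m -> 'M[R]_(m, k)).
Variable t : nat -> R.
Hypotheses (M_open : open M) (t_grid : time_grid t).
Hypothesis mu_cont : forall i x, M x -> {for x, continuous (fun y => mu y i 0)}.
Hypothesis sigma_cont : forall i j x, M x -> {for x, continuous (fun y => sigma y i j)}.
Hypothesis euler_in_M : forall (x : 'cV[R]_m) (l : nat) (w : 'cV[R]_k),
  M x -> M (euler mu sigma x (grid_step t l) w).
Variable x0 : 'cV[R]_m.
Hypothesis x0_in : M x0.
Local Notation P := (@uniform01 R).
Local Notation mR := (measurableTypeR R).

Definition brownian_increment l (w : mR) : 'cV[R]_k :=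
  stream_block (normal_prob 0 (Num.sqrt (grid_step t l))) (l * k) w.

Definition brownian_driver l (w : mR) : 'cV[R]_(1 + k) :=
  \sum_(j < l) col_mx (grid_step t j)%:M (brownian_increment j w).

Fixpoint euler_process l (w : mR) : 'cV[R]_m :=
  if l is n.+1 then euler mu sigma (euler_process n w) (grid_step t n) (brownian_increment n w)
  else x0.

(** Each time step consumes k terms of the stream, one per Brownian coordinate. *)
Let G l : set (set mR) := history (l * k).

Let G_sigma l : sigma_algebra setT (G l). Proof. exact: history_sigma. Qed.

Let G_le l l' : (l <= l')%N -> G l `<=` G l'.
Proof. by move=> h; apply: history_le; rewrite leq_mul2r h orbT. Qed.

Let G_increment l i : sub_measurable (G l.+1) (fun w => brownian_increment l w i 0).
Proof. by rewrite /G mulSn addnC; exact: history_stream_block. Qed.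

Lemma jump_brownian_driver l w :
  jump brownian_driver l w = col_mx (grid_step t l)%:M (brownian_increment l w).
Proof. by rewrite /jump /brownian_driver big_ord_recr/= [LHS]addrC addKr. Qed.

Lemma brownian_driver_time l w : brownian_driver l w 0 0 = t l.
Proof.
elim: l => [|l IH]; first by rewrite /brownian_driver big_ord0 mxE t_grid.1.
have := congr1 (fun u : 'cV_(1 + k) => u 0 0) (jump_brownian_driver l w).
rewrite /jump mxE [X in _ + X]mxE IH => /eqP; rewrite subr_eq => /eqP ->.
have -> : (0 : 'I_(1 + k)) = lshift k 0 by exact/val_inj.
by rewrite col_mxEu !mxE/= mulr1n /grid_step subrK.
Qed.

Lemma euler_process_in l w : M (euler_process l w).
Proof. by elim: l => [|l IH] //=; exact: euler_in_M. Qed.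

Let adapted_process : adapted G euler_process.
Proof.
elim=> [|l IH] i; rewrite -/(sub_measurable _ _).
  by apply: sub_measurable_cst.
have GX j : sub_measurable (G l.+1) (fun w => euler_process l w j 0).
  exact: sub_measurable_le (G_le (leqnSn l)) (IH j).
have Gf (f : 'cV[R]_m -> R) : (forall x, M x -> {for x, continuous f}) ->
    sub_measurable (G l.+1) (fun w => f (euler_process l w)).
  by move=> fc; apply: (sub_measurable_continuous (G_sigma l.+1) M_open (euler_process_in l) fc).
rewrite (_ : (fun w => _) = fun w => euler_process l w i 0
    + (grid_step t l * mu (euler_process l w) i 0
    + \sum_j sigma (euler_process l w) i j * brownian_increment l w j 0)); last first.
  by apply/funext => w; rewrite /= !mxE addrA.
apply: sub_measurable_add => //; apply: sub_measurable_add => //.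
  apply: sub_measurable_mul => //; first exact: sub_measurable_cst.
  exact: (Gf (fun y => mu y i 0) (@mu_cont i)).
apply: sub_measurable_sum => // j; apply: sub_measurable_mul => //.
exact: (Gf (fun y => sigma y i j) (@sigma_cont i j)).
Qed.

Let adapted_driver : adapted G brownian_driver.
Proof.
move=> l i; rewrite -/(sub_measurable _ _) /brownian_driver.
under eq_fun do rewrite summxE; apply: sub_measurable_sum => // j.
apply: (sub_measurable_le (G_le (ltn_ord j))).
case: (splitP i) => i' ii'.
  have -> : i = lshift k i' by exact/val_inj.
  under eq_fun do rewrite col_mxEu; exact: sub_measurable_cst.
have -> : i = rshift 1 i' by exact/val_inj.
by under eq_fun do rewrite col_mxEd; exact: G_increment.
Qed.

Theorem euler_solution_exists : euler_solution t M mu sigma P euler_process brownian_driver.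
Proof.
exists G; split.
- split=> [//|l S|l]; first exact: history_measurable.
  exact: G_le.
- by split=> // l w; exact: euler_process_in.
- split=> //.
  + by apply: aeW => w; rewrite /brownian_driver big_ord0.
  + by move=> l; apply: aeW => w; exact: brownian_driver_time.
  + move=> l S A GS mA; rewrite -(history_block_indep _ GS mA); congr (P (S `&` _)).
    by apply/seteqP; split=> w /= h a; have := h a; rewrite jump_brownian_driver col_mxKd.
- move=> l; apply: aeW => w; rewrite jump_brownian_driver col_mxKd /=.
  have -> : (0 : 'I_(1 + k)) = lshift k 0 by exact/val_inj.
  by rewrite col_mxEu !mxE/= mulr1n.
Qed.

End EulerExistence.

Section FullSupport.
Context {R : realType}.

(** On the interval the density is at least its value [c] at the larger absolute value [K] of the
    two ends. *)
Lemma normal_prob_itv_gt0 (s a b : R) : s != 0 -> a < b ->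
  (0 < normal_prob 0 s `]a, b[%classic)%E.
Proof.
move=> s0 ab; pose K := Num.max `|a| `|b|.
pose c := normal_peak s * expR (- K ^+ 2 / (s ^+ 2 *+ 2)).
have c0 : 0 < c by rewrite mulr_gt0// ?expR_gt0// normal_peak_gt0.
apply: (@lt_le_trans _ _ (\int[lebesgue_measure]_(x in `]a, b[) c%:E)%E).
  rewrite integral_cst//= lebesgue_measure_itv/= lte_fin ab -EFinB -EFinM lte_fin.
  by rewrite mulr_gt0// subr_gt0.
apply: ge0_le_integral => //.
- by move=> x _; rewrite lee_fin ltW.
- by apply: measurable_funTS; apply/measurable_EFinP; exact: measurable_normal_pdf.
move=> x /=; rewrite in_itv/= => /andP[ax xb]; rewrite lee_fin normal_pdfS// subr0.
rewrite /c ler_pM2l ?normal_peak_gt0// ler_expR ler_pM2r; last first.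
  by rewrite invr_gt0 pmulrn_rgt0// exprn_even_gt0.
rewrite lerN2 -[x ^+ 2]real_normK ?num_real// ler_pXn2r ?nnegrE//; last first.
  by rewrite /K le_max normr_ge0.
rewrite /K le_max; have [x0|x0] := leP 0 x.
  by apply/orP; right; rewrite ger0_norm// (le_trans (ltW xb))// ler_norm.
apply/orP; left; rewrite ltr0_norm// (@le_trans _ _ (- a)) ?lerN2 ?(ltW ax)//.
by rewrite -normrN ler_norm.
Qed.

End FullSupport.

Section EntrywiseContinuity.
Context {R : realType} {U : topologicalType}.

Lemma continuous_at_sub (f g : U -> R) x : {for x, continuous f} -> {for x, continuous g} ->
  {for x, continuous (fun y => f y - g y)}.
Proof. by move=> fx gx; exact: cvgB. Qed.

Lemma continuous_at_neq0 (f : U -> R) x : {for x, continuous f} -> f x != 0 ->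
  \forall y \near x, f y != 0.
Proof. by move=> fx fx0; exact: cvgr_neq0 fx fx0. Qed.

Lemma continuous_at_entrywise p q (F : U -> 'M[R]_(p, q)) x :
  (forall i j, {for x, continuous (fun y => F y i j)}) -> {for x, continuous F}.
Proof.
move=> Fc; apply/cvgrPdist_le => e e0.
apply: (@near_forall_imp _ _ (nbhs x) _ (fun ij y => `|F x ij.1 ij.2 - F y ij.1 ij.2| <= e)) => [y h|ij].
  by apply: mx_norm_le => [|i j]; [exact: ltW|have := h (i, j); rewrite !mxE].
by have := Fc ij.1 ij.2; move=> /cvgrPdist_le; apply.
Qed.

End EntrywiseContinuity.

(** * Equivariance forced by a symmetry *)

Section Converse.
Context {R : realType} {m k : nat}.
Variables (M : set 'cV[R]_m) (mu : 'cV[R]_m -> 'cV[R]_m) (sigma : 'cV[R]_m -> 'M[R]_(m, k)).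
Variable t : nat -> R.
Hypotheses (M_open : open M) (t_grid : time_grid t).
Hypotheses (mu_smooth : smooth_on M mu) (sigma_smooth : smooth_on M sigma).
Hypothesis euler_in_M : forall (x : 'cV[R]_m) (l : nat) (w : 'cV[R]_k),
  M x -> M (euler mu sigma x (grid_step t l) w).
Variable x0 : 'cV[R]_m.
Hypothesis x0_in : M x0.
Local Notation P := (@uniform01 R).
Local Notation mR := (measurableTypeR R).

(** The spanning condition in usable form: a right inverse [Q] selects an increment that produces
    any prescribed displacement. *)
Lemma spanning_columns_onto :
  (<< [seq col a (sigma x0) | a <- enum 'I_k] >> = fullv)%VS ->
  exists Q : 'M[R]_(k, m), sigma x0 *m Q = 1%:M.
Proof.
move=> full.
have onto (y : 'cV[R]_m) : exists u : 'cV[R]_k, sigma x0 *m u = y.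
  have : y \in (<< [seq col a (sigma x0) | a <- enum 'I_k] >>)%VS by rewrite full memvf.
  move=> /(@coord_span _ _ _ (in_tuple _)) ->.
  elim/big_ind: _ => [|y1 y2 [u1 <-] [u2 <-]|l _].
  - by exists 0; rewrite mulmx0.
  - by exists (u1 + u2); rewrite mulmxDr.
  have sz : size [seq col a (sigma x0) | a <- enum 'I_k] = k by rewrite size_map size_enum_ord.
  have lk : (l < k)%N by rewrite -[X in (_ < X)%N]sz.
  exists (coord (in_tuple [seq col a (sigma x0) | a <- enum 'I_k]) l y *: delta_mx (Ordinal lk) 0).
  rewrite -scalemxAr -colE (nth_map (Ordinal lk)) ?size_enum_ord//.
  by have := nth_ord_enum (Ordinal lk) (Ordinal lk) => /= ->.
have /choice[q qE] : forall j : 'I_m, exists u : 'cV[R]_k, sigma x0 *m u = delta_mx j 0.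
  by move=> j; exact: onto.
exists (\matrix_(l, j) q j l 0); apply/matrixP => i j.
have := congr1 (fun y : 'cV_m => y i 0) (qE j); rewrite !mxE eqxx andbT => <-.
by apply: eq_bigr => l _; rewrite mxE.
Qed.

Lemma smooth_on_continuous p q (g : 'cV[R]_m -> 'M[R]_(p, q)) i j x :
  smooth_on M g -> M x -> {for x, continuous (fun y => g y i j)}.
Proof. by move=> /(_ 0%N i j)[h _] Mx; exact: h. Qed.

Section OneMap.
Variables (Phi : 'cV[R]_m -> 'cV[R]_m) (B : 'cV[R]_m -> 'M[R]_k).
Hypothesis sym : euler_weak_symmetry t M mu sigma Phi B.

Let dt := grid_step t 0.

Let equivariant_ae : {ae P, forall w : mR,
  Phi (euler mu sigma x0 dt (brownian_increment t 0 w)) =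
  euler mu sigma (Phi x0) dt (B x0 *m (brownian_increment t 0 w : 'cV[R]_k))}.
Proof.
have [_ _ _ preserve] := sym.
have mu_cont i x : M x -> {for x, continuous (fun y => mu y i 0)}.
  exact: smooth_on_continuous.
have sigma_cont i j x : M x -> {for x, continuous (fun y => sigma y i j)}.
  exact: smooth_on_continuous.
have sol := euler_solution_exists M_open t_grid mu_cont sigma_cont euler_in_M x0_in.
have [G [_ _ _ /(_ 0%N)]] := preserve _ _ _ _ _ sol.
apply: filterS => w; rewrite jump_transform_driver col_mxKd.
rewrite jump_brownian_driver col_mxKd /=.
have -> : (0 : 'I_(1 + k)) = lshift k 0 by exact/val_inj.
by rewrite col_mxEu !mxE/= mulr1n.
Qed.

Let Phi_cont i x : M x -> {for x, continuous (fun y => Phi y i 0)}.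
Proof. by have [[Psi [_ _ h _]] _ _ _] := sym; exact: smooth_on_continuous. Qed.

Lemma symmetry_equivariant (u : 'cV[R]_k) :
  Phi (euler mu sigma x0 dt u) = euler mu sigma (Phi x0) dt (B x0 *m u).
Proof.
have dt0 : 0 < dt by rewrite subr_gt0 t_grid.2.
apply/matrixP => i j; rewrite ord1; apply/eqP/negPn/negP => neq.
pose f (v : 'cV[R]_k) := Phi (euler mu sigma x0 dt v) i 0
   - euler mu sigma (Phi x0) dt (B x0 *m v) i 0.
have fu : f u != 0 by rewrite subr_eq0.
have fc : {for u, continuous f}.
  apply: continuous_at_sub.
    apply: (@continuous_comp _ _ _ (fun v => euler mu sigma x0 dt v) (fun y => Phi y i 0)).
      apply: continuous_at_entrywise => i' j'.
      rewrite (_ : (fun v => _) = fun v : 'cV[R]_k => (x0 + dt *: mu x0) i' j' +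
          \sum_l sigma x0 i' l * v l 0); first exact: continuous_affine.
      by apply/funext => v; rewrite /euler mxE [(_ *m v) i' j']mxE ord1.
    by apply: Phi_cont; exact: euler_in_M.
  rewrite (_ : (fun v => _) = fun v : 'cV[R]_k => (Phi x0 + dt *: mu (Phi x0)) i 0 +
      \sum_l (sigma (Phi x0) *m B x0) i l * v l 0).
    exact: continuous_affine.
  by apply/funext => v; rewrite /euler mxE mulmxA [(_ *m v) i 0]mxE.
have [e e0 He] : exists2 e : R, 0 < e & forall v : 'cV[R]_k, (forall l, `|v l 0 - u l 0| < e) -> f v != 0.
  have nf := continuous_at_neq0 fc fu.
  have [r /= r0 rP] := (nbhs_ballP _ _).1 nf; exists (r / 2); first by rewrite divr_gt0.
  move=> v vu; apply: rP; rewrite -ball_normE /=.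
  apply: (@le_lt_trans _ _ (r / 2)); last by lra.
  apply: mx_norm_le => [|l l']; first by rewrite ltW// divr_gt0.
  by rewrite !mxE ord1 distrC ltW.
pose A (l : 'I_k) : set R := `]u l 0 - e, u l 0 + e[%classic.
have mA l : measurable (A l) by exact: measurable_itv.
have mT : history (0 * k) (setT : set R).
  by have [_ h _] := @history_sigma R (0 * k); have := h set0; rewrite setTD setC0; apply; case: (@history_sigma R (0 * k)).
have := @history_block_indep R k (normal_prob 0 (Num.sqrt dt)) (0 * k) setT A mT mA.
rewrite setTI [X in (X * _)%E](@probability_setT _ _ _ P) mul1e.
have -> : P [set w | forall l, A l (stream_block (normal_prob 0 (Num.sqrt dt)) (0 * k) w l 0)] = 0%E.
  (* The cube around u on which [f] does not vanish lies in the exceptional null set of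
     [equivariant_ae], whereas the Gaussian block hits it with positive probability. *)
  have [N [mN N0 subN]] := equivariant_ae.
  apply/eqP; rewrite eq_le measure_ge0 andbT -N0; apply: le_measure; rewrite ?inE//.
    rewrite (_ : [set w | _] = \bigcap_l ((fun w : mR =>
        stream_block (normal_prob 0 (Num.sqrt dt)) (0 * k) w l 0) @^-1` A l)); last first.
      by apply/seteqP; split=> w h l; [move=> _|]; exact: h.
    apply: fin_bigcap_measurable; first exact: finite_finset.
    by move=> l _; exact: (history_measurable (history_stream_block _ (0 * k) l (mA l))).
  move=> w /= h; apply: subN => /= E.
  have /eqP : f (stream_block (normal_prob 0 (Num.sqrt dt)) (0 * k) w) != 0.
    by apply: He => l; have := h l; rewrite /A/= in_itv/= ltr_distl.
  by apply; rewrite /f; apply/eqP; rewrite subr_eq0; apply/eqP; exact: (congr1 (fun y : 'cV_m => y i 0) E).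
move=> /esym/eqP; rewrite gt_eqF//.
elim/big_ind: _ => [|y1 y2|l _]; [exact: lte01|exact: mule_gt0|].
apply: normal_prob_itv_gt0; first by rewrite gt_eqF// sqrtr_gt0.
by lra.
Qed.

Lemma symmetry_affine (Q : 'M[R]_(k, m)) : sigma x0 *m Q = 1%:M ->
  exists (c : 'cV[R]_m) (L : 'M[R]_m), forall y, M y /\ Phi y = c + L *m y.
Proof.
move=> QE; pose z := x0 + dt *: mu x0.
(* One Euler step with increment [Q *m (y - z)] leads from [x0] to y; equivariance is affine in the
   increment, hence in y. *)
have yE y : y = euler mu sigma x0 dt (Q *m (y - z)).
  by rewrite /euler mulmxA QE mul1mx addrC subrK.
exists (Phi x0 + dt *: mu (Phi x0) - sigma (Phi x0) *m B x0 *m Q *m z), (sigma (Phi x0) *m B x0 *m Q) => y.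
split; first by rewrite (yE y); exact: euler_in_M.
rewrite {1}(yE y) symmetry_equivariant /euler !mulmxA mulmxBr.
by rewrite -!addrA; congr (_ + (_ + _)); rewrite addrC.
Qed.

End OneMap.

Theorem weak_symmetry_first_degree (Y : 'cV[R]_m -> 'cV[R]_m) (C : 'cV[R]_m -> 'M[R]_k) :
  (<< [seq col a (sigma x0) | a <- enum 'I_k] >> = fullv)%VS ->
  euler_infinitesimal_weak_symmetry t M mu sigma Y C ->
  forall i, first_degree_on M (fun x => Y x i 0).
Proof.
move=> /spanning_columns_onto[Q QE] [Phi [B [Phi_flow _ sym]]] i.
have aff a := symmetry_affine (sym a) QE.
have MT y : M y by have [c [L /(_ y)[]]] := aff 0.
pose e j : 'cV[R]_m := delta_mx j 0.
(* The affine coefficients were obtained for each a separately, without any regularity in a. Written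
   through the values of [Phi a] at 0 and at the basis vectors they become differentiable at
   [a = 0]. *)
have PhiE a y : Phi a y i 0 = Phi a 0 i 0 + \sum_j y j 0 * (Phi a (e j) i 0 - Phi a 0 i 0).
  have [c [L cL]] := aff a.
  have E x : Phi a x i 0 = c i 0 + \sum_j L i j * x j 0.
    by have [_ ->] := cL x; rewrite !mxE.
  have E0 : Phi a 0 i 0 = c i 0.
    by rewrite E big1 ?addr0// => j _; rewrite mxE mulr0.
  rewrite E E0; congr (_ + _); apply: eq_bigr => j _.
  rewrite E addrC addKr (bigD1 j)//= big1 ?addr0; last first.
    by move=> l lj; rewrite /e mxE (negbTE lj) mulr0.
  by rewrite /e mxE !eqxx mulr1 mulrC.
have d x : is_derive (0 : R) (1 : R) (fun a => Phi a x i 0) (Y x i 0).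
  have [P0 /(_ 0)[_ h]] := Phi_flow x (MT x).
  by have := (is_derive_mxP _ _ _ _).1 h i 0; rewrite P0.
exists (Y 0 i 0), (fun j => Y (e j) i 0 - Y 0 i 0) => y _.
have d1 := d y.
have d2 : is_derive (0 : R) (1 : R) (fun a => Phi a 0 i 0 + \sum_j y j 0 * (Phi a (e j) i 0 - Phi a 0 i 0))
    (Y 0 i 0 + \sum_j y j 0 * (Y (e j) i 0 - Y 0 i 0)).
  exact: (is_derive_eq (is_derive_add (d 0) (is_derive_bigsum (fun j =>
    is_derive_scal (y j 0) (is_derive_sub (d (e j)) (d 0)))))).
rewrite (funext (PhiE ^~ y)) in d1.
rewrite (etrans (esym (@derive_val _ _ _ _ _ _ _ d1)) (@derive_val _ _ _ _ _ _ _ d2)).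
by congr (_ + _); apply: eq_bigr => j _; rewrite mulrC.
Qed.

End Converse.

Theorem theorem7p3 (R : realType) (m k : nat) (M : set 'cV[R]_m)
    (mu : 'cV[R]_m -> 'cV[R]_m) (sigma : 'cV[R]_m -> 'M[R]_(m, k))
    (t : nat -> R) (Y : 'cV[R]_m -> 'cV[R]_m) (C : 'cV[R]_m -> 'M[R]_k)
    (M_open : open M) (mu_smooth : smooth_on M mu)
    (sigma_smooth : smooth_on M sigma) (t_grid : time_grid t)
    (euler_in_M : forall (x : 'cV[R]_m) (l : nat) (w : 'cV[R]_k),
       M x -> M (euler mu sigma x (grid_step t l) w))
    (V_sym : quasi_strong_symmetry M mu sigma Y C) :
  ((forall i, first_degree_on M (fun x => Y x i 0)) ->
     euler_infinitesimal_weak_symmetry t M mu sigma Y C) /\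
  (forall x0 : 'cV[R]_m, M x0 ->
     (<< [seq col a (sigma x0) | a <- enum 'I_k] >> = fullv)%VS ->
     euler_infinitesimal_weak_symmetry t M mu sigma Y C ->
     forall i, first_degree_on M (fun x => Y x i 0)).
Proof.
split=> [Y_affine|x0 x0_in span sym].
  exact: (first_degree_weak_symmetry M_open mu_smooth sigma_smooth t_grid V_sym euler_in_M Y_affine).
exact: (weak_symmetry_first_degree M_open t_grid mu_smooth sigma_smooth euler_in_M x0_in span sym).
Qed.
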